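(* Let $d\in\mathbb N$, $$p\in\Bigl(2-\frac{2}{3d+2},\,2+\frac2d\Bigr),\qquad p'=\frac{p}{p-1},\qquad \bar q:=p\,\frac{4d+2}{d(p+2)}.$$ Then for every $q\in(\max\{p,p'\},\bar q)$ there exists $C=C(d,p,q)>0$ such that the following holds. If $f\in \mathrm L^2(\mathbb R^{1+2d})$ with $\nabla_v f\in \mathrm L^p(\mathbb R^{1+2d})$ satisfies $(\partial_t+v\cdot\nabla_x)f=\nabla_v\cdot S_0$ in the sense of distributions for some $S_0\in \mathrm L^{p'}(\mathbb R^{1+2d};\mathbb R^d)$, then $$\|f\|_{\dot B^{s(q)}_{q\infty,x}\mathrm L^q_{t,v}}\le C\,\|\nabla_v f\|_{\mathrm L^p(\mathbb R^{1+2d})}^{\alpha(q)}\,\|S_0\|_{\mathrm L^{p'}(\mathbb R^{1+2d})}^{1-\alpha(q)},$$ where $$s(q)=\frac{p(4d+2)-qd(p+2)}{q\,[d(p-2)+2p+2]},\qquad \alpha(q)=\frac{3d+1}{4d+2}-\frac{d-1}{4d+2}s(q)=\frac{q[p(1+d)-d+1]-(d-1)p}{q\,[d(p-2)+2p+2]}.$$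
   Context: Points of $\mathbb R^{1+2d}$ are written $(t,x,v)$. For $s\in(0,1)$ and $q\in[1,\infty]$, the homogeneous Besov seminorm in $x$ is $$\|f\|_{\dot B^{s}_{q\infty,x}\mathrm L^q_{t,v}}:=\sup_{h\in\mathbb R^d\setminus\{0\}}\frac{\|\Delta_x^hf\|_{\mathrm L^q(\mathbb R^{1+2d})}}{|h|^s},\qquad [\Delta_x^hf](t,x,v):=f(t,x+h,v)-f(t,x,v).$$ *)

(* Defs.v *)
(* R^n is represented by n.-tuple R,
   which MathComp-Analysis equips with the product (= Borel) sigma-algebra. *)
From HB Require Import structures.
From mathcomp Require Import all_boot all_order all_algebra.
From mathcomp Require Import all_classical all_reals all_analysis.
Set Implicit Arguments.
Unset Strict Implicit.
Unset Printing Implicit Defensive.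
Import Order.TTheory GRing.Theory Num.Theory.
Import numFieldNormedType.Exports.
Local Open Scope classical_set_scope.
Local Open Scope ring_scope.

Section kinetic_defs.
Variable R : realType.

(** Lebesgue integral over R^n, written as the iterated one-dimensional
    Lebesgue integral (Tonelli/Fubini: it coincides with the integral for
    the n-dimensional Lebesgue measure on nonnegative measurable or on
    integrable functions). *)
Fixpoint iint (n : nat) : (n.-tuple R -> \bar R) -> \bar R :=
  match n with
  | 0 => fun g => g [tuple]
  | m.+1 => fun g =>
      (\int[@lebesgue_measure R]_x iint (fun y : m.-tuple R => g [tuple of x :: y]))%E
  end.

Definition Ipow (n : nat) (p : R) (f : n.-tuple R -> R) : \bar R :=
  iint (fun z => ((`|f z|) `^ p)%:E).

Definition Lp_norm (n : nat) (p : R) (f : n.-tuple R -> R) : \bar R :=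
  (Ipow p f `^ p^-1)%E.

Definition vnorm (n d : nat) (F : 'I_d -> n.-tuple R -> R) : n.-tuple R -> R :=
  fun z => Num.sqrt (\sum_(i < d) (F i z) ^+ 2).

Definition eucl (d : nat) (h : d.-tuple R) : R :=
  Num.sqrt (\sum_(i < d) (tnth h i) ^+ 2).

Definition upd (n : nat) (z : n.-tuple R) (k : 'I_n) (s : R) : n.-tuple R :=
  [tuple tnth z j + (if j == k then s else 0) | j < n].

Definition partial (n : nat) (k : 'I_n) (phi : n.-tuple R -> R) : n.-tuple R -> R :=
  fun z => derive1 (fun s : R => phi (upd z k s)) 0.

Definition has_partial (n : nat) (k : 'I_n) (phi : n.-tuple R -> R) : Prop :=
  forall z, derivable (fun s : R => phi (upd z k s)) 0 1.

Definition cont_Rn (n : nat) (phi : n.-tuple R -> R) : Prop :=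
  forall z (e : R), 0 < e -> exists2 del : R, 0 < del &
    forall w, (forall j, `|tnth w j - tnth z j| < del) -> `|phi w - phi z| < e.

Definition smooth (n : nat) (phi : n.-tuple R -> R) : Prop :=
  forall ks : seq 'I_n,
    let psi := foldr (@partial n) phi ks in
    cont_Rn psi /\ forall k, has_partial k psi.

Definition compact_support (n : nat) (phi : n.-tuple R -> R) : Prop :=
  exists M : R, forall z, (exists j, M < `|tnth z j|) -> phi z = 0.

Definition test_fun (n : nat) (phi : n.-tuple R -> R) : Prop :=
  smooth phi /\ compact_support phi.

(** Coordinates on R^{1+2d} = R_t x R^d_x x R^d_v *)
Definition tidx (d : nat) : 'I_(1 + d + d) := lshift d (lshift d (@ord0 0)).
Definition xidx (d : nat) (i : 'I_d) : 'I_(1 + d + d) := lshift d (rshift 1 i).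
Definition vidx (d : nat) (i : 'I_d) : 'I_(1 + d + d) := rshift (1 + d) i.

Definition xpart (d : nat) (h : d.-tuple R) (j : 'I_(1 + d + d)) : R :=
  match fintype.split j with
  | inl j1 => match fintype.split j1 with inl _ => 0 | inr i => tnth h i end
  | inr _ => 0
  end.

Definition Delta_x (d : nat) (h : d.-tuple R) (f : (1 + d + d).-tuple R -> R) :
    (1 + d + d).-tuple R -> R :=
  fun z => f [tuple tnth z j + xpart h j | j < 1 + d + d] - f z.

Definition weak_grad_v (d : nat) (f : (1 + d + d).-tuple R -> R)
    (g : 'I_d -> (1 + d + d).-tuple R -> R) : Prop :=
  forall phi, test_fun phi -> forall i : 'I_d,
    iint (fun z => (f z * partial (vidx i) phi z)%:E)
    = (- iint (fun z => (g i z * phi z)%:E))%E.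

Definition kinetic_eq (d : nat) (f : (1 + d + d).-tuple R -> R)
    (S0 : 'I_d -> (1 + d + d).-tuple R -> R) : Prop :=
  forall phi, test_fun phi ->
    iint (fun z => (f z * (partial (tidx d) phi z
            + \sum_(i < d) tnth z (vidx i) * partial (xidx i) phi z))%:E)
    = iint (fun z => (\sum_(i < d) S0 i z * partial (vidx i) phi z)%:E).

End kinetic_defs.

(* Main.v *)
(** For scales tau, nu > 0 let f_(tau,nu)(z) be the integral of f(z o (tau w_t, tau nu w_x, nu w_v))
    against a fixed kernel K(w) dw, where o is the Galilean group law. The difference between
    two consecutive scales is an integral of f against K - K^c; writing K - K^c as a divergence,
    trading d_t for Y - v.d_x with Y = d_t + v.d_x, and d_(x_i) for the commutator [d_(v_i), Y],
    it becomes Y Psi + sum_i d_(v_i) Phi_i, so the equation turns the difference into averages of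
    (tau / nu) S_0 and nu grad_v f. Young's inequality bounds these averages in L^q by a negative
    power of the volume of the kinetic box. Translating in x by h gains min(1, |h| / (tau nu)),
    by smoothness of the kernels. With tau nu = r = 2^j |h| and nu = e^l r^theta, the exponent
    theta can be chosen so that both contributions grow like r^s, 0 < s < 1, and the sum over j
    is a two-sided geometric series of size |h|^s. Optimising in l gives the interpolated
    product of norms. The coarse end of the sum vanishes since f is in L^2, and the fine end
    converges to Delta_h f in L^1_loc. *)
Require Import Defs.
From HB Require Import structures.
From mathcomp Require Import all_boot all_order all_algebra.
From mathcomp Require Import all_classical all_reals all_analysis.
From mathcomp Require Import measurable_realfun ring lra zify.
Import Order.TTheory GRing.Theory Num.Theory.
Import numFieldNormedType.Exports.
Local Open Scope classical_set_scope.
Local Open Scope ring_scope.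
Set Implicit Arguments.
Unset Strict Implicit.
Unset Printing Implicit Defensive.

(** * Lebesgue measure on tuples *)

(** The exponents come from two linear equations. At [tau nu = r], [nu = e^l r^theta] the kinetic
    box has volume [e^((d-1) l) r^kappa] with [kappa = 1 + d - theta + theta d]. Asking for the same
    power [r^s] in the gradient term [nu vol^(-(1/p - 1/q))] and in the source term
    [(tau / nu) vol^(-(1/p' - 1/q))] determines [theta] and [s]; the powers of [e^l] left over are
    [A1] and [-A2], and [alpha = A2 / (A1 + A2)]. The hypotheses are sign conditions: [p < 2 + 2/d]
    means both [theta > 0] and [p < qbar], the lower bound on [p] means [p' < qbar], and [q < qbar]
    means [s > 0]. The kernel is a product of one-variable densities, so that writing a difference
    of kernels as a divergence reduces to explicit primitives on the line. No seminorm of [f] is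
    known to be finite beforehand, so nothing can be absorbed: every bound concerns a finite sum of
    scales, uniformly in their number. The limit keeps an arbitrarily small slack, which pays for
    the coarse remainder and for the case where one of the two norms vanishes. *)

Section transport.
Local Open Scope ereal_scope.
Context d1 d2 (T1 : measurableType d1) (T2 : measurableType d2) (R : realType).
Variables (m : {measure set T1 -> \bar R}) (sf : sigma_finite setT m) (f : T1 -> T2) (g : T2 -> T1).
Hypotheses (mf : measurable_fun setT f) (mg : measurable_fun setT g).
Hypothesis fK : cancel f g.

(** The hypotheses are arguments of the definition so that measure and sigma-finite structures can
    be attached to it; a sigma-finite cover is carried to [T2] by preimages under the left inverse
    [g]. *)
Definition transport of sigma_finite setT m & measurable_fun setT f &
  measurable_fun setT g & cancel f g
  : set T2 -> \bar R := pushforward m f.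
Local Notation tr := (transport sf mf mg fK).

Let tr0 : tr set0 = 0. Proof. by rewrite /transport /pushforward preimage_set0 measure0. Qed.
Let tr_ge0 A : 0 <= tr A. Proof. exact: measure_ge0. Qed.
Let tr_sigma : semi_sigma_additive tr.
Proof.
move=> F mF tF mUF.
exact: (@measure_semi_sigma_additive _ _ _ (pushforward m f : {measure set T2 -> \bar R}) F mF tF mUF).
Qed.
HB.instance Definition _ := isMeasure.Build _ _ _ tr tr0 tr_ge0 tr_sigma.

Let tr_sigma_finite : sigma_finite setT tr.
Proof.
have [F TF Foo] := sf.
exists (fun i => g @^-1` F i).
  by rewrite -preimage_bigcup -TF preimage_setT.
move=> i; have [mFi Fioo] := Foo i; split.
  by rewrite -[X in measurable X]setTI; exact: mg.
rewrite /transport /pushforward -comp_preimage.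
by rewrite (_ : g \o f = id) ?preimage_id//; apply/funext => x /=; rewrite fK.
Qed.
HB.instance Definition _ := Measure_isSigmaFinite.Build _ _ _ tr tr_sigma_finite.

Lemma ge0_integral_transport (h : T2 -> \bar R) :
  measurable_fun setT h -> (forall x, 0 <= h x) ->
  \int[tr]_x h x = \int[m]_x h (f x).
Proof.
move=> mh h0.
have := @ge0_integral_pushforward _ _ _ _ R f mf m setT h measurableT mh (fun x _ => h0 x).
by rewrite preimage_setT.
Qed.

Lemma integral_transport (h : T2 -> \bar R) :
  measurable_fun setT h -> \int[tr]_x h x = \int[m]_x h (f x).
Proof.
move=> mh; rewrite [LHS]integralE [RHS]integralE.
have H1 := ge0_integral_transport (measurable_funepos mh) (funepos_ge0 h).
have H2 := ge0_integral_transport (measurable_funeneg mh) (funeneg_ge0 h).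
by rewrite H1 H2 (funepos_comp h f) (funeneg_comp h f).
Qed.
End transport.

(* The library's sigma-finiteness instance for [m1 \x m2] is shadowed by the one
   for subprobability measures. *)
Lemma sigma_finite_product d1 d2 (T1 : measurableType d1) (T2 : measurableType d2)
    (R : realType) (m1 : {sigma_finite_measure set T1 -> \bar R})
    (m2 : {sigma_finite_measure set T2 -> \bar R}) :
  sigma_finite setT (m1 \x m2)%E.
Proof.
have /sigma_finiteP[F [TF ndF Foo]] := sigma_finiteT m1.
have /sigma_finiteP[G [TG ndG Goo]] := sigma_finiteT m2.
exists (fun n => F n `*` G n).
  rewrite -setXTT TF TG predeqE => -[x y]; split.
    move=> [/= [n _ Fnx] [k _ Gky]]; exists (maxn n k) => //; split.
    - by move: x Fnx; exact/subsetPset/ndF/leq_maxl.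
    - by move: y Gky; exact/subsetPset/ndG/leq_maxr.
  by move=> [n _ []/= ? ?]; split; exists n.
move=> k; have [? ?] := Foo k; have [? ?] := Goo k.
split; first exact: measurableX.
by rewrite product_measure1E// lte_mul_pinfty// ge0_fin_numE.
Qed.

Section lebesgue_tuple.
Local Open Scope ereal_scope.
Variable R : realType.

Lemma measurable_id_measurableTypeR :
  measurable_fun [set: measurableTypeR R] (idfun : measurableTypeR R -> R).
Proof. by move=> _ Y mY; rewrite setTI. Qed.
Lemma measurable_id_to_measurableTypeR :
  measurable_fun [set: R] (idfun : R -> measurableTypeR R).
Proof. by move=> _ Y mY; rewrite setTI. Qed.

(* [lebesgue_measure] lives on [measurableTypeR R], whose display differs from
   that of the measurable structure carried by tuples over [R]. *)
Lemma leb_spec : {mu : {sigma_finite_measure set R -> \bar R} |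
  (forall A, mu A = @lebesgue_measure R A) /\
  (forall h : R -> \bar R, measurable_fun setT h ->
    \int[@lebesgue_measure R]_x h x = \int[mu]_x h x)}.
Proof.
exists (transport (sigma_finiteT (@lebesgue_measure R)) measurable_id_measurableTypeR
    measurable_id_to_measurableTypeR (fun x => erefl x)).
by split => // h mh; rewrite integral_transport.
Qed.

Definition leb := sval leb_spec.

Lemma lebE (A : set R) : leb A = @lebesgue_measure R A.
Proof. exact: (svalP leb_spec).1. Qed.

Lemma integral_leb (h : R -> \bar R) : measurable_fun setT h ->
  \int[@lebesgue_measure R]_x h x = \int[leb]_x h x.
Proof. exact: (svalP leb_spec).2. Qed.

Definition tcons n (u : R * n.-tuple R) : n.+1.-tuple R := [tuple of u.1 :: u.2].
Definition tuncons n (u : n.+1.-tuple R) : R * n.-tuple R :=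
  (thead u, [tuple of behead u]).

Lemma measurable_tcons n : measurable_fun setT (@tcons n).
Proof. exact: measurable_cons. Qed.

Lemma measurable_tuncons n : measurable_fun setT (@tuncons n).
Proof.
apply/measurable_fun_pairP; split.
  exact: measurable_tnth.
exact: measurable_behead.
Qed.

Lemma tconsK n : cancel (@tcons n) (@tuncons n).
Proof. by case=> x y; congr pair; apply/val_inj => /=. Qed.

Fixpoint lebn_rec n : {sigma_finite_measure set (n.-tuple R) -> \bar R} :=
  match n with
  | 0 => dirac [tuple]
  | m.+1 => transport (sigma_finite_product leb (lebn_rec m)) (@measurable_tcons m)
              (@measurable_tuncons m) (@tconsK m)
  end.

(** Sealing the recursive construction leaves only these two integration rules visible. *)
Lemma lebn_spec : {mu : forall n, {sigma_finite_measure set (n.-tuple R) -> \bar R} |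
  (forall g : 0.-tuple R -> \bar R, measurable_fun setT g ->
    \int[mu 0%N]_z g z = g [tuple]) /\
  (forall n (g : n.+1.-tuple R -> \bar R), measurable_fun setT g ->
    \int[mu n.+1]_z g z = \int[leb \x mu n]_u g (tcons u))}.
Proof.
exists lebn_rec; split => [g mg|n g mg].
  by rewrite /= integral_dirac// diracT mul1e.
exact: integral_transport.
Qed.

Definition lebn := sval lebn_spec.

Lemma integral_lebn0 (g : 0.-tuple R -> \bar R) : measurable_fun setT g ->
  \int[lebn 0]_z g z = g [tuple].
Proof. exact: (svalP lebn_spec).1. Qed.

Lemma integral_lebn_prod n (g : n.+1.-tuple R -> \bar R) : measurable_fun setT g ->
  \int[lebn n.+1]_z g z = \int[leb \x lebn n]_u g (tcons u).
Proof. exact: (svalP lebn_spec).2. Qed.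

Lemma ge0_integral_lebnS n (g : n.+1.-tuple R -> \bar R) :
  measurable_fun setT g -> (forall z, 0 <= g z) ->
  \int[lebn n.+1]_z g z = \int[leb]_x \int[lebn n]_y g (tcons (x, y)).
Proof.
move=> mg g0; rewrite integral_lebn_prod//.
have mgt : measurable_fun setT (fun u => g (tcons u)).
  by apply: measurableT_comp => //; exact: measurable_tcons.
by rewrite (fubini_tonelli1 (fun u => g (tcons u))).

Qed.

Lemma ge0_integral_lebnS2 n (g : n.+1.-tuple R -> \bar R) :
  measurable_fun setT g -> (forall z, 0 <= g z) ->
  \int[lebn n.+1]_z g z = \int[lebn n]_y \int[leb]_x g (tcons (x, y)).
Proof.
move=> mg g0; rewrite integral_lebn_prod//.
have mgt : measurable_fun setT (fun u => g (tcons u)).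
  by apply: measurableT_comp => //; exact: measurable_tcons.
by rewrite (fubini_tonelli2 (fun u => g (tcons u))).

Qed.

(** The integral is the difference of those of the positive and negative parts; Tonelli makes each
    measurable, and subtraction of extended reals is measurable also where both are infinite. *)
Lemma measurable_integral_param d (T : measurableType d) d' (T' : measurableType d')
  (m : {sigma_finite_measure set T' -> \bar R}) (g : T * T' -> \bar R) :
  measurable_fun setT g -> measurable_fun setT (fun x => \int[m]_y g (x, y)).
Proof.
move=> mg.
rewrite (_ : (fun x => _) = fun x => \int[m]_y (g^\+ (x, y)) - \int[m]_y (g^\- (x, y))); last first.
  apply/funext => x; rewrite integralE.
  by rewrite (funepos_comp g (fun y => (x, y))) (funeneg_comp g (fun y => (x, y))).
apply: emeasurable_funB.
  apply: (measurable_fun_fubini_tonelli_F (m2 := m) (g^\+)) => //.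
  exact: measurable_funepos.
apply: (measurable_fun_fubini_tonelli_F (m2 := m) (g^\-)) => //.
exact: measurable_funeneg.
Qed.

(** The parameter space is arbitrary so that the induction can absorb the outermost integration
    variable into it. *)
Lemma measurable_iint_param n d (T : measurableType d) (g : T * n.-tuple R -> \bar R) :
  measurable_fun setT g -> measurable_fun setT (fun x => iint (fun y => g (x, y))).
Proof.
elim: n d T g => [|n ih] d T g mg /=.
  by apply: measurableT_comp => //; apply/measurable_fun_pairP; split.
pose G (u : T * R) := iint (fun y => g (u.1, [tuple of u.2 :: y])).
have mG : measurable_fun setT G.
  apply: (ih _ _ (fun w : (T * R) * n.-tuple R => g (w.1.1, tcons (w.1.2, w.2)))).
  apply: measurableT_comp => //.
  apply/measurable_fun_pairP; split => /=.
    exact: (measurableT_comp measurable_fst measurable_fst).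
  apply: (measurableT_comp (@measurable_tcons n)).
  apply/measurable_fun_pairP; split => //=.
    exact: (measurableT_comp measurable_snd measurable_fst).
  exact: measurable_snd.
rewrite (_ : (fun x => _) = fun x => \int[leb]_y G (x, y)); last first.
  apply/funext => x; rewrite integral_leb//.
  have mx : measurable_fun setT (fun y : R => (x, y)).
    by apply: measurable_fun_pair => //; exact: measurable_id.
  exact: (measurableT_comp mG mx).
exact: measurable_integral_param.
Qed.

Lemma measurable_tcons_section n (g : n.+1.-tuple R -> \bar R) x :
  measurable_fun setT g -> measurable_fun setT (fun y => g (tcons (x, y))).
Proof.
move=> mg; apply: measurableT_comp => //; apply: (measurableT_comp (@measurable_tcons n)).
by apply: measurable_fun_pair => //; exact: measurable_id.
Qed.

Lemma measurable_iint_tcons n (g : n.+1.-tuple R -> \bar R) :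
  measurable_fun setT g ->
  measurable_fun setT (fun x : R => iint (fun y => g (tcons (x, y)))).
Proof.
move=> mg; apply: (measurable_iint_param (g := g \o @tcons n)).
exact: (measurableT_comp mg (@measurable_tcons n)).
Qed.

Lemma iint_ge0 n (g : n.-tuple R -> \bar R) : measurable_fun setT g ->
  (forall z, 0 <= g z) -> iint g = \int[lebn n]_z g z.
Proof.
elim: n g => [|n ih] g mg g0.
  by rewrite integral_lebn0.
rewrite ge0_integral_lebnS//= integral_leb; last exact: measurable_iint_tcons.
by apply: eq_integral => x _; rewrite ih//; exact: measurable_tcons_section.
Qed.

(** Fubini gives integrable sections only for almost every [x], so the induction hypothesis applies
    only there. The inner integrals are compared almost everywhere, which requires both to be
    measurable in [x]. *)
Lemma iint_integrable n (g : n.-tuple R -> \bar R) :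
  (lebn n).-integrable setT g -> iint g = \int[lebn n]_z g z.
Proof.
elim: n g => [|n ih] g ig; have mg := measurable_int _ ig.
  by rewrite integral_lebn0.
rewrite /= integral_leb; last exact: measurable_iint_tcons.
rewrite integral_lebn_prod//.
have ig' : (leb \x lebn n).-integrable setT (fun u => g (tcons u)).
  apply/integrableP; split; first exact: (measurableT_comp mg (@measurable_tcons n)).
  move/integrableP : ig => [_]; rewrite integral_lebn_prod//.
  exact: measurableT_comp mg.
rewrite -(integral12_prod_meas1 ig').
apply: ae_eq_integral => //.
- exact: measurable_iint_tcons.
- apply: (@measurable_integral_param _ _ _ _ (lebn n) (fun u => g (tcons u))).
  exact: (measurableT_comp mg (@measurable_tcons n)).
have := ae_integrable1 ig'; apply: filterS => x H _.
exact: (ih (fun y => g (tcons (x, y))) H).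
Qed.
End lebesgue_tuple.

(** * Affine changes of variables with triangular linear part *)

Section affine_change.
Local Open Scope ereal_scope.
Variable R : realType.

(** Uniqueness of Lebesgue measure: [a] times the image measure under the affine map gives every
    interval []u, v]] its length. *)
Lemma leb_affine (a b : R) (A : set R) : (0 < a)%R -> measurable A ->
  a%:E * leb R ((fun x => a * x + b)%R @^-1` A) = leb R A.
Proof.
move=> a0 mA.
have mf : measurable_fun [set: measurableTypeR R]
    ((fun x => a * x + b)%R : measurableTypeR R -> measurableTypeR R).
  have : measurable_fun [set: R] (fun x : R => a * x + b)%R.
    by apply: measurable_funD => //; exact: measurable_funM.
  by move=> h _ Y mY; exact: h.
have a0' : (0 <= a)%R by exact: ltW.
pose mu' := mscale (NngNum a0') (pushforward (@lebesgue_measure R)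
  ((fun x => a * x + b)%R : measurableTypeR R -> measurableTypeR R)).
rewrite !lebE; suff -> : @lebesgue_measure R A = mu' mf A by [].
apply: (@lebesgue_measure_unique R (mu' mf)) => // _ [[u v]] _ <-.
rewrite /mu' /mscale /pushforward /=.
have E : [set` `](u - b) / a, (v - b) / a]]%R = (fun x => a * x + b)%R @^-1` [set` `]u, v]].
  by apply/seteqP; split => x /=; rewrite !in_itv/= ltr_pdivrMr// ler_pdivlMr// ltrBlDr lerBrDr (mulrC x).
transitivity (a%:E * @lebesgue_measure R [set` `](u - b) / a, (v - b) / a]]%R); last by rewrite E.
rewrite !lebesgue_measure_itv/= !lte_fin ltr_pM2r ?invr_gt0// ltrD2r.
case: ifPn => uv; last by rewrite mule0.
rewrite -!EFinB -EFinM; congr EFin; field.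
by rewrite gt_eqF.
Qed.

Lemma ge0_integral_leb_affine (a b : R) (g : R -> \bar R) : (0 < a)%R ->
  measurable_fun setT g -> (forall x, 0 <= g x) ->
  \int[leb R]_x g (a * x + b)%R = a^-1%:E * \int[leb R]_x g x.
Proof.
move=> a0 mg g0.
have mf : measurable_fun [set: R] (fun x : R => a * x + b)%R.
  by apply: measurable_funD => //; exact: measurable_funM.
have a0' : (0 <= a)%R by exact: ltW.
have H : \int[leb R]_x g x =
    \int[mscale (NngNum a0') (pushforward (leb R) (fun x => a * x + b)%R)]_x g x.
  move=> m; apply: eq_measure_integral => A mA _.
  exact: (esym (leb_affine b a0 mA)).
rewrite {}(H mf) ge0_integral_mscale//= muleA -EFinM mulVf ?gt_eqF// mul1e.
by rewrite ge0_integral_pushforward.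
Qed.

Lemma ge0_integralZT d (T : measurableType d) (mu : {measure set T -> \bar R})
    (k : R) (f : T -> \bar R) : (0 <= k)%R -> measurable_fun setT f ->
  (forall x, 0 <= f x) -> \int[mu]_x (k%:E * f x) = k%:E * \int[mu]_x f x.
Proof. by move=> k0 mf f0; rewrite ge0_integralZl_EFin. Qed.

Definition affmap n (al : 'I_n -> R) (be : 'I_n -> n.-tuple R -> R) (y : n.-tuple R)
  : n.-tuple R := [tuple (al j * tnth y j + be j y)%R | j < n].

Lemma measurable_mktuple d (T : measurableType d) n (F : T -> 'I_n -> R) :
  (forall i, measurable_fun setT (F^~ i)) ->
  measurable_fun setT (fun x => [tuple F x i | i < n]).
Proof.
move=> mF; apply/measurable_fun_tnthP => i.
rewrite (_ : _ \o _ = F^~ i)//.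
by apply/funext => x /=; rewrite tnth_mktuple.
Qed.

Lemma measurable_affmap n al be : (forall j, measurable_fun setT (be j)) ->
  measurable_fun setT (@affmap n al be).
Proof.
move=> mbe; apply: measurable_mktuple => i; apply: measurable_funD => //.
by apply: measurable_funM => //; exact: measurable_tnth.
Qed.

Lemma affmap_tcons n al be x (y : n.-tuple R) :
  affmap al be (tcons (x, y)) = tcons (al ord0 * x + be ord0 (tcons (x, y)),
    affmap (fun j => al (lift ord0 j)) (fun j z => be (lift ord0 j) (tcons (x, z))) y)%R.
Proof.
apply: eq_from_tnth => i; rewrite tnth_mktuple.
have [->|[j ->]] : i = ord0 \/ exists j, i = lift ord0 j.
  by case: (unliftP ord0 i) => [j ->|->]; [right; exists j|left].
- by rewrite !tnth0.
- by rewrite !tnthS tnth_mktuple.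
Qed.

Lemma measurable_tcons_r n (x : R) : measurable_fun setT (fun y : n.-tuple R => tcons (x, y)).
Proof.
apply: (measurableT_comp (@measurable_tcons R n)).
by apply: measurable_fun_pair => //; exact: measurable_id.
Qed.

Lemma measurable_tcons_l n (y : n.-tuple R) : measurable_fun setT (fun x : R => tcons (x, y)).
Proof.
apply: (measurableT_comp (@measurable_tcons R n)).
by apply: measurable_fun_pair => //; exact: measurable_id.
Qed.

(** Integrating the first variable outermost freezes it in the other shifts, so the remaining map is
    again triangular and the Jacobian is the product of the diagonal. This covers [w] in [act],
    where the time of [w] enters the x-coordinates. *)
Lemma ge0_integral_affmap_lower n (al : 'I_n -> R) (be : 'I_n -> n.-tuple R -> R) (g : n.-tuple R -> \bar R) :
  (forall j, (0 < al j)%R) -> (forall j, measurable_fun setT (be j)) ->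
  (forall (j : 'I_n) (y y' : n.-tuple R), (forall k : 'I_n, (k < j)%N -> tnth y k = tnth y' k) ->
     be j y = be j y') ->
  measurable_fun setT g -> (forall x, 0 <= g x) ->
  \int[lebn R n]_z g (affmap al be z) = ((\prod_j al j)^-1)%:E * \int[lebn R n]_z g z.
Proof.
elim: n al be g => [|n ih] al be g al0 mbe dbe mg g0.
  rewrite big_ord0 invr1 mul1e; apply: eq_integral => x _.
  by congr g; apply: eq_from_tnth => -[].
rewrite big_ord_recl !ge0_integral_lebnS//; last first.
  by apply: measurableT_comp => //; exact: measurable_affmap.
(* The shift of the first coordinate depends on no coordinate, so its value at any point serves. *)
pose b0 := be ord0 [tuple 0%R | i < n.+1].
pose c := (\prod_(i < n) al (lift ord0 i))%R.
transitivity (\int[leb R]_x (c^-1%:E * \int[lebn R n]_y g (tcons (al ord0 * x + b0, y)%R))).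
  apply: eq_integral => x _.
  rewrite -(ih _ (fun j z => be (lift ord0 j) (tcons (x, z)))
    (fun y => g (tcons (al ord0 * x + b0, y)%R)))//.
  - apply: eq_integral => y _; rewrite affmap_tcons.
    by congr (g (tcons (_ + _, _)%R)); apply: dbe.
  - by move=> j; apply: (measurableT_comp (mbe _)); exact: measurable_tcons_r.
  - move=> j y y' yy'; apply: dbe => k kj.
    case: (unliftP ord0 k) kj => [k' ->|->] kj; last by rewrite !tnth0.
    by rewrite !tnthS; apply: yy'; move: kj; rewrite /= /bump !leq0n !add1n ltnS.
  - by apply: (measurableT_comp mg); exact: measurable_tcons_r.
have mG : measurable_fun setT (fun x => \int[lebn R n]_y g (tcons (x, y))).
  apply: (@measurable_integral_param _ _ _ _ _ (lebn R n) (g \o @tcons R n)).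
  exact: (measurableT_comp mg (@measurable_tcons R n)).
have c0 : (0 < c)%R by apply: prodr_gt0.
have m1 : measurable_fun [set: R] (fun x : R => al ord0 * x + b0)%R.
  by apply: measurable_funD => //; exact: measurable_funM.
have c0' : (0 <= c^-1)%R by rewrite invr_ge0 ltW.
rewrite (ge0_integralZT (leb R) c0' (measurableT_comp mG m1)); last first.
  by move=> x; apply: integral_ge0.
rewrite (ge0_integral_leb_affine b0 (al0 ord0) mG); last by move=> x; apply: integral_ge0.
by rewrite muleA -EFinM invfM mulrC.
Qed.

(** Here the first variable is integrated innermost, its shift being frozen by the others. This
    covers [z] in [act], whose velocity, of larger index, enters the x-coordinates. *)
Lemma ge0_integral_affmap_upper n (al : 'I_n -> R) (be : 'I_n -> n.-tuple R -> R) (g : n.-tuple R -> \bar R) :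
  (forall j, (0 < al j)%R) -> (forall j, measurable_fun setT (be j)) ->
  (forall (j : 'I_n) (y y' : n.-tuple R), (forall k : 'I_n, (j < k)%N -> tnth y k = tnth y' k) ->
     be j y = be j y') ->
  measurable_fun setT g -> (forall x, 0 <= g x) ->
  \int[lebn R n]_z g (affmap al be z) = ((\prod_j al j)^-1)%:E * \int[lebn R n]_z g z.
Proof.
elim: n al be g => [|n ih] al be g al0 mbe dbe mg g0.
  rewrite big_ord0 invr1 mul1e; apply: eq_integral => x _.
  by congr g; apply: eq_from_tnth => -[].
rewrite big_ord_recl [in LHS]ge0_integral_lebnS2//; last first.
  by apply: measurableT_comp => //; exact: measurable_affmap.
pose be' j z := be (lift ord0 j) (tcons (0%R, z)).
pose al' j := al (lift ord0 j).
pose c := (\prod_(i < n) al (lift ord0 i))%R.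
have c0 : (0 < c)%R by apply: prodr_gt0.
have mbe' j : measurable_fun setT (be' j).
  by apply: (measurableT_comp (mbe _)); exact: measurable_tcons_r.
have mG : measurable_fun setT (fun y => \int[leb R]_x g (tcons (x, y))).
  apply: (@measurable_integral_param _ _ _ _ _ (leb R) (fun u => g (tcons (u.2, u.1)))).
  apply: (measurableT_comp mg); apply: (measurableT_comp (@measurable_tcons R n)).
  by apply: measurable_fun_pair; [exact: measurable_snd|exact: measurable_fst].
transitivity (\int[lebn R n]_y ((al ord0)^-1%:E *
    \int[leb R]_x g (tcons (x, affmap al' be' y)))).
  apply: eq_integral => y _.
  rewrite -(ge0_integral_leb_affine (be ord0 (tcons (0%R, y))))//; last first.
    by apply: (measurableT_comp mg); exact: measurable_tcons_l.
  apply: eq_integral => x _; rewrite affmap_tcons.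
  congr (g (tcons (_ + _, _)%R)).
    apply: dbe => k k0.
    by case: (unliftP ord0 k) k0 => [k' ->|->] k0 //; rewrite !tnthS.
  apply: eq_from_tnth => i; rewrite !tnth_mktuple; congr (_ + _)%R.
  apply: dbe => k k0.
  by case: (unliftP ord0 k) k0 => [k' ->|->] k0 //; rewrite !tnthS.
have a0' : (0 <= (al ord0)^-1)%R by rewrite invr_ge0 ltW.
have mA : measurable_fun setT (affmap al' be') by exact: measurable_affmap.
rewrite (ge0_integralZT (lebn R n) a0' (measurableT_comp mG mA)); last first.
  by move=> x; apply: integral_ge0.
rewrite (ih _ _ (fun y => \int[leb R]_x g (tcons (x, y))))//; last 3 first.
- by move=> j; exact: al0.
- move=> j y y' yy'; apply: dbe => k kj.
  case: (unliftP ord0 k) kj => [k' ->|->] kj; last by rewrite !tnth0.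
  by rewrite !tnthS; apply: yy'; move: kj; rewrite /= /bump !leq0n !add1n ltnS.
- by move=> x; apply: integral_ge0.
by rewrite -ge0_integral_lebnS2// muleA -EFinM invfM.
Qed.

End affine_change.

(** * Galilean translations and anisotropic dilations *)

Section change_of_variables.
Local Open Scope ereal_scope.
Context d (T : measurableType d) (R : realType) (mu : {measure set T -> \bar R}).
Variables (phi : T -> T) (c : R).
Hypotheses (mphi : measurable_fun setT phi) (c0 : (0 <= c)%R).
Hypothesis ge0_change : forall g : T -> \bar R, measurable_fun setT g ->
  (forall x, 0 <= g x) -> \int[mu]_x g (phi x) = c%:E * \int[mu]_x g x.

Lemma integrable_change (g : T -> \bar R) : mu.-integrable setT g ->
  mu.-integrable setT (g \o phi).
Proof.
move=> /integrableP[mg goo]; apply/integrableP; split.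
  exact: measurableT_comp.
rewrite (ge0_change (g := fun x => `|g x|))//; last exact: measurableT_comp.
by rewrite lte_mul_pinfty.
Qed.

Lemma integral_change (g : T -> \bar R) : mu.-integrable setT g ->
  \int[mu]_x g (phi x) = c%:E * \int[mu]_x g x.
Proof.
move=> ig; have mg := measurable_int _ ig.
rewrite [LHS]integralE (funepos_comp g phi) (funeneg_comp g phi).
have mp := measurable_funepos mg; have mn := measurable_funeneg mg.
have H1 := ge0_change mp (funepos_ge0 g).
have H2 := ge0_change mn (funeneg_ge0 g).
rewrite [X in _ * X]integralE.
have mB := @muleBr _ c%:E _ _ isT (integrable_add_def measurableT ig).
by rewrite {}mB -H1 -H2.
Qed.

End change_of_variables.

Section galilean_group.
Local Open Scope ring_scope.
Variables (R : realType) (d : nat).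
Local Notation Z := ((1 + d + d).-tuple R).
Local Notation mu := (lebn R (1 + d + d)).
Implicit Types (z w : Z) (h : d.-tuple R) (tau nu : R).

Variant idx_spec : 'I_(1 + d + d) -> Type :=
| IdxT : idx_spec (tidx d)
| IdxX i : idx_spec (xidx i)
| IdxV i : idx_spec (vidx i).

Lemma idxP j : idx_spec j.
Proof.
rewrite -(splitK j); case: (fintype.split j) => [j1|i] /=; last exact: IdxV.
rewrite -(splitK j1); case: (fintype.split j1) => [j0|i] /=; last exact: IdxX.
by rewrite (ord1 j0); exact: IdxT.
Qed.

(** The same nested matching as in [xpart], which thus becomes an instance by conversion. *)
Definition kcase (A : Type) (a : A) (b c : 'I_d -> A) (j : 'I_(1 + d + d)) : A :=
  match fintype.split j with
  | inl j1 => match fintype.split j1 with inl _ => a | inr i => b i end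
  | inr i => c i
  end.

Lemma kcase_t A (a : A) b c : kcase a b c (tidx d) = a.
Proof.
rewrite /kcase /tidx -[lshift d (lshift d ord0)]/(unsplit (inl (lshift d ord0))) unsplitK.
by rewrite -[lshift d ord0]/(unsplit (inl ord0)) unsplitK.
Qed.

Lemma kcase_x A (a : A) b c i : kcase a b c (xidx i) = b i.
Proof.
rewrite /kcase /xidx -[lshift d (rshift 1 i)]/(unsplit (inl (rshift 1 i))) unsplitK.
by rewrite -[rshift 1 i]/(unsplit (inr i)) unsplitK.
Qed.

Lemma kcase_v A (a : A) b c i : kcase a b c (vidx i) = c i.
Proof. by rewrite /kcase /vidx -[rshift _ i]/(unsplit (inr i)) unsplitK. Qed.

Definition kcaseE := (kcase_t, kcase_x, kcase_v).

Lemma prod_idx (F : 'I_(1 + d + d) -> R) :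
  \prod_j F j = F (tidx d) * (\prod_(i < d) F (xidx i)) * (\prod_(i < d) F (vidx i)).
Proof. by rewrite !big_split_ord/= big_ord1. Qed.

Definition kscale tau nu := kcase tau (fun=> tau * nu) (fun=> nu).
(** The velocity of [z] moved to the x slots: the direction of the Galilean drift. *)
Definition vpart z := kcase 0 (fun i => tnth z (vidx i)) (fun=> 0).

(* z o (tau w_t, tau nu w_x, nu w_v) for the Galilean group law
   (t, x, v) o (s, y, w) = (t + s, x + y + s v, v + w). *)
Definition act tau nu z w : Z :=
  [tuple kscale tau nu j * tnth w j + (tnth z j + tau * tnth w (tidx d) * vpart z j)
   | j < 1 + d + d].

Definition xshift h z : Z := [tuple tnth z j + xpart h j | j < 1 + d + d].

(** The Jacobian of [act tau nu z], that is the volume of a kinetic box up to a constant. *)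
Definition vol tau nu := tau * (tau * nu) ^+ d * nu ^+ d.

Lemma xpartE h : xpart h = kcase 0 (tnth h) (fun=> 0).
Proof. by []. Qed.

Lemma kscale_gt0 tau nu j : 0 < tau -> 0 < nu -> 0 < kscale tau nu j.
Proof. by move=> t0 n0; case: (idxP j) => [|i|i]; rewrite /kscale kcaseE ?mulr_gt0. Qed.

Lemma vol_gt0 tau nu : 0 < tau -> 0 < nu -> 0 < vol tau nu.
Proof. by move=> t0 n0; rewrite /vol !mulr_gt0// exprn_gt0// mulr_gt0. Qed.

Lemma prod_kscale tau nu : \prod_j kscale tau nu j = vol tau nu.
Proof.
rewrite prod_idx /kscale kcaseE; under eq_bigr do rewrite kcaseE.
under [X in _ * X]eq_bigr do rewrite kcaseE.
by rewrite !prodr_const card_ord.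
Qed.

Lemma measurable_vpart j : measurable_fun setT (fun z : Z => vpart z j).
Proof.
rewrite /vpart; case: (idxP j) => [|i|i].
- by rewrite (_ : (fun z : Z => _) = cst 0)//; apply/funext => z; rewrite kcaseE.
- rewrite (_ : (fun z : Z => _) = (fun z => tnth z (vidx i))).
    exact: measurable_tnth.
  by apply/funext => z; rewrite kcaseE.
- by rewrite (_ : (fun z : Z => _) = cst 0)//; apply/funext => z; rewrite kcaseE.
Qed.

Lemma measurable_act tau nu : measurable_fun setT (fun u : Z * Z => act tau nu u.1 u.2).
Proof.
have mt (j : 'I_(1 + d + d)) : measurable_fun setT (fun z : Z => tnth z j).
  exact: measurable_tnth.
apply: measurable_mktuple => j; apply: measurable_funD.
  by apply: measurable_funM => //; exact: (measurableT_comp (mt j) measurable_snd).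
apply: measurable_funD; first exact: (measurableT_comp (mt j) measurable_fst).
apply: measurable_funM.
  by apply: measurable_funM => //; exact: (measurableT_comp (mt _) measurable_snd).
exact: (measurableT_comp (measurable_vpart j) measurable_fst).
Qed.

Lemma measurable_act_w tau nu z : measurable_fun setT (act tau nu z).
Proof.
have m1 : measurable_fun setT (fun w : Z => (z, w)).
  by apply: measurable_fun_pair => //; exact: measurable_id.
exact: (measurableT_comp (measurable_act tau nu) m1).
Qed.

Lemma measurable_act_z tau nu w : measurable_fun setT (act tau nu ^~ w).
Proof.
have m1 : measurable_fun setT (fun z : Z => (z, w)).
  by apply: measurable_fun_pair => //; exact: measurable_id.
exact: (measurableT_comp (measurable_act tau nu) m1).
Qed.

Lemma ge0_integral_act_w tau nu z (g : Z -> \bar R) : 0 < tau -> 0 < nu ->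
  measurable_fun setT g -> (forall x, 0 <= g x)%E ->
  (\int[mu]_w g (act tau nu z w) = ((vol tau nu)^-1)%:E * \int[mu]_w g w)%E.
Proof.
move=> t0 n0 mg g0; rewrite -prod_kscale -(ge0_integral_affmap_lower
  (be := fun j w => tnth z j + tau * tnth w (tidx d) * vpart z j))//.
- by move=> j; exact: kscale_gt0.
- move=> j; apply: measurable_funD => //; apply: measurable_funM => //.
  by apply: measurable_funM => //; exact: measurable_tnth.
- move=> j y y'; case: (idxP j) => [|i|i] H; rewrite /vpart kcaseE ?mulr0//.
  by rewrite H//.
Qed.

Lemma ge0_integral_act_z tau nu w (g : Z -> \bar R) :
  measurable_fun setT g -> (forall x, 0 <= g x)%E ->
  (\int[mu]_z g (act tau nu z w) = \int[mu]_z g z)%E.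
Proof.
move=> mg g0; transitivity ((((\prod_(j < 1 + d + d) (1 : R))^-1)%:E * \int[mu]_z g z)%E).
  rewrite -(ge0_integral_affmap_upper
    (be := fun j z => kscale tau nu j * tnth w j + tau * tnth w (tidx d) * vpart z j))//.
  - apply: eq_integral => z _; congr g; apply: eq_from_tnth => j.
    by rewrite !tnth_mktuple mul1r addrCA.
  - move=> j; apply: measurable_funD => //; apply: measurable_funM => //.
    exact: measurable_vpart.
  - move=> j y y'; case: (idxP j) => [|i|i] H; rewrite /vpart !kcaseE//.
    by rewrite H//=; have := ltn_ord i; lia.
by rewrite big1// invr1 mul1e.
Qed.

Lemma ge0_integral_xshift h (g : Z -> \bar R) :
  measurable_fun setT g -> (forall x, 0 <= g x)%E ->
  (\int[mu]_z g (xshift h z) = \int[mu]_z g z)%E.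
Proof.
move=> mg g0; transitivity ((((\prod_(j < 1 + d + d) (1 : R))^-1)%:E * \int[mu]_z g z)%E).
  rewrite -(ge0_integral_affmap_upper (be := fun j _ => xpart h j))//.
  apply: eq_integral => z _; congr g; apply: eq_from_tnth => j.
  by rewrite !tnth_mktuple mul1r.
by rewrite big1// invr1 mul1e.
Qed.

Lemma measurable_xshift h : measurable_fun setT (xshift h).
Proof.
apply: measurable_mktuple => j; apply: measurable_funD => //.
exact: measurable_tnth.
Qed.

Lemma vpart_xshift h z : vpart (xshift h z) = vpart z.
Proof.
apply/funext => j; rewrite /vpart; case: (idxP j) => [|i|i]; rewrite !kcaseE//.
by rewrite tnth_mktuple xpartE kcaseE addr0.
Qed.

(** Translations in x are central in the Galilean group. *)
Lemma act_xshift tau nu h z w : act tau nu (xshift h z) w = xshift h (act tau nu z w).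
Proof.
apply: eq_from_tnth => j; rewrite !tnth_mktuple vpart_xshift.
by rewrite -!addrA; congr (_ + (_ + _)); rewrite addrC.
Qed.

(** With [act_xshift] this transfers a translation of the base point [z] by [h] to one of [w] by
    [h / (tau nu)], hence to the smooth kernel. *)
Lemma xshift_act tau nu h z w : 0 < tau -> 0 < nu ->
  xshift h (act tau nu z w) =
  act tau nu z (xshift [tuple tnth h i / (tau * nu) | i < d] w).
Proof.
move=> t0 n0; set k := [tuple _ | i < d].
have kE j : kscale tau nu j * xpart k j = xpart h j.
  rewrite !xpartE /kscale; case: (idxP j) => [|i|i]; rewrite !kcaseE ?mulr0//.
  by rewrite tnth_mktuple mulrC divfK// mulf_neq0// gt_eqF.
apply: eq_from_tnth => j; rewrite !tnth_mktuple -kE.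
have xt : xpart k (tidx d) = 0 by rewrite xpartE kcaseE.
rewrite xt; ring.
Qed.

Definition dil a b w : Z := [tuple kscale a b j * tnth w j | j < 1 + d + d].

Lemma kscaleM a b tau nu j : kscale (a * tau) (b * nu) j = kscale tau nu j * kscale a b j.
Proof.
rewrite /kscale; case: (idxP j) => [|i|i]; rewrite !kcaseE; [exact: mulrC| |exact: mulrC].
by rewrite mulrACA mulrC.
Qed.

(** A coarser scale is a dilation of [w]: after a change of variables both scales integrate the same
    [f (act tau nu z w)] and differ only in the kernel. *)
Lemma act_dil a b tau nu z w : act (a * tau) (b * nu) z w = act tau nu z (dil a b w).
Proof.
apply: eq_from_tnth => j; rewrite !tnth_mktuple kscaleM -mulrA; congr (_ + (_ + _)).
by rewrite /kscale kcaseE (mulrC a) !mulrA.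
Qed.

Lemma ge0_integral_dil a b (g : Z -> \bar R) : 0 < a -> 0 < b ->
  measurable_fun setT g -> (forall x, 0 <= g x)%E ->
  (\int[mu]_w g (dil a b w) = ((vol a b)^-1)%:E * \int[mu]_w g w)%E.
Proof.
move=> a0 b0 mg g0; rewrite -prod_kscale -(ge0_integral_affmap_lower (be := fun j w => 0))//.
  by apply: eq_integral => w _; congr g; apply: eq_from_tnth => j; rewrite !tnth_mktuple addr0.
by move=> j; exact: kscale_gt0.
Qed.

End galilean_group.

(** * Test functions *)

Section real_calculus.
Variable R : realType.
Implicit Types (f g : R -> R) (x a b c : R).

Local Notation dv f x l := (is_derive (x : R) (1 : R) (f : R -> R) (l : R)).

Lemma dvD f g x a b : dv f x a -> dv g x b -> dv (fun y => f y + g y) x (a + b).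
Proof. exact: is_deriveD. Qed.

Lemma dvM f g x a b : dv f x a -> dv g x b ->
  dv (fun y => f y * g y) x (a * g x + f x * b).
Proof.
move=> df dg; apply: (is_derive_eq (is_deriveM df dg)).
by rewrite addrC; congr (_ + _); rewrite /GRing.scale/= mulrC.
Qed.

Lemma dv_cst c x : dv (fun=> c) x 0.
Proof. exact: is_derive_cst. Qed.

Lemma dv_id x : dv (fun y => y) x 1.
Proof. exact: is_derive_id. Qed.

Lemma dv_aff a b x : dv (fun y => a * y + b) x a.
Proof.
apply: (is_derive_eq (dvD (dvM (dv_cst a x) (dv_id x)) (dv_cst b x))).
by rewrite mul0r add0r mulr1 addr0.
Qed.

Lemma dv_comp f g x a b : dv f (g x) a -> dv g x b -> dv (fun y => f (g y)) x (a * b).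
Proof. exact: is_derive1_comp. Qed.

Lemma dv_comp_aff f a b x l : dv f (a * x + b) l -> dv (fun y => f (a * y + b)) x (a * l).
Proof. by move=> df; rewrite mulrC; apply: (dv_comp (g := fun y => a * y + b) df); exact: dv_aff. Qed.

Lemma dv_continuous f x l : dv f x l -> continuous_at x f.
Proof. by move=> df; apply/differentiable_continuous/derivable1_diffP. Qed.

(** Meant for [flat] at the origin, where the definition by cases blocks the usual rules. *)
Lemma dv_quadratic f x C : f x = 0 -> (forall y, `|f y| <= C * (y - x) ^+ 2) -> dv f x 0.
Proof.
move=> fx0 fC.
have C0 : 0 <= C.
  by have := fC (x + 1); rewrite addrAC subrr add0r expr1n mulr1; apply: le_trans.
suff H : h^-1 *: ((f \o shift x) (h *: (1 : R)) - f x) @[h --> 0^'] --> (0 : R).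
  have H' : derivable f x 1 by apply/cvg_ex; exists 0.
  by apply: DeriveDef => //; exact: cvg_lim H.
apply/cvgrPdist_le => e e0; near=> h.
rewrite sub0r normrN /= fx0 subr0 normrM normfV.
have h0 : h != 0 by near: h; exact: nbhs_dnbhs_neq.
rewrite ler_pdivrMl ?normr_gt0//.
have -> : h%:A + x = h + x by rewrite /GRing.scale/= mulr1.
apply: (le_trans (fC _)); rewrite addrK -real_normK ?num_real// expr2 mulrA.
rewrite mulrC; apply: ler_wpM2l => //.
rewrite (le_trans (y := (C + 1) * `|h|))//; first by rewrite ler_wpM2r// lerDl.
rewrite -ler_pdivlMl ?ltr_wpDl//.
near: h; exists ((C + 1)^-1 * e) => /=; first by rewrite mulr_gt0// invr_gt0 ltr_wpDl.
by move=> h /=; rewrite sub0r normrN => /ltW.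
Unshelve. all: by end_near. Qed.

(** The powers in front of [exp (-1/x)] give a family whose linear span is closed under
    differentiation. *)
Definition flat (k : nat) x : R := if 0 < x then x ^- k * expR (- x^-1) else 0.

Lemma flat_ge0 k x : 0 <= flat k x.
Proof.
rewrite /flat; case: ifPn => // x0; apply: mulr_ge0; last exact: expR_ge0.
by rewrite invr_ge0 exprn_ge0// ltW.
Qed.

(** The term of degree [k + 2] in the exponential series at [1 / x] beats [x^(-k)] with two powers
    to spare. *)
Lemma flat_le k x : `|flat k x| <= (k.+2)`!%:R * x ^+ 2.
Proof.
rewrite ger0_norm ?flat_ge0// /flat; case: ifPn => x0; last first.
  by rewrite mulr_ge0// sqr_ge0.
have m0 : 0 < (k.+2)`!%:R :> R by rewrite ltr0n fact_gt0.
have xi0 : 0 <= x^-1 by rewrite invr_ge0 ltW.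
have H : (x^-1) ^+ k.+2 / (k.+2)`!%:R <= expR (x^-1).
  by apply: le_trans (expR_ge1Dxn k.+1 xi0); rewrite lerDr.
have xk : 0 < x^-1 ^+ k.+2 / (k.+2)`!%:R by rewrite divr_gt0// exprn_gt0// invr_gt0.
have -> : (k.+2)`!%:R * x ^+ 2 = x ^- k / (x^-1 ^+ k.+2 / (k.+2)`!%:R).
  rewrite invf_div exprVn invrK -addn2 exprD; field.
  by rewrite expf_neq0 ?gt_eqF.
rewrite expRN; apply: ler_wpM2l; first by rewrite invr_ge0 exprn_ge0// ltW.
by rewrite lef_pV2// posrE ?expR_gt0.
Qed.

Lemma flat_derive k x :
  dv (flat k) x ((- k%:R) * flat k.+1 x + flat k.+2 x).
Proof.
have [x0|x0|x0] := ltgtP x 0.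
- rewrite (_ : _ + _ = 0); last by rewrite /flat !ltNge (ltW x0)/= mulr0 addr0.
  apply: near_eq_is_derive (dv_cst 0 x).
  near=> y; rewrite /flat ifF//; apply/negbTE; rewrite -leNgt ltW//.
  by near: y; exact: lt_nbhsl.
- have xn0 : x != 0 by rewrite gt_eqF.
  have dV : dv (fun y => y^-1) x (- x ^- 2).
    by apply: (is_derive_eq (is_deriveV xn0 (dv_id x))); rewrite /GRing.scale/= mulr1.
  have dX : dv (fun y => y ^- k) x (- k%:R * x ^- k.+1).
    have H := is_deriveX k dV.
    rewrite (_ : (fun y => y ^- k) = (fun y => y^-1) ^+ k); last first.
      by apply/funext => y; rewrite fctE exprVn.
    apply: (is_derive_eq H); rewrite /GRing.scale/= mulrN mulNr; congr (- _).
    case: k H => [|k] H; first by rewrite !mul0r.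
    by rewrite /= -mulrA; congr (_ * _); rewrite exprVn -invfM -exprD addn2.
  have dE : dv (fun y => expR (- y^-1)) x (expR (- x^-1) * x ^- 2).
    have dN : dv (fun y => - y^-1) x (x ^- 2).
      by apply: (is_derive_eq (is_deriveN dV)); rewrite opprK.
    exact: (dv_comp (g := fun y => - y^-1) (is_derive_expR (- x^-1)) dN).
  have E : \near x, x ^- k * expR (- x^-1) = flat k x.
    by near=> y; rewrite /flat ifT//; near: y; exact: lt_nbhsr.
  apply: (near_eq_is_derive E); apply: (is_derive_eq (dvM dX dE)); rewrite /flat x0; congr (_ + _).
    by rewrite mulrA.
  by rewrite mulrCA mulrC -invfM -exprD addn2.
- rewrite x0 (_ : _ + _ = 0); last by rewrite /flat ltxx mulr0 addr0.
  apply: (@dv_quadratic _ _ (k.+2)`!%:R) => [|y]; first by rewrite /flat ltxx.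
  by rewrite subr0; exact: flat_le.
Unshelve. all: by end_near. Qed.

(** A syntactic class closed under differentiation, in place of derivatives of all orders.
    [Smooth_prim] admits the step function, which is known only as an integral. *)
Inductive smooth1 : (R -> R) -> Prop :=
| Smooth_flat k : smooth1 (flat k)
| Smooth_cst c : smooth1 (fun=> c)
| Smooth_id : smooth1 (fun x => x)
| Smooth_add f g : smooth1 f -> smooth1 g -> smooth1 (fun x => f x + g x)
| Smooth_mul f g : smooth1 f -> smooth1 g -> smooth1 (fun x => f x * g x)
| Smooth_aff f a b : smooth1 f -> smooth1 (fun x => f (a * x + b))
| Smooth_prim f g : (forall x, dv f x (g x)) -> smooth1 g -> smooth1 f.

Lemma smooth1_derive f : smooth1 f -> exists2 f', smooth1 f' & forall x, dv f x (f' x).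
Proof.
elim => {f}.
- move=> k; exists (fun x => (- k%:R) * flat k.+1 x + flat k.+2 x).
    by apply: Smooth_add; [apply: Smooth_mul; [exact: Smooth_cst|]|]; exact: Smooth_flat.
  exact: flat_derive.
- by move=> c; exists (fun=> 0); [exact: Smooth_cst|move=> x; exact: dv_cst].
- by exists (fun=> 1); [exact: Smooth_cst|move=> x; exact: dv_id].
- move=> f g _ [f' sf' ff'] _ [g' sg' gg'].
  exists (fun x => f' x + g' x); first exact: Smooth_add.
  by move=> x; exact: dvD.
- move=> f g sf [f' sf' ff'] sg [g' sg' gg'].
  exists (fun x => f' x * g x + f x * g' x).
    by apply: Smooth_add; exact: Smooth_mul.
  by move=> x; exact: dvM.
- move=> f a b sf [f' sf' ff']; exists (fun x => a * f' (a * x + b)).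
    by apply: Smooth_mul; [exact: Smooth_cst|exact: Smooth_aff].
  by move=> x; exact: dv_comp_aff.
- by move=> f g fg sg _; exists g.
Qed.

Lemma dv_derive1 f x l : dv f x l -> f^`()%classic x = l.
Proof. by move=> df; rewrite derive1E; exact: derive_val. Qed.

Lemma smooth1_derive1 f : smooth1 f ->
  smooth1 f^`()%classic /\ forall x, dv f x (f^`()%classic x).
Proof.
move=> /smooth1_derive[f' sf' ff'].
suff -> : f^`()%classic = f' by [].
by apply/funext => x; exact: dv_derive1.
Qed.

Lemma smooth1_continuous f : smooth1 f -> continuous f.
Proof. by move=> /smooth1_derive[f' _ ff'] x; exact: dv_continuous (ff' x). Qed.

Definition csmooth f := smooth1 f /\ exists M, forall x, M < `|x| -> f x = 0.

Lemma csmooth_derive1 f : csmooth f ->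
  csmooth f^`()%classic /\ forall x, dv f x (f^`()%classic x).
Proof.
move=> [sf [M fM]]; have [sf' ff'] := smooth1_derive1 sf; split => //; split => //.
exists M => x Mx; apply: dv_derive1.
apply: near_eq_is_derive (dv_cst 0 x); near=> y; rewrite fM//.
near: y; have : continuous_at x (fun y : R => `|y|) by exact: norm_continuous.
by move=> /cvgrPdist_lt H; apply: (cvgr_gt `|x|) => //; exact: norm_continuous.
Unshelve. all: by end_near. Qed.

Lemma csmooth_mulx f : csmooth f -> csmooth (fun x => x * f x).
Proof.
move=> [sf [M fM]]; split; first by apply: Smooth_mul => //; exact: Smooth_id.
by exists M => x /fM ->; rewrite mulr0.
Qed.

Lemma csmooth_bounded f : csmooth f -> exists2 C, 0 < C & forall x, `|f x| <= C.
Proof.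
move=> [sf [M fM]]; have cf := smooth1_continuous sf.
have M1 : - (`|M| + 1) <= `|M| + 1 :> R by rewrite ge0_cp ?addr_ge0.
have [c _ cM] := @EVT_max _ (fun x => `|f x|) _ _ M1
  (continuous_subspaceT (fun x => continuous_comp (cf x) (@norm_continuous _ _ (f x)))).
exists (`|f c| + 1); first by rewrite ltr_wpDl.
move=> x; have [xM|xM] := leP `|x| (`|M| + 1).
  by rewrite (le_trans (cM x _)) ?lerDl// in_itv/= -ler_norml.
rewrite fM ?normr0 ?addr_ge0//; apply: le_lt_trans xM.
by rewrite (le_trans (ler_norm _)) // lerDl.
Qed.

Lemma csmooth_lipschitz f : csmooth f ->
  exists2 C, 0 < C & forall x y, `|f x - f y| <= C * `|x - y|.
Proof.
move=> cf; have [cf' ff'] := csmooth_derive1 cf.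
have [C C0 fC] := csmooth_bounded cf'; exists C => // x y.
wlog xy : x y / x <= y => [H|].
  by have [/H//|/ltW/H] := leP x y; rewrite distrC (distrC y).
have [c _ E] := MVT_segment xy (fun z _ => ff' z)
  (continuous_subspaceT (fun z => dv_continuous (ff' z))).
by rewrite distrC E normrM distrC ler_wpM2r.
Qed.

Lemma csmooth_measurable f : csmooth f -> measurable_fun setT f.
Proof. by move=> [sf _]; apply: continuous_measurable_fun; exact: smooth1_continuous. Qed.

End real_calculus.

Section multivariate_calculus.
Variables (R : realType) (n : nat).
Local Notation V := (n.-tuple R).
Local Notation dv f x l := (is_derive (x : R) (1 : R) (f : R -> R) (l : R)).
Implicit Types (phi psi : V -> R) (z w : V).

(** Closed under partial derivatives and large enough for pullbacks of kernels by affine maps, which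
    mix the coordinates and destroy the product form. *)
Inductive elem : (V -> R) -> Prop :=
| Elem_comp g (a : 'I_n -> R) b : smooth1 g ->
    elem (fun z => g (\sum_j a j * tnth z j + b))
| Elem_add phi psi : elem phi -> elem psi -> elem (fun z => phi z + psi z)
| Elem_mul phi psi : elem phi -> elem psi -> elem (fun z => phi z * psi z).

Lemma elem_cst c : elem (fun=> c).
Proof. exact: (@Elem_comp (fun=> c) (fun=> 0) 0 (Smooth_cst c)). Qed.

Lemma elem_deriv phi : elem phi -> exists psi : 'I_n -> V -> R,
  (forall k, elem (psi k)) /\
  forall k z, dv (fun s => phi (upd z k s)) 0 (psi k z).
Proof.
elim => {phi}.
- move=> g a b sg; have [sg' gg'] := smooth1_derive1 sg.
  exists (fun k z => a k * g^`()%classic (\sum_j a j * tnth z j + b)); split => [k|k z].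
    by apply: Elem_mul; [exact: elem_cst|exact: Elem_comp].
  rewrite (_ : (fun s => _) = fun s => g (a k * s + (\sum_j a j * tnth z j + b))).
    by apply: dv_comp_aff; rewrite mulr0 add0r; exact: gg'.
  apply/funext => s; congr g; rewrite addrA; congr (_ + b).
  under eq_bigr do rewrite tnth_mktuple mulrDr.
  rewrite big_split/= addrC; congr (_ + _).
  rewrite (bigD1 k)//= eqxx big1 ?addr0// => j /negbTE ->.
  by rewrite mulr0.
- move=> phi psi _ [phi' [ephi' dphi]] _ [psi' [epsi' dpsi]].
  exists (fun k z => phi' k z + psi' k z); split => [k|k z]; first exact: Elem_add.
  exact: dvD.
- move=> phi psi ephi [phi' [ephi' dphi]] epsi [psi' [epsi' dpsi]].
  have upd0 k z : upd z k 0 = z.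
    by apply: eq_from_tnth => j; rewrite tnth_mktuple; case: ifP; rewrite addr0.
  exists (fun k z => phi' k z * psi z + phi z * psi' k z); split => [k|k z].
    by apply: Elem_add; exact: Elem_mul.
  by have := dvM (dphi k z) (dpsi k z); rewrite upd0.
Qed.

Lemma partial_dv k phi z l : dv (fun s => phi (upd z k s)) 0 l -> partial k phi z = l.
Proof. exact: dv_derive1. Qed.

Lemma elem_cont phi : elem phi -> cont_Rn phi.
Proof.
elim => {phi}.
- move=> g a b sg z e e0.
  have cg : continuous_at (\sum_j a j * tnth z j + b) g by exact: smooth1_continuous sg _.
  move/cvgrPdist_lt : cg => /(_ e e0) /nbhs_ballP[r r0 rg].
  pose A := \sum_j `|a j| + 1.
  have A0 : 0 < A by rewrite ltr_wpDl// sumr_ge0.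
  exists (r / A) => [|w wz]; first by rewrite divr_gt0.
  rewrite distrC; apply: rg => /=.
  rewrite /ball/= opprD addrACA subrr addr0 -sumrB.
  apply: (le_lt_trans (ler_norm_sum _ _ _)).
  apply: (@le_lt_trans _ _ (\sum_j `|a j| * (r / A))).
    apply: ler_sum => j _; rewrite -mulrBr normrM ler_wpM2l//.
    by rewrite distrC ltW.
  rewrite -mulr_suml mulrCA gtr_pMr// ltr_pdivrMr// mul1r.
  by rewrite /A ltrDl.
- move=> phi psi _ cphi _ cpsi z e e0.
  have e2 : 0 < e / 2 by rewrite divr_gt0.
  have [d1 d10 H1] := cphi z _ e2; have [d2 d20 H2] := cpsi z _ e2.
  exists (Num.min d1 d2) => [|w wz]; first by rewrite lt_min d10.
  rewrite opprD addrACA (le_lt_trans (ler_normD _ _))// (splitr e) ltrD//.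
    by apply: H1 => j; have := wz j; rewrite lt_min => /andP[].
  by apply: H2 => j; have := wz j; rewrite lt_min => /andP[].
- move=> phi psi _ cphi _ cpsi z e e0.
  have B0 : 0 < `|psi z| + 1 by rewrite ltr_wpDl.
  have A0 : 0 < `|phi z| + 1 by rewrite ltr_wpDl.
  have e1 : 0 < e / 2 / (`|psi z| + 1) by rewrite !divr_gt0.
  (* The cap 1 bounds [|psi w|] by [|psi z| + 1] in the first half of the product estimate. *)
  have e2 : 0 < Num.min 1 (e / 2 / (`|phi z| + 1)) by rewrite lt_min ltr01 !divr_gt0.
  have [d1 d10 H1] := cphi z _ e1; have [d2 d20 H2] := cpsi z _ e2.
  exists (Num.min d1 d2) => [|w wz]; first by rewrite lt_min d10.
  have {}H1 : `|phi w - phi z| < e / 2 / (`|psi z| + 1).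
    by apply: H1 => j; have := wz j; rewrite lt_min => /andP[].
  have : `|psi w - psi z| < Num.min 1 (e / 2 / (`|phi z| + 1)).
    by apply: H2 => j; have := wz j; rewrite lt_min => /andP[].
  rewrite lt_min => /andP[H2' {}H2].
  have -> : phi w * psi w - phi z * psi z =
    (phi w - phi z) * psi w + phi z * (psi w - psi z) by ring.
  rewrite (le_lt_trans (ler_normD _ _))// !normrM (splitr e) ltr_leD//.
    apply: (@le_lt_trans _ _ (`|phi w - phi z| * (`|psi z| + 1))).
      apply: ler_wpM2l => //; have -> : psi w = psi z + (psi w - psi z) by ring.
      by rewrite (le_trans (ler_normD _ _))// lerD2l ltW.
    by rewrite -ltr_pdivlMr.
  apply: (@le_trans _ _ ((`|phi z| + 1) * `|psi w - psi z|)).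
    by apply: ler_wpM2r => //; rewrite lerDl.
  by rewrite -ler_pdivlMl// mulrC ltW.
Qed.

Lemma elem_smooth phi : elem phi -> smooth phi.
Proof.
move=> ephi ks /=.
suff : elem (foldr (@partial R n) phi ks).
  move=> E; split; first exact: elem_cont.
  move=> k z; have [psi [_ /(_ k z)]] := elem_deriv E.
  by case.
elim: ks => //= k ks E; have [psi [epsi dpsi]] := elem_deriv E.
rewrite (_ : partial _ _ = psi k)//.
by apply/funext => z; exact: partial_dv (dpsi k z).
Qed.

(** The class of the kernels: stable under partial derivatives and multiplication by coordinates,
    hence under [Ykin], and made of compactly supported, bounded Lipschitz functions. *)
Inductive tens : (V -> R) -> Prop :=
| Tens_prod (g : 'I_n -> R -> R) : (forall j, csmooth (g j)) ->
    tens (fun z => \prod_j g j (tnth z j))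
| Tens_add phi psi : tens phi -> tens psi -> tens (fun z => phi z + psi z)
| Tens_scale c phi : tens phi -> tens (fun z => c * phi z).

Lemma dv_prod (I : eqType) (r : seq I) (F : I -> R -> R) (F' : I -> R) x :
  uniq r -> (forall i, dv (F i) x (F' i)) ->
  dv (fun s => \prod_(i <- r) F i s) x
     (\sum_(i <- r) \prod_(j <- r) (if j == i then F' j else F j x)).
Proof.
move=> + dF; elim: r => [_|i r ih /= /andP[ir ur]].
  rewrite big_nil (_ : (fun s => _) = fun=> 1); first exact: dv_cst.
  by apply/funext => s; rewrite big_nil.
rewrite (_ : (fun s => _) = fun s => F i s * \prod_(i <- r) F i s); last first.
  by apply/funext => s; rewrite big_cons.
apply: (is_derive_eq (dvM (dF i) (ih ur))); rewrite !big_cons eqxx; congr (_ + _).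
  congr (_ * _); apply: eq_big_seq => j jr.
  by case: eqP => // ji; rewrite -ji jr in ir.
rewrite mulr_sumr; apply: eq_big_seq => j jr; rewrite big_cons.
by case: eqP => // ij; rewrite ij jr in ir.
Qed.

(** An arbitrary direction [c] is allowed because moving [z] along a coordinate axis moves
    [act_inv z] along a skew line. *)
Lemma tens_deriv phi : tens phi -> exists psi : 'I_n -> V -> R,
  (forall k, tens (psi k)) /\
  forall (c : 'I_n -> R) z,
    dv (fun s => phi [tuple tnth z j + s * c j | j < n]) 0 (\sum_k c k * psi k z).
Proof.
elim => {phi}.
- move=> g cg.
  exists (fun k z => \prod_j (if j == k then (g j)^`()%classic else g j) (tnth z j)).
  split => [k|c z].
    apply: (@Tens_prod (fun j => if j == k then (g j)^`()%classic else g j)) => j.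
    by case: ifP => _ //; exact: (csmooth_derive1 (cg j)).1.
  have dF j : dv (fun s => g j (c j * s + tnth z j)) 0 (c j * (g j)^`()%classic (tnth z j)).
    apply: (@dv_comp_aff _ (g j) (c j) (tnth z j) 0); rewrite mulr0 add0r.
    exact: (csmooth_derive1 (cg j)).2.
  rewrite (_ : (fun s => _) = fun s => \prod_j g j (c j * s + tnth z j)); last first.
    by apply/funext => s; apply: eq_bigr => j _; rewrite tnth_mktuple addrC mulrC.
  apply: (is_derive_eq (dv_prod (index_enum_uniq _) dF)).
  apply: eq_bigr => k _; rewrite (bigD1 k)//= eqxx [in RHS](bigD1 k)//= eqxx mulrA.
  congr (_ * _); apply: eq_bigr => j /negbTE jk.
  by rewrite jk mulr0 add0r.
- move=> phi psi _ [phi' [tphi' dphi]] _ [psi' [tpsi' dpsi]].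
  exists (fun k z => phi' k z + psi' k z); split => [k|c z]; first exact: Tens_add.
  under eq_bigr do rewrite mulrDr.
  by rewrite big_split/=; exact: dvD.
- move=> a phi _ [phi' [tphi' dphi]].
  exists (fun k z => a * phi' k z); split => [k|c z]; first exact: Tens_scale.
  apply: (is_derive_eq (dvM (dv_cst a 0) (dphi c z))); rewrite mul0r add0r mulr_sumr.
  by apply: eq_bigr => k _; rewrite mulrCA.
Qed.

Lemma tens_partial phi : tens phi ->
  (forall k, tens (partial k phi)) /\
  forall (c : 'I_n -> R) z,
    dv (fun s => phi [tuple tnth z j + s * c j | j < n]) 0 (\sum_k c k * partial k phi z).
Proof.
move=> /tens_deriv[psi [tpsi dpsi]].
suff H k : partial k phi = psi k.
  by split => [k|c z]; [rewrite H|under eq_bigr do rewrite H].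
apply/funext => z; apply: partial_dv.
rewrite (_ : psi k z = \sum_j (j == k)%:R * psi j z); last first.
  rewrite (bigD1 k)//= eqxx mul1r big1 ?addr0// => j /negbTE ->.
  by rewrite mul0r.
rewrite (_ : (fun s => _) = fun s => phi [tuple tnth z j + s * (j == k)%:R | j < n])//.
apply/funext => s; congr phi; apply: eq_from_tnth => j; rewrite !tnth_mktuple.
by case: eqP; rewrite ?mulr1 ?mulr0.
Qed.

Lemma tens_dpartial phi k z : tens phi ->
  dv (fun s => phi (upd z k s)) 0 (partial k phi z).
Proof.
move=> /tens_partial[_ /(_ (fun j => (j == k)%:R) z)].
rewrite (bigD1 k)//= eqxx mul1r big1 ?addr0; last first.
  by move=> j /negbTE ->; rewrite mul0r.
rewrite (_ : (fun s => _) = fun s => phi (upd z k s))//.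
apply/funext => s; congr phi; apply: eq_from_tnth => j; rewrite !tnth_mktuple.
by case: eqP; rewrite ?mulr1 ?mulr0.
Qed.

Lemma partialD k phi psi : tens phi -> tens psi ->
  partial k (fun z => phi z + psi z) = (fun z => partial k phi z + partial k psi z).
Proof.
move=> tp ts; apply/funext => z; apply: partial_dv.
by apply: dvD; exact: tens_dpartial.
Qed.

Lemma partialZ k c phi : tens phi ->
  partial k (fun z => c * phi z) = (fun z => c * partial k phi z).
Proof.
move=> tp; apply/funext => z; apply: partial_dv.
apply: (is_derive_eq (dvM (dv_cst c 0) (tens_dpartial k z tp))).
by rewrite mul0r add0r.
Qed.

Lemma tens_coord k phi : tens phi -> tens (fun z => tnth z k * phi z).
Proof.
elim => {phi}.
- move=> g cg.
  rewrite (_ : (fun z => _) = fun z =>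
    \prod_j (if j == k then (fun x => x * g j x) else g j) (tnth z j)).
    apply: (@Tens_prod (fun j => if j == k then (fun x => x * g j x) else g j)) => j.
    by case: ifP => _ //; exact: csmooth_mulx.
  apply/funext => z; rewrite (bigD1 k)//= [in RHS](bigD1 k)//= eqxx mulrA.
  by congr (_ * _); apply: eq_bigr => j /negbTE ->.
- move=> phi psi _ tp _ ts; rewrite (_ : (fun z => _) =
    fun z => tnth z k * phi z + tnth z k * psi z); first exact: Tens_add.
  by apply/funext => z; rewrite mulrDr.
- move=> c phi _ tp; rewrite (_ : (fun z => _) = fun z => c * (tnth z k * phi z)).
    exact: Tens_scale.
  by apply/funext => z; rewrite mulrCA.
Qed.

Lemma csmooth0 : csmooth (fun=> 0 : R).
Proof. by split; [exact: Smooth_cst|exists 0]. Qed.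

Lemma tens0 : tens (fun=> 0) .
Proof.
rewrite (_ : (fun=> 0) = fun z : V => 0 * \prod_j (fun=> 0 : R) (tnth z j)).
  apply: Tens_scale; apply: (@Tens_prod (fun=> fun=> 0)) => _; exact: csmooth0.
by apply/funext => z; rewrite mul0r.
Qed.

Lemma tens_sum (I : Type) (r : seq I) (F : I -> V -> R) :
  (forall i, tens (F i)) -> tens (fun z => \sum_(i <- r) F i z).
Proof.
move=> tF; elim: r => [|i r ih].
  by rewrite (_ : (fun z => _) = fun=> 0); [exact: tens0|apply/funext => z; rewrite big_nil].
rewrite (_ : (fun z => _) = fun z => F i z + \sum_(i <- r) F i z); first exact: Tens_add.
by apply/funext => z; rewrite big_cons.
Qed.

Definition bounded_lipschitz phi := exists M L : R, [/\ 0 < M, 0 < L,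
  (forall z, `|phi z| <= M) &
  forall e z w, 0 <= e -> (forall j, `|tnth z j - tnth w j| <= e) ->
    `|phi z - phi w| <= L * e].

Lemma bounded_lipschitzM phi psi : bounded_lipschitz phi -> bounded_lipschitz psi ->
  bounded_lipschitz (fun z => phi z * psi z).
Proof.
move=> [M [L [M0 L0 HM HL]]] [M' [L' [M0' L0' HM' HL']]].
exists (M * M'), (L * M' + M * L'); split => [||z|e z w e0 zw].
- exact: mulr_gt0.
- by rewrite addr_gt0// mulr_gt0.
- by rewrite normrM ler_pM.
- have -> : phi z * psi z - phi w * psi w =
    (phi z - phi w) * psi z + phi w * (psi z - psi w) by ring.
  rewrite (le_trans (ler_normD _ _))// !normrM mulrDl lerD//.
    by rewrite mulrAC ler_pM// HL.
  by rewrite -mulrA ler_pM// HL'.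
Qed.

Lemma tens_bounded_lipschitz phi : tens phi -> bounded_lipschitz phi.
Proof.
elim => {phi}.
- move=> g cg; elim: (index_enum _) => [|j r ih].
    exists 1, 1; split => // [z|e z w e0 _]; first by rewrite big_nil normr1.
    by rewrite !big_nil subrr normr0 mul1r.
  rewrite (_ : (fun z => _) = fun z => g j (tnth z j) * \prod_(i <- r) g i (tnth z i)).
    apply: bounded_lipschitzM => //.
    have [C C0 HC] := csmooth_bounded (cg j); have [L L0 HL] := csmooth_lipschitz (cg j).
    exists C, L; split => // e z w e0 zw.
    by rewrite (le_trans (HL _ _))// ler_wpM2l// ltW.
  by apply/funext => z; rewrite big_cons.
- move=> phi psi _ [M [L [M0 L0 HM HL]]] _ [M' [L' [M0' L0' HM' HL']]].
  exists (M + M'), (L + L'); split => [||z|e z w e0 zw]; rewrite ?addr_gt0//.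
    by rewrite (le_trans (ler_normD _ _))// lerD.
  by rewrite opprD addrACA (le_trans (ler_normD _ _))// mulrDl lerD// ?HL ?HL'.
- move=> c phi _ [M [L [M0 L0 HM HL]]].
  have c1 : 0 < `|c| + 1 by rewrite ltr_wpDl.
  exists ((`|c| + 1) * M), ((`|c| + 1) * L); split => [||z|e z w e0 zw].
  + exact: mulr_gt0.
  + exact: mulr_gt0.
  + by rewrite normrM ler_pM// lerDl.
  + by rewrite -mulrBr normrM -mulrA ler_pM// ?lerDl// HL.
Qed.

Lemma tens_compact_support phi : tens phi ->
  exists2 B, 0 < B & forall z, (exists j, B < `|tnth z j|) -> phi z = 0.
Proof.
elim => {phi}.
- move=> g cg.
  have /choice[M HM] : forall j, exists M, forall x, M < `|x| -> g j x = 0.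
    by move=> j; exact: (cg j).2.
  have S0 : 0 <= \sum_j `|M j| by rewrite sumr_ge0.
  exists (\sum_j `|M j| + 1) => [|z [j Mz]]; first by rewrite ltr_wpDl.
  apply/eqP/prodf_eq0; exists j => //; apply/eqP/HM; apply: le_lt_trans Mz.
  rewrite (bigD1 j)//= -addrA (le_trans (ler_norm _))// lerDl addr_ge0// sumr_ge0//.
- move=> phi psi _ [B B0 HB] _ [B' B0' HB'].
  exists (B + B') => [|z [j zj]]; first exact: addr_gt0.
  rewrite HB ?HB' ?addr0//; exists j; apply: le_lt_trans zj; rewrite ?lerDl ?lerDr ltW//.
- by move=> c phi _ [B B0 HB]; exists B => // z /HB ->; rewrite mulr0.
Qed.

Lemma tens_measurable phi : tens phi -> measurable_fun setT phi.
Proof.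
elim => {phi}.
- move=> g cg; apply: measurable_prod => j _.
  by apply: (measurableT_comp (csmooth_measurable (cg j))); exact: measurable_tnth.
- by move=> phi psi _ ? _ ?; exact: measurable_funD.
- by move=> c phi _ ?; exact: measurable_funM.
Qed.

Lemma tens_elem_affine phi (a : 'I_n -> 'I_n -> R) (b : 'I_n -> R) : tens phi ->
  elem (fun z => phi [tuple \sum_k a j k * tnth z k + b j | j < n]).
Proof.
elim => {phi}.
- move=> g cg; pose l z := [tuple \sum_k a j k * tnth z k + b j | j < n].
  suff H r : elem (fun z => \prod_(i <- r) g i (tnth (l z) i)) by exact: H.
  elim: r => [|j r ih].
    rewrite (_ : (fun z => _) = fun=> 1); first exact: elem_cst.
    by apply/funext => z; rewrite big_nil.
  rewrite (_ : (fun z => _) = fun z => g j (\sum_k a j k * tnth z k + b j) *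
     \prod_(i <- r) g i (tnth (l z) i)).
    by apply: Elem_mul => //; exact: (@Elem_comp (g j) (a j) (b j) (cg j).1).
  by apply/funext => z; rewrite big_cons tnth_mktuple.
- by move=> phi psi _ ? _ ?; exact: Elem_add.
- by move=> c phi _ ?; apply: Elem_mul => //; exact: elem_cst.
Qed.

End multivariate_calculus.

(** * The mollifying kernel *)

Section step_function.
Variable R : realType.
Local Notation dv f x l := (is_derive (x : R) (1 : R) (f : R -> R) (l : R)).
Local Notation leb0 := (@lebesgue_measure R).

Definition bump (x : R) : R := flat 0 x * flat 0 (-1 * x + 1).

Lemma smooth1_bump : smooth1 bump.
Proof.
by apply: Smooth_mul; [exact: Smooth_flat|apply: Smooth_aff; exact: Smooth_flat].
Qed.

Lemma bump_ge0 x : 0 <= bump x.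
Proof. by rewrite mulr_ge0// flat_ge0. Qed.

Lemma bump_eq0 x : x <= 0 \/ 1 <= x -> bump x = 0.
Proof.
rewrite /bump /flat => -[x0|x1]; first by rewrite ltNge x0 mul0r.
by rewrite [X in _ * X]ifF ?mulr0//; apply/negbTE; rewrite -leNgt; lra.
Qed.

Lemma bump_gt0 x : 0 < x -> x < 1 -> 0 < bump x.
Proof.
move=> x0 x1; rewrite /bump /flat x0 ifT; last by lra.
by rewrite !expr0 !invr1 !mul1r mulr_gt0// expR_gt0.
Qed.

Lemma integrable_bump a b : leb0.-integrable `[a, b] (EFin \o bump).
Proof.
apply: continuous_compact_integrable; first exact: segment_compact.
exact: continuous_subspaceT (smooth1_continuous smooth1_bump).
Qed.

(** The base point [-1] lies strictly left of the support, so the fundamental theorem of calculus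
    applies at [0] as an interior point. *)
Definition bump_prim (x : R) : R := \int[leb0]_(t in `[(-1), x]) bump t.

Lemma bump_prim_eq0 x : x <= 0 -> bump_prim x = 0.
Proof.
move=> x0; rewrite /bump_prim /Rintegral (eq_integral (cst 0%E)) ?integral0//.
move=> t; rewrite inE/= in_itv/= => /andP[_ tx]; rewrite bump_eq0//.
by left; exact: le_trans x0.
Qed.

Lemma bump_prim_derive x : dv bump_prim x (bump x).
Proof.
have [x0|x0] := ltP x 0.
  rewrite bump_eq0; last by left; exact: ltW.
  apply: near_eq_is_derive (dv_cst 0 x); near=> y; rewrite bump_prim_eq0// ltW//.
  by near: y; exact: lt_nbhsl.
have [|||H1 H2] := @continuous_FTC1_closed R bump (-1) x (x + 1) _ (integrable_bump _ _).
- by rewrite ltrDl.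
- by lra.
- exact: (smooth1_continuous smooth1_bump).
have H3 : 'D_1 bump_prim x = bump x by rewrite -derive1E; exact: H2.
exact: (DeriveDef H1 H3).
Unshelve. all: by end_near. Qed.

Lemma bump_prim_le x y : x <= y -> bump_prim x <= bump_prim y.
Proof.
move=> xy; have [c _ E] := MVT_segment xy (fun z _ => bump_prim_derive z)
  (continuous_subspaceT (fun z => dv_continuous (bump_prim_derive z))).
by rewrite -subr_ge0 E mulr_ge0 ?bump_ge0 ?subr_ge0.
Qed.

Lemma bump_prim_cst x : 1 <= x -> bump_prim x = bump_prim 1.
Proof.
move=> x1; have [c cx E] := MVT_segment x1 (fun z _ => bump_prim_derive z)
  (continuous_subspaceT (fun z => dv_continuous (bump_prim_derive z))).
apply/eqP; rewrite -subr_eq0 E bump_eq0 ?mul0r//; right.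
by move: cx; rewrite in_itv/= => /andP[].
Qed.

Lemma bump_prim1_gt0 : 0 < bump_prim 1.
Proof.
(* The mean value point is not controlled, so the interval is taken well inside [(0, 1)], where
   [bump] is positive throughout. *)
have h : 4^-1 <= 2^-1 :> R by lra.
have [c cx E] := MVT_segment h (fun z _ => bump_prim_derive z)
  (continuous_subspaceT (fun z => dv_continuous (bump_prim_derive z))).
move: cx; rewrite in_itv/= => /andP[c1 c2].
have b0 : 0 < bump_prim 2^-1 - bump_prim 4^-1.
  have c0 : 0 < c by apply: lt_le_trans c1; lra.
  have c3 : c < 1 by apply: (le_lt_trans c2); lra.
  have h' : 0 < 2^-1 - 4^-1 :> R by rewrite subr_gt0 ltf_pV2 ?posrE// ltr_nat.
  by rewrite E mulr_gt0// bump_gt0.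
have : bump_prim 0 <= bump_prim 4^-1 by apply: bump_prim_le; lra.
have : bump_prim 2^-1 <= bump_prim 1 by apply: bump_prim_le; lra.
rewrite (bump_prim_eq0 (lexx 0)); lra.
Qed.

Lemma integral_bump : (\int[leb R]_x (bump x)%:E = (bump_prim 1)%:E)%E.
Proof.
have mb : measurable_fun setT (EFin \o bump).
  apply/measurable_EFinP; apply: continuous_measurable_fun.
  exact: smooth1_continuous smooth1_bump.
rewrite -integral_leb// /bump_prim /Rintegral fineK; last first.
  by apply: integrable_fin_num => //; exact: integrable_bump.
rewrite [RHS]integral_mkcond; apply: eq_integral => x _.
rewrite patchE; case: ifPn => //; rewrite notin_setE/= in_itv/= => /negP.
rewrite negb_and -!ltNge => /orP[x1|x1]; rewrite bump_eq0//; [left|right]; lra.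
Qed.

(** [th] is the primitive of [bump] normalised to final value 1. The kernel is built from [a]; [th]
    provides the primitives of differences of rescaled copies of [a]. *)
Lemma smooth_step_exists : exists th a : R -> R,
  [/\ smooth1 th, csmooth a, (forall x, dv th x (a x)),
      (forall x, 0 <= a x) /\ (\int[leb R]_x (a x)%:E = 1)%E &
      (forall x, x <= 0 -> th x = 0) /\ (forall x, 1 <= x -> th x = 1)].
Proof.
have m0 := bump_prim1_gt0; pose m := (bump_prim 1)^-1.
have m0' : 0 < m by rewrite invr_gt0.
exists (fun x => m * bump_prim x), (fun x => m * bump x); split.
- apply: Smooth_mul; first exact: Smooth_cst.
  exact: Smooth_prim bump_prim_derive smooth1_bump.
- split; first by apply: Smooth_mul; [exact: Smooth_cst|exact: smooth1_bump].
  exists 1 => x; rewrite ltr_normr => /orP[x1|x1]; rewrite bump_eq0 ?mulr0//; [right|left]; lra.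
- move=> x; apply: (is_derive_eq (dvM (dv_cst m x) (bump_prim_derive x))).
  by rewrite mul0r add0r.
- split=> [x|]; first by rewrite mulr_ge0 ?bump_ge0// ltW.
  have mb : measurable_fun setT (EFin \o bump).
    apply/measurable_EFinP; apply: continuous_measurable_fun.
    exact: smooth1_continuous smooth1_bump.
  transitivity (m%:E * \int[leb R]_x (bump x)%:E)%E.
    rewrite -(ge0_integralZT (leb R) (ltW m0') mb)// => x.
    by rewrite lee_fin bump_ge0.
  by rewrite integral_bump -EFinM mulVf// gt_eqF.
- split=> x x01; first by rewrite bump_prim_eq0// mulr0.
  by rewrite bump_prim_cst// mulVf// gt_eqF.
Qed.

Lemma ge0_integral_prod n (g : 'I_n -> R -> R) :
  (forall j, measurable_fun setT (g j)) -> (forall j x, 0 <= g j x) ->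
  (forall j, \int[leb R]_x (g j x)%:E = 1)%E ->
  (\int[lebn R n]_z (\prod_j g j (tnth z j))%:E = 1)%E.
Proof.
elim: n g => [|n ih] g mg g0 g1.
  rewrite integral_lebn0 ?big_ord0// (_ : (fun z => _) = cst 1%E)//.
  by apply/funext => z; rewrite big_ord0.
rewrite ge0_integral_lebnS; last 2 first.
- apply/measurable_EFinP; apply: measurable_prod => j _.
  by apply: (measurableT_comp (mg j)); exact: measurable_tnth.
- by move=> z; rewrite lee_fin prodr_ge0.
rewrite -[RHS](g1 ord0); apply: eq_integral => x _.
have mP : measurable_fun setT (fun y : n.-tuple R =>
    (\prod_(i < n) g (lift ord0 i) (tnth y i))%:E).
  apply/measurable_EFinP; apply: measurable_prod => j _.
  by apply: (measurableT_comp (mg _)); exact: measurable_tnth.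
transitivity ((g ord0 x)%:E * \int[lebn R n]_y (\prod_(i < n) g (lift ord0 i) (tnth y i))%:E)%E.
  rewrite -(ge0_integralZT (lebn R n) (g0 ord0 x) mP); last first.
    by move=> y; rewrite lee_fin prodr_ge0.
  apply: eq_integral => y _; rewrite big_ord_recl EFinM tnth0.
  by under eq_bigr do rewrite tnthS.
by rewrite (ih (fun i => g (lift ord0 i))) ?mule1.
Qed.

End step_function.

(** * Differences of product kernels as divergences *)

Section kernel_decomposition.
Variables (R : realType).
Local Notation dv f x l := (is_derive (x : R) (1 : R) (f : R -> R) (l : R)).

(** Factors are exchanged one at a time from the left, so each term contains a single difference,
    which for the kernels is an exact derivative in the variable [j]. *)
Lemma prodB_telescope n (u v : 'I_n -> R) : \prod_j u j - \prod_j v j =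
  \sum_(j < n) \prod_(i < n) (if (i < j)%N then v i else if i == j then u j - v j else u i).
Proof.
elim: n u v => [|n ih] u v; first by rewrite !big_ord0 subrr.
rewrite big_ord_recl [in X in _ - X]big_ord_recl [in RHS]big_ord_recl.
set S := (X in _ = _ + X).
have -> : S = v ord0 * (\prod_(i < n) u (lift ord0 i) - \prod_(i < n) v (lift ord0 i)).
  rewrite ih mulr_sumr; apply: eq_bigr => j _; rewrite [in LHS]big_ord_recl.
  congr (_ * _); apply: eq_bigr => i _.
rewrite big_ord_recl [X in _ = _ * X + _](_ : _ = \prod_(i < n) u (lift ord0 i))//.
by rewrite /=; ring.
Qed.

Variable n : nat.
Local Notation V := (n.-tuple R).

Lemma partial_prod k (g : 'I_n -> R -> R) : (forall j, csmooth (g j)) ->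
  partial k (fun z : V => \prod_j g j (tnth z j)) =
  fun z : V => \prod_j (if j == k then (g j)^`()%classic else g j) (tnth z j).
Proof.
move=> cg; apply/funext => z; apply: partial_dv.
pose c j : R := (j == k)%:R.
have dF j : dv (fun s => g j (c j * s + tnth z j)) 0 (c j * (g j)^`()%classic (tnth z j)).
  apply: (@dv_comp_aff _ (g j) (c j) (tnth z j) 0); rewrite mulr0 add0r.
  exact: (csmooth_derive1 (cg j)).2.
rewrite (_ : (fun s => _) = fun s => \prod_j g j (c j * s + tnth z j)); last first.
  apply/funext => s; apply: eq_bigr => j _; rewrite tnth_mktuple addrC /c.
  by case: eqP; rewrite ?mul1r ?mul0r.
apply: (is_derive_eq (dv_prod (index_enum_uniq _) dF)).
rewrite (bigD1 k)//= [X in _ + X]big1 => [|i ik]; last first.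
  by rewrite (bigD1 i)//= eqxx /c (negbTE ik) mul0r mul0r.
rewrite addr0; apply: eq_bigr => j _; rewrite /c.
by case: eqP => _; rewrite ?mul1r// mulr0 add0r.
Qed.

(** On a product, derivatives in different variables act on different factors. *)
Lemma partialC k l (phi : V -> R) : tens phi ->
  partial k (partial l phi) = partial l (partial k phi).
Proof.
elim => {phi}.
- move=> g cg; have [->//|kl] := eqVneq k l.
  pose g' k j := if j == k then (g j)^`()%classic else g j.
  have cg' k' j : csmooth (g' k' j).
    by rewrite /g'; case: eqP => _ //; exact: (csmooth_derive1 (cg j)).1.
  rewrite (partial_prod l cg) (partial_prod k (cg' l)) (partial_prod k cg).
  rewrite (partial_prod l (cg' k)); apply/funext => z; apply: eq_bigr => j _.
  by rewrite /g'; case: eqP => [->|]; rewrite ?(negbTE kl)//; case: eqP.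
- move=> phi psi tp ihp ts ihs; have [tp' _] := tens_partial tp.
  have [ts' _] := tens_partial ts.
  by rewrite (partialD l tp ts) (partialD k tp ts) (partialD k (tp' l) (ts' l))
    (partialD l (tp' k) (ts' k)) ihp ihs.
- move=> c phi tp ihp; have [tp' _] := tens_partial tp.
  by rewrite (partialZ l c tp) (partialZ k c tp) (partialZ k c (tp' l))
    (partialZ l c (tp' k)) ihp.
Qed.

Lemma partial_coord k l (phi : V -> R) : tens phi ->
  partial k (fun z => tnth z l * phi z) =
  (fun z => (l == k)%:R * phi z + tnth z l * partial k phi z).
Proof.
move=> tp; apply/funext => z; apply: partial_dv.
have d1 : dv (fun s => tnth (upd z k s) l) 0 (l == k)%:R.
  rewrite (_ : (fun s => _) = fun s => (l == k)%:R * s + tnth z l); first exact: dv_aff.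
  apply/funext => s; rewrite tnth_mktuple addrC.
  by case: eqP; rewrite ?mul1r ?mul0r.
have upd0 : upd z k 0 = z.
  by apply: eq_from_tnth => j; rewrite tnth_mktuple; case: ifP; rewrite addr0.
by apply: (is_derive_eq (dvM d1 (tens_dpartial k z tp))); rewrite upd0.
Qed.

Lemma partial_sum (I : Type) (r : seq I) k (F : I -> V -> R) : (forall i, tens (F i)) ->
  partial k (fun z => \sum_(i <- r) F i z) = fun z => \sum_(i <- r) partial k (F i) z.
Proof.
move=> tF; elim: r => [|i r ih].
  rewrite (_ : (fun z => _) = fun=> 0); last by apply/funext => z; rewrite big_nil.
  apply/funext => z; rewrite big_nil; apply: partial_dv; exact: dv_cst.
rewrite (_ : (fun z => _) = fun z => F i z + \sum_(i <- r) F i z); last first.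
  by apply/funext => z; rewrite big_cons.
rewrite (partialD k (tF i) (tens_sum r tF)).
by rewrite ih; apply/funext => z; rewrite big_cons.
Qed.

(* With [th] a smooth step and [a] its derivative, [th x - th (x / c)] is a compactly
   supported primitive of [a x - a (x / c) / c]. *)
Lemma kernel_difference (a th : R -> R) (c : 'I_n -> R) :
  smooth1 th -> csmooth a -> (forall x, dv th x (a x)) ->
  (forall x, x <= 0 -> th x = 0) -> (forall x, 1 <= x -> th x = 1) ->
  (forall j, 0 < c j) ->
  exists B : 'I_n -> V -> R, (forall j, tens (B j)) /\ forall z,
    \prod_j a (tnth z j) - \prod_j ((c j)^-1 * a ((c j)^-1 * tnth z j + 0)) =
    \sum_j partial j (B j) z.
Proof.
move=> sth ca dth th0 th1 c0.
pose ac j x := (c j)^-1 * a ((c j)^-1 * x + 0).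
have ci0 j : 0 < (c j)^-1 by rewrite invr_gt0.
have cac j : csmooth (ac j).
  split.
    by apply: Smooth_mul; [exact: Smooth_cst|apply: Smooth_aff; exact: ca.1].
  have [M HM] := ca.2; exists (c j * `|M|) => x Mx; rewrite /ac HM ?mulr0//.
  rewrite addr0 normrM gtr0_norm// ltr_pdivlMl//.
  by apply: le_lt_trans Mx; rewrite ler_wpM2l ?ler_norm// ltW.
pose A j x := th x + (-1) * th ((c j)^-1 * x + 0).
have dA j x : dv (A j) x (a x - ac j x).
  have H := dvM (dv_cst (-1) x) (dv_comp_aff (dth ((c j)^-1 * x + 0))).
  by apply: (is_derive_eq (dvD (dth x) H)); rewrite mul0r add0r mulN1r.
have cA j : csmooth (A j).
  split.
    apply: Smooth_add => //; apply: Smooth_mul; first exact: Smooth_cst.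
    exact: Smooth_aff.
  exists (1 + c j) => x; rewrite ltr_normr /A addr0 => /orP[x1|x1].
    rewrite !th1 ?mulr1 ?subrr//.
      by rewrite ler_pdivlMl// mulr1; have := c0 j; lra.
    by have := c0 j; lra.
  have xn : x <= 0 by have := c0 j; lra.
  by rewrite !th0 ?mulr0 ?addr0// pmulr_rle0.
pose g (j i : 'I_n) := if (i < j)%N then ac i else if i == j then A j else a.
have cg j i : csmooth (g j i) by rewrite /g; case: ifP => // _; case: ifP.
exists (fun j z => \prod_i g j i (tnth z i)); split => [j|z]; first exact: Tens_prod.
rewrite (prodB_telescope (fun j => a (tnth z j)) (fun j => ac j (tnth z j))).
apply: eq_bigr => j _; rewrite partial_prod//; apply: eq_bigr => i _.
rewrite /g; case: (ltngtP i j) => ij.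
- by rewrite ifF//; apply/negbTE; rewrite neq_ltn ij.
- by rewrite !ifF//; apply/negbTE; rewrite neq_ltn ij ?orbT.
- have -> : i = j by apply/val_inj.
  by rewrite eqxx; symmetry; apply: dv_derive1.
Qed.

End kernel_decomposition.

(** * Boxes and local integrability *)

Section boxes.
Variables (R : realType) (n : nat).
Local Notation V := (n.-tuple R).
Local Notation mu := (lebn R n).

Definition box (B : R) : set V := [set z | forall j, `|tnth z j| <= B].

Lemma measurable_box B : measurable (box B).
Proof.
rewrite (_ : box B = \bigcap_(j in [set: 'I_n]) ((fun z : V => tnth z j) @^-1` `[- B, B])).
  apply: fin_bigcap_measurable; first exact: finite_finset.
  move=> j _; rewrite -[X in measurable X]setTI; exact: measurable_tnth.
apply/seteqP; split => z /= H j; have := H j; rewrite ?in_itv/= ler_norml//.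
by move=> /(_ I); rewrite in_itv.
Qed.
Hint Resolve measurable_box : core.

(** The normalised indicator of the box is a product of one-variable densities of integral 1. *)
Lemma lebn_box B : 0 < B -> (mu : {measure set V -> \bar R}) (box B) = ((2 * B) ^+ n)%:E.
Proof.
move=> B0; have B2 : 0 < 2 * B by rewrite mulr_gt0.
pose g (j : 'I_n) (x : R) : R := (2 * B)^-1 * \1_(`[- B, B]%classic) x.
have mg j : measurable_fun setT (g j).
  by apply: measurable_funM => //; exact: measurable_indic.
have g0 j x : 0 <= g j x by rewrite mulr_ge0// invr_ge0 ltW.
have g1 j : (\int[leb R]_x (g j x)%:E = 1)%E.
  have mi : measurable_fun setT (fun x : R => (\1_(`[- B, B]%classic) x)%:E : \bar R).
    by apply/measurable_EFinP; exact: measurable_indic.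
  have B2' : 0 <= (2 * B)^-1 by rewrite invr_ge0 ltW.
  transitivity (((2 * B)^-1)%:E * \int[leb R]_x (\1_(`[- B, B]%classic) x)%:E)%E.
    by rewrite -(ge0_integralZT (leb R) B2' mi)// => x; rewrite /= lee_fin.
  rewrite integral_indic// setIT [X in (_ * X)%E](lebE (R := R)) lebesgue_measure_itv/= lte_fin ifT; last by lra.
  by rewrite -EFinB -EFinM; congr EFin; field; rewrite gt_eqF.
have := ge0_integral_prod mg g0 g1.
have -> : (fun z : V => (\prod_j g j (tnth z j))%:E) =
    (fun z => (((2 * B) ^+ n)^-1)%:E * (\1_(box B) z)%:E)%E.
  apply/funext => z; rewrite -EFinM; congr EFin; rewrite big_split/=.
  rewrite prodr_const card_ord exprVn; congr (_ * _); rewrite indicE.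
  have [zB|zB] := boolP (z \in box B).
    rewrite big1// => j _; rewrite indicE mem_set//= in_itv/= -ler_norml.
    by move/set_mem : zB => /(_ j).
  have [j /negP zj] : exists j, ~ (`|tnth z j| <= B).
    by apply/existsNP => H; move/negP : zB; apply; rewrite inE.
  apply/eqP/prodf_eq0; exists j => //; rewrite indicE memNset//= in_itv/= -ler_norml.
  exact/negP.
rewrite ge0_integralZT//; last 2 first.
- by rewrite invr_ge0 exprn_ge0// ltW.
- by apply/measurable_EFinP; exact: measurable_indic.
rewrite integral_indic// setIT => /eqP; rewrite eqe_pdivrMl ?mule1 => [/eqP//|].
by rewrite expf_neq0// gt_eqF.
Qed.

(** A substitute for Holder's inequality: on a box of finite measure it makes [L^p] functions
    integrable. *)
Lemma ler_powR1D (x p : R) : 0 <= x -> 1 <= p -> x <= 1 + x `^ p.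
Proof.
move=> x0 p1; have [x1|x1] := leP x 1.
  by rewrite (le_trans x1)// lerDl powR_ge0.
rewrite -[leLHS]powRr1//; apply: (@le_trans _ _ (x `^ p)); last by rewrite lerDr.
by apply: ler_powR => //; exact: ltW.
Qed.

Definition Lpfin p (u : V -> R) := measurable_fun setT u /\
  (\int[mu]_z ((`|u z|) `^ p)%:E < +oo)%E.

Lemma measurable_powR_norm p (u : V -> R) : measurable_fun setT u ->
  measurable_fun setT (fun z => ((`|u z|) `^ p)%:E).
Proof.
move=> mu_; apply/measurable_EFinP.
by apply: (measurableT_comp (measurable_powR p)); exact: measurableT_comp.
Qed.

Lemma Ipow_int p (u : V -> R) : measurable_fun setT u ->
  Ipow p u = (\int[mu]_z ((`|u z|) `^ p)%:E)%E.
Proof.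
move=> mu_; by rewrite /Ipow iint_ge0//; exact: measurable_powR_norm.
Qed.

Lemma integrable_mul_box p (u phi : V -> R) M B : 1 <= p -> 0 < B -> Lpfin p u ->
  measurable_fun setT phi -> (forall z, `|phi z| <= M) ->
  (forall z, ~ box B z -> phi z = 0) ->
  mu.-integrable setT (fun z => (u z * phi z)%:E).
Proof.
move=> p1 B0 [mu_ uoo] mphi phiM phiB.
have mF : measurable_fun setT (fun z => (\1_(box B) z)%:E + ((`|u z|) `^ p)%:E : \bar R)%E.
  apply: emeasurable_funD; last exact: measurable_powR_norm.
  by apply/measurable_EFinP; exact: measurable_indic.
have iF : mu.-integrable setT (fun z => M%:E * ((\1_(box B) z)%:E + ((`|u z|) `^ p)%:E))%E.
  apply: integrableZl => //; apply/integrableP; split => //.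
  under eq_integral => z _ do rewrite gee0_abs ?adde_ge0 ?lee_fin ?powR_ge0//.
  have mI : measurable_fun setT (fun z => (\1_(box B) z)%:E : \bar R).
    by apply/measurable_EFinP; exact: measurable_indic.
  have mP := measurable_powR_norm p mu_.
  rewrite (@ge0_integralD _ _ _ mu _ measurableT) //.
  by rewrite lte_add_pinfty// integral_indic// setIT lebn_box// ltry.
apply: (le_integrable measurableT _ _ iF).
  by apply/measurable_EFinP; exact: measurable_funM.
move=> z _; have M0 : 0 <= M by exact: le_trans (phiM z).
rewrite -EFinD -EFinM lee_fin [leLHS]normrM [leRHS]ger0_norm; last first.
  by rewrite mulr_ge0// addr_ge0// powR_ge0.
have [zB|zB] := pselect (box B z); last first.
  by rewrite phiB// normr0 mulr0 mulr_ge0// addr_ge0// powR_ge0.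
by rewrite mulrC ler_pM// indicE mem_set// ler_powR1D.
Qed.

Lemma integrable_mul_tens p (u phi : V -> R) : 1 <= p -> Lpfin p u -> tens phi ->
  mu.-integrable setT (fun z => (u z * phi z)%:E).
Proof.
move=> p1 hu tphi; have [M [_ [_ _ HM _]]] := tens_bounded_lipschitz tphi.
have [B B0 HB] := tens_compact_support tphi.
apply: (integrable_mul_box p1 B0 hu (tens_measurable tphi) HM) => z /existsNP[j zj].
by apply: HB; exists j; rewrite ltNge; exact/negP.
Qed.

End boxes.

(** * Test functions adapted to a kinetic box *)

Section weak_formulation.
Variables (R : realType) (d : nat).
Local Notation Z := ((1 + d + d).-tuple R).
Local Notation mu := (lebn R (1 + d + d)).
Implicit Types (z w : Z) (phi : Z -> R).

Definition Ykin phi : Z -> R := fun z =>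
  partial (tidx d) phi z + \sum_(i < d) tnth z (vidx i) * partial (xidx i) phi z.

Lemma sum_idx (F : 'I_(1 + d + d) -> R) :
  \sum_j F j = F (tidx d) + (\sum_(i < d) F (xidx i)) + (\sum_(i < d) F (vidx i)).
Proof. by rewrite !big_split_ord/= big_ord1. Qed.

Lemma tens_Ykin phi : tens phi -> tens (Ykin phi).
Proof.
move=> tp; have [tp' _] := tens_partial tp; apply: Tens_add => //.
by apply: tens_sum => i; exact: tens_coord.
Qed.

Lemma tidx_xidx (i : 'I_d) : (tidx d == xidx i) = false.
Proof. by apply/eqP => /(congr1 val) /=; lia. Qed.

Lemma tidx_vidx (i : 'I_d) : (tidx d == vidx i) = false.
Proof. by apply/eqP => /(congr1 val) /=; lia. Qed.

Lemma xidx_vidx (i j : 'I_d) : (xidx i == vidx j) = false.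
Proof. by apply/eqP => /(congr1 val) /=; have := ltn_ord i; lia. Qed.

Lemma xidx_tidx (i : 'I_d) : (xidx i == tidx d) = false.
Proof. by rewrite eq_sym tidx_xidx. Qed.

Lemma vidx_tidx (i : 'I_d) : (vidx i == tidx d) = false.
Proof. by rewrite eq_sym tidx_vidx. Qed.

Lemma vidx_xidx (i j : 'I_d) : (vidx i == xidx j) = false.
Proof. by rewrite eq_sym xidx_vidx. Qed.

Definition idx_neqE := (tidx_xidx, tidx_vidx, xidx_vidx, xidx_tidx, vidx_tidx, vidx_xidx).

Lemma vidx_inj : injective (@vidx d).
Proof. by move=> i j /rshift_inj. Qed.

Section pullback.
Variables (tau nu : R) (z0 : Z).
Hypotheses (tau0 : 0 < tau) (nu0 : 0 < nu).

Let ks := kscale (d := d) tau nu.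
Let ks0 j : 0 < ks j. Proof. exact: kscale_gt0. Qed.
Let a (j k : 'I_(1 + d + d)) : R :=
  ((j == k)%:R - (k == tidx d)%:R * vpart z0 j) / ks j.
Let b (j : 'I_(1 + d + d)) : R := (tnth z0 (tidx d) * vpart z0 j - tnth z0 j) / ks j.
(** The inverse of [act tau nu z0], spelled out as a matrix and a vector so that [tens_elem_affine]
    applies; [act_invE] is the readable form. *)
Definition act_inv z : Z := [tuple \sum_k a j k * tnth z k + b j | j < 1 + d + d].

Lemma act_invE z j : tnth (act_inv z) j =
  (tnth z j - tnth z0 j - (tnth z (tidx d) - tnth z0 (tidx d)) * vpart z0 j) / ks j.
Proof.
rewrite tnth_mktuple /a /b; under eq_bigr do rewrite mulrAC mulrBl.
rewrite -mulr_suml -mulrDl; congr (_ / _).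
rewrite sumrB (bigD1 j)//= eqxx mul1r big1 ?addr0; last first.
  by move=> k /negbTE kj; rewrite eq_sym kj mul0r.
rewrite (bigD1 (tidx d))// eqxx mul1r big1 ?addr0; last first.
  by move=> k /negbTE ->; rewrite !mul0r.
rewrite /= addr0; ring.
Qed.

Lemma act_invK w : act_inv (act tau nu z0 w) = w.
Proof.
apply: eq_from_tnth => j; rewrite act_invE !tnth_mktuple.
have -> : vpart z0 (tidx d) = 0 by rewrite /vpart kcaseE.
have -> : kscale tau nu (tidx d) = tau by rewrite /kscale kcaseE.
rewrite -/ks; field; exact/lt0r_neq0.
Qed.

Lemma actK z : act tau nu z0 (act_inv z) = z.
Proof.
apply: eq_from_tnth => j; rewrite tnth_mktuple !act_invE -/ks.
have -> : vpart z0 (tidx d) = 0 by rewrite /vpart kcaseE.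
have -> : ks (tidx d) = tau by rewrite /ks /kscale kcaseE.
by field; rewrite !lt0r_neq0.
Qed.

Lemma act_inv_line z k s : act_inv (upd z k s) = [tuple tnth (act_inv z) j + s * a j k | j < 1 + d + d].
Proof.
apply: eq_from_tnth => j; rewrite !tnth_mktuple [RHS]addrAC; congr (_ + _).
under eq_bigr do rewrite tnth_mktuple mulrDr.
rewrite big_split/=; congr (_ + _); rewrite (bigD1 k)//= eqxx big1 ?addr0 1?mulrC//.
by move=> i /negbTE ->; rewrite mulr0.
Qed.

Variable G : Z -> R.
Hypothesis tG : tens G.
Let phi := G \o act_inv.

Lemma partial_pullback z k :
  partial k phi z = \sum_j a j k * partial j G (act_inv z).
Proof.
apply: partial_dv; have [_ H] := tens_partial tG.
rewrite (_ : (fun s => _) = fun s => G [tuple tnth (act_inv z) j + s * a j k | j < 1 + d + d]).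
  exact: (H (fun j => a j k)).
by apply/funext => s; rewrite /phi/= act_inv_line.
Qed.

Lemma test_pullback : test_fun phi.
Proof.
split; first by apply: elem_smooth; exact: tens_elem_affine.
have [B B0 HB] := tens_compact_support tG.
(* A bound on coordinate [j] of [act tau nu z0 w] when all coordinates of [w] are at most [B] in
   absolute value. *)
pose m j := ks j * B + `|tnth z0 j| + tau * B * `|vpart z0 j|.
have m0 j : 0 <= m j by rewrite !addr_ge0// !mulr_ge0// ltW.
exists (\sum_j m j) => z [j zj]; apply: HB; apply: contrapT => /forallNP H.
have {}H k : `|tnth (act_inv z) k| <= B by rewrite leNgt; apply/negP.
move: zj; apply/negP; rewrite -leNgt (bigD1 j)//=.
apply: (@le_trans _ _ (m j)); last by rewrite lerDl sumr_ge0.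
rewrite -[z]actK tnth_mktuple addrA /m.
rewrite (le_trans (ler_normD _ _))// lerD//; last first.
  by rewrite !normrM gtr0_norm// ler_wpM2r// ler_wpM2l// ltW.
rewrite (le_trans (ler_normD _ _))// lerD2r normrM gtr0_norm; last exact: ks0.
by rewrite ler_wpM2l// ltW.
Qed.

Lemma partial_v_pullback i w :
  partial (vidx i) phi (act tau nu z0 w) = nu^-1 * partial (vidx i) G w.
Proof.
rewrite partial_pullback act_invK (bigD1 (vidx i))//= big1 ?addr0; last first.
  move=> j /negbTE ji; by rewrite /a ji idx_neqE mul0r subrr !mul0r.
by rewrite /a eqxx idx_neqE mul0r subr0 mul1r /ks /kscale kcaseE.
Qed.

Lemma partial_x_pullback i w :
  partial (xidx i) phi (act tau nu z0 w) = (tau * nu)^-1 * partial (xidx i) G w.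
Proof.
rewrite partial_pullback act_invK (bigD1 (xidx i))//= big1 ?addr0; last first.
  move=> j /negbTE ji; by rewrite /a ji idx_neqE mul0r subrr !mul0r.
by rewrite /a eqxx idx_neqE mul0r subr0 mul1r /ks /kscale kcaseE.
Qed.

Lemma partial_t_pullback w : partial (tidx d) phi (act tau nu z0 w) =
  tau^-1 * partial (tidx d) G w
  - \sum_(i < d) tnth z0 (vidx i) / (tau * nu) * partial (xidx i) G w.
Proof.
rewrite partial_pullback act_invK sum_idx -addrA; congr (_ + _).
  by rewrite /a eqxx /vpart /ks /kscale !kcaseE mulr0 subr0 mul1r.
rewrite [X in _ + X]big1 ?addr0 => [|i _]; last first.
  by rewrite /a idx_neqE /vpart kcaseE mulr0 subrr !mul0r.
rewrite -sumrN; apply: eq_bigr => i _.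
by rewrite /a idx_neqE eqxx /vpart /ks /kscale !kcaseE sub0r mul1r !mulNr.
Qed.

(** [Y] is invariant under left translations of the Galilean group and scales like [1 / tau]: the
    drift in [partial_t_pullback] cancels the [z0] part of the velocity [z0_v + nu w_v]. *)
Lemma transport_pullback w :
  partial (tidx d) phi (act tau nu z0 w) + \sum_(i < d)
    tnth (act tau nu z0 w) (vidx i) * partial (xidx i) phi (act tau nu z0 w)
  = tau^-1 * Ykin G w.
Proof.
rewrite partial_t_pullback -addrA /Ykin mulrDr; congr (_ + _).
rewrite addrC -sumrB mulr_sumr; apply: eq_bigr => i _.
rewrite partial_x_pullback tnth_mktuple /vpart /kscale !kcaseE mulr0 addr0.
by field; rewrite !lt0r_neq0.
Qed.

End pullback.

Section weak_act.
Variables (tau nu : R) (z0 : Z).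
Hypotheses (tau0 : 0 < tau) (nu0 : 0 < nu).
Local Notation A := (act tau nu z0).

Lemma Lpfin_act p (u : Z -> R) : Lpfin p u -> Lpfin p (u \o A).
Proof.
move=> [mu_ uoo]; split; first by apply: (measurableT_comp mu_); exact: measurable_act_w.
rewrite (ge0_integral_act_w z0 tau0 nu0 (measurable_powR_norm p mu_)).
  by rewrite lte_mul_pinfty// lee_fin invr_ge0 ltW// vol_gt0.
by move=> z; rewrite lee_fin powR_ge0.
Qed.

Lemma integral_act (u : Z -> R) : mu.-integrable setT (EFin \o u) ->
  (\int[mu]_w (u (A w))%:E = ((vol d tau nu)^-1)%:E * \int[mu]_w (u w)%:E)%E.
Proof.
move=> iu; apply: (integral_change (mu := mu) (phi := A) _ iu) => g mg g0.
exact: ge0_integral_act_w.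
Qed.

Lemma test_pullback_bounded G : tens G -> exists B M, [/\ 0 < B,
  measurable_fun setT (G \o act_inv tau nu z0),
  (forall z, `|(G \o act_inv tau nu z0) z| <= M) &
  (forall z, ~ box B z -> (G \o act_inv tau nu z0) z = 0)].
Proof.
move=> tG; have [_ [B HB]] := test_pullback z0 tau0 nu0 tG.
have [M [_ [_ _ HM _]]] := tens_bounded_lipschitz tG.
exists (`|B| + 1), M; split.
- by rewrite ltr_wpDl.
- apply: (measurableT_comp (tens_measurable tG)); apply: measurable_mktuple => j.
  apply: measurable_funD => //; apply: measurable_sum => k.
  by apply: measurable_funM => //; exact: measurable_tnth.
- by move=> z; exact: HM.
- move=> z /existsNP[j /negP]; rewrite -ltNge => zj; apply: HB; exists j.
  by apply: le_lt_trans zj; rewrite (le_trans (ler_norm _))// lerDl.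
Qed.

Lemma integrable_pullback p u G : 1 <= p -> Lpfin p u -> tens G ->
  mu.-integrable setT (fun z => (u z * (G \o act_inv tau nu z0) z)%:E).
Proof.
move=> p1 hu tG; have [B [M [B0 mG HM HB]]] := test_pullback_bounded tG.
exact: integrable_mul_box p1 B0 hu mG HM HB.
Qed.

End weak_act.
End weak_formulation.

(** * Weak identities at scale (tau, nu) *)

Section weak_identities.
Variables (R : realType) (d : nat).
Local Notation Z := ((1 + d + d).-tuple R).
Local Notation mu := (lebn R (1 + d + d)).
Local Notation I u := (Rintegral mu setT u).
Variables (p p' : R) (f : Z -> R) (g S : 'I_d -> Z -> R).
Hypotheses (p1 : 1 <= p) (p1' : 1 <= p').
Hypotheses (hf : Lpfin 2 f) (hg : forall i, Lpfin p (g i)) (hS : forall i, Lpfin p' (S i)).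
Hypotheses (wg : weak_grad_v f g) (ke : kinetic_eq f S).
Variables (tau nu : R) (z0 : Z).
Hypotheses (tau0 : 0 < tau) (nu0 : 0 < nu).
Local Notation A := (act tau nu z0).
Local Notation Ai := (act_inv tau nu z0).

Let two1 : 1 <= 2 :> R. Proof. by rewrite ler1n. Qed.

Lemma Rintegral_act (u : Z -> R) : mu.-integrable setT (EFin \o u) ->
  I (fun w => u (A w)) = (vol d tau nu)^-1 * I u.
Proof. by move=> iu; rewrite /Rintegral integral_act// fineM//; exact: integrable_fin_num. Qed.

Lemma Rintegral_pullback q u G : 1 <= q -> Lpfin q u -> tens G ->
  (\int[mu]_z (u z * G (Ai z))%:E = (vol d tau nu * I (fun w => u (A w) * G w))%:E)%E.
Proof.
move=> q1 hu tG; have iu := integrable_pullback z0 tau0 nu0 q1 hu tG.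
have -> : I (fun w => u (A w) * G w) = (vol d tau nu)^-1 * I (fun z => u z * G (Ai z)).
  by rewrite -(Rintegral_act iu); apply: eq_Rintegral => w _; rewrite /= act_invK.
rewrite mulrA divff ?mul1r ?fineK//; last by rewrite gt_eqF// vol_gt0.
exact: integrable_fin_num.
Qed.

Lemma partial_v_pullbackE i G : tens G ->
  partial (vidx i) (G \o Ai) = fun z => nu^-1 * partial (vidx i) G (Ai z).
Proof.
move=> tG; apply/funext => z; rewrite -{1}(actK z0 tau0 nu0 z).
by rewrite (partial_v_pullback z0 tau0 nu0 tG).
Qed.

Lemma iint_pullback q u G c : 1 <= q -> Lpfin q u -> tens G ->
  iint (fun z => (u z * (c * G (Ai z)))%:E) =
  (vol d tau nu * (c * I (fun w => u (A w) * G w)))%:E.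
Proof.
move=> q1 hu tG; have iu := integrable_pullback z0 tau0 nu0 q1 hu tG.
have icu : mu.-integrable setT (fun z => c%:E * (u z * G (Ai z))%:E)%E.
  exact: integrableZl.
rewrite (_ : (fun z => _) = fun z => (c%:E * (u z * G (Ai z))%:E)%E); last first.
  by apply/funext => z; rewrite -EFinM mulrCA.
rewrite iint_integrable// integralZl// (Rintegral_pullback q1 hu tG) -EFinM.
by rewrite mulrCA.
Qed.

(** Test with the pullback of [G] and return to [w]: the Jacobian is the same on both sides and the
    chain rule leaves [nu]. *)
Lemma weak_grad_act i G : tens G ->
  I (fun w => f (A w) * partial (vidx i) G w) = - nu * I (fun w => g i (A w) * G w).
Proof.
move=> tG; have [tG' _] := tens_partial tG.
have := wg (test_pullback z0 tau0 nu0 tG) i.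
rewrite (partial_v_pullbackE i tG) (iint_pullback nu^-1 two1 hf (tG' _)).
under [in X in _ = X -> _]eq_fun do rewrite /=.
rewrite (_ : (fun z => _) = fun z => (g i z * (1 * G (Ai z)))%:E); last first.
  by apply/funext => z; rewrite mul1r.
rewrite (iint_pullback 1 p1 (hg i) tG) -EFinN => -[].
rewrite mul1r -mulrN => /mulfI H.
have v0 : vol d tau nu != 0 by rewrite gt_eqF// vol_gt0.
move/(_ v0) : H => /(congr1 (fun x => nu * x)).
by rewrite mulrA divff ?gt_eqF// mul1r mulrN mulNr.
Qed.

(** For the pulled-back test function, [Y] contributes [1 / tau] and the velocity derivative
    [1 / nu], whence the ratio. *)
Lemma kinetic_act G : tens G ->
  I (fun w => f (A w) * Ykin G w) =
  tau / nu * \sum_(j < d) I (fun w => S j (A w) * partial (vidx j) G w).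
Proof.
move=> tG; have [tG' _] := tens_partial tG.
have := ke (test_pullback z0 tau0 nu0 tG).
rewrite (_ : (fun z => _) = fun z => (f z * (tau^-1 * Ykin G (Ai z)))%:E); last first.
  apply/funext => z; rewrite -{2 3 4}(actK z0 tau0 nu0 z).
  by rewrite (transport_pullback z0 tau0 nu0 tG).
rewrite (iint_pullback tau^-1 two1 hf (tens_Ykin tG)).
rewrite (_ : (fun z => _) = fun z =>
    (\sum_(j < d) nu^-1%:E * (S j z * partial (vidx j) G (Ai z))%:E)%E); last first.
  apply/funext => z; rewrite sumEFin; congr EFin; apply: eq_bigr => j _.
  by rewrite (partial_v_pullbackE j tG) mulrCA.
have iS j : mu.-integrable setT (fun z => (S j z * partial (vidx j) G (Ai z))%:E).
  exact: (integrable_pullback z0 tau0 nu0 p1' (hS j) (tG' _)).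
have iS' j : mu.-integrable setT (fun z => nu^-1%:E * (S j z * partial (vidx j) G (Ai z))%:E)%E.
  exact: integrableZl.
rewrite iint_integrable; last exact: integrable_sum.
rewrite integral_sum//.
under eq_bigr => j _ do rewrite integralZl// (Rintegral_pullback p1' (hS j) (tG' _)) -EFinM.
rewrite sumEFin => -[].
under eq_bigr do rewrite mulrCA.
rewrite -mulr_sumr => /mulfI H.
have v0 : vol d tau nu != 0 by rewrite gt_eqF// vol_gt0.
move/(_ v0) : H; rewrite -mulr_sumr => /(congr1 (fun x => tau * x)).
by rewrite mulrA divff ?gt_eqF// mul1r mulrA.
Qed.

Lemma integrable_act_tens q u G : 1 <= q -> Lpfin q u -> tens G ->
  mu.-integrable setT (EFin \o (fun w => u (A w) * G w)).
Proof.
move=> q1 hu tG; exact: (integrable_mul_tens q1 (Lpfin_act z0 tau0 nu0 hu) tG).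
Qed.

Lemma integrable_sum_EFin (J : Type) (r : seq J) (F : J -> Z -> R) :
  (forall j, mu.-integrable setT (EFin \o F j)) ->
  mu.-integrable setT (EFin \o (fun w => \sum_(j <- r) F j w)).
Proof.
move=> iF; apply: (eq_integrable measurableT (fun w => \sum_(j <- r) (F j w)%:E)%E).
  by move=> w _; rewrite sumEFin.
by apply: integrable_sum => // j _; exact: iF.
Qed.

Lemma Rintegral_sum (J : Type) (r : seq J) (F : J -> Z -> R) :
  (forall j, mu.-integrable setT (EFin \o F j)) ->
  I (fun w => \sum_(j <- r) F j w) = \sum_(j <- r) I (F j).
Proof.
move=> iF; elim: r => [|j r ih].
  under eq_Rintegral do rewrite big_nil.
  by rewrite big_nil /Rintegral integral0.
under eq_Rintegral do rewrite big_cons.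
rewrite RintegralD// ?ih ?big_cons//; exact: integrable_sum_EFin.
Qed.

Lemma kernel_act Psi (Phi : 'I_d -> Z -> R) : tens Psi -> (forall i, tens (Phi i)) ->
  I (fun w => f (A w) * (Ykin Psi w + \sum_(i < d) partial (vidx i) (Phi i) w)) =
  tau / nu * \sum_(j < d) I (fun w => S j (A w) * partial (vidx j) Psi w)
  - nu * \sum_(i < d) I (fun w => g i (A w) * Phi i w).
Proof.
move=> tP tQ; have tQ' i := (tens_partial (tQ i)).1.
under eq_Rintegral do rewrite mulrDr mulr_sumr.
rewrite RintegralD//; last 2 first.
- exact: (integrable_act_tens two1 hf (tens_Ykin tP)).
- by apply: integrable_sum_EFin => i; exact: (integrable_act_tens two1 hf (tQ' i _)).
rewrite kinetic_act// Rintegral_sum; last first.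
  by move=> i; exact: (integrable_act_tens two1 hf (tQ' i _)).
congr (_ + _); rewrite mulr_sumr -sumrN; apply: eq_bigr => i _.
by rewrite weak_grad_act// mulNr.
Qed.

End weak_identities.

(** * The kernel and its decomposition along the equation *)

Section kernel.
Variables (R : realType) (d : nat).
Local Notation Z := ((1 + d + d).-tuple R).
Local Notation mu := (lebn R (1 + d + d)).

(* Write K - K^c = d_t A + sum_i d_(x_i) G_i + sum_i d_(v_i) H_i. With Y = d_t + v . d_x
   we have d_t = Y - v . d_x and d_(x_i) = [d_(v_i), Y], which trades all t- and
   x-derivatives for Y and v-derivatives. *)
Lemma kernel_divergence (B : 'I_(1 + d + d) -> Z -> R) : (forall j, tens (B j)) ->
  exists Psi (Phi : 'I_d -> Z -> R), [/\ tens Psi, (forall i, tens (Phi i)) &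
   forall w, \sum_j partial j (B j) w =
     Ykin Psi w + \sum_(i < d) partial (vidx i) (Phi i) w].
Proof.
move=> tB; pose A := B (tidx d).
(* Since [v_i] does not depend on x, [d_t A = Y A - sum_i d_(x_i) (v_i A)]; so [G i] collects
   everything under [d_(x_i)]. *)
pose G i := fun z : Z => B (xidx i) z + (-1) * (tnth z (vidx i) * A z).
have tvA (i : 'I_d) : tens (fun z => tnth z (vidx i) * A z).
  exact: (tens_coord (vidx i) (tB (tidx d))).
have tG i : tens (G i) by exact: (Tens_add (tB (xidx i)) (Tens_scale (-1) (tvA i))).
have tG' i := (tens_partial (tG i)).1.
pose Q := fun z => \sum_(i < d) partial (vidx i) (G i) z.
have tQ : tens Q by apply: tens_sum.
(* From [d_(x_i) G_i = d_(v_i) (Y G_i) - Y (d_(v_i) G_i)]: the last terms add up to [- Y Q] and join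
   [Y A]. *)
exists (fun z => A z + (-1) * Q z), (fun i z => B (vidx i) z + Ykin (G i) z); split.
- exact: (Tens_add (tB (tidx d)) (Tens_scale (-1) tQ)).
- by move=> i; exact: (Tens_add (tB (vidx i)) (tens_Ykin (tG i))).
move=> w; rewrite sum_idx -/A.
have tNQ : tens (fun z => (-1) * Q z) := Tens_scale (-1) tQ.
have partG k i z : partial k (G i) z = partial k (B (xidx i)) z
    - ((vidx i == k)%:R * A z + tnth z (vidx i) * partial k A z).
  rewrite /G (partialD k (tB _) (Tens_scale (-1) (tvA i))) (partialZ k (-1) (tvA i)).
  by rewrite (partial_coord k (vidx i) (tB _)) mulN1r.
have partYG i z : partial (vidx i) (Ykin (G i)) z =
    partial (xidx i) (G i) z + Ykin (partial (vidx i) (G i)) z.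
  have tvG j : tens (fun z : Z => tnth z (vidx j) * partial (xidx j) (G i) z).
    exact: (tens_coord (vidx j) (tG' i _)).
  rewrite /Ykin (partialD _ (tG' i _) (tens_sum _ tvG)) (partial_sum _ _ tvG).
  rewrite (partialC _ _ (tG i)) addrCA; congr (_ + _).
  under eq_bigr => j _ do rewrite partial_coord// (partialC _ _ (tG i)).
  rewrite big_split/=; congr (_ + _).
  rewrite (bigD1 i)//= eqxx mul1r big1 ?addr0// => j ji.
  by rewrite (inj_eq (@vidx_inj d)) (negbTE ji) mul0r.
have YQ : Ykin Q w = \sum_(i < d) Ykin (partial (vidx i) (G i)) w.
  rewrite /Ykin big_split/= /Q (partial_sum _ _ (fun i => tG' i _)); congr (_ + _).
  under eq_bigr => j _ do rewrite (partial_sum _ _ (fun i => tG' i _)) mulr_sumr.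
  exact: exchange_big.
have YAQ : Ykin (fun z => A z + (-1) * Q z) w = Ykin A w - Ykin Q w.
  rewrite /Ykin (partialD _ (tB _) tNQ) (partialZ _ (-1) tQ).
  under eq_bigr => j _ do rewrite (partialD _ (tB _) tNQ) (partialZ _ (-1) tQ) mulrDr mulN1r mulrN.
  by rewrite big_split/= sumrN mulN1r; ring.
rewrite YAQ YQ.
have PhiE i : partial (vidx i) (fun z => B (vidx i) z + Ykin (G i) z) w =
    partial (vidx i) (B (vidx i)) w + (partial (xidx i) (B (xidx i)) w
      - tnth w (vidx i) * partial (xidx i) A w + Ykin (partial (vidx i) (G i)) w).
  rewrite (partialD _ (tB _) (tens_Ykin (tG i))) partYG partG vidx_xidx mul0r add0r.
  by [].
rewrite [X in _ = _ + X](eq_bigr _ (fun i _ => PhiE i)).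
rewrite !big_split/= /Ykin sumrN; ring.
Qed.

Lemma kernel_exists (ct cv : R) : 0 < ct -> 0 < cv ->
  exists (K Psi : Z -> R) (Phi : 'I_d -> Z -> R), [/\ 
    [/\ tens K, tens (fun w => K (dil ct^-1 cv^-1 w)), forall w, 0 <= K w &
      (\int[mu]_w (K w)%:E = 1)%E],
    tens Psi, (forall i, tens (Phi i)) &
    forall w, K w - (vol d ct cv)^-1 * K (dil ct^-1 cv^-1 w) =
     Ykin Psi w + \sum_(i < d) partial (vidx i) (Phi i) w].
Proof.
move=> ct0 cv0.
have [th [a [sth ca dth [a0 a1] [th0 th1]]]] := smooth_step_exists R.
pose c := kscale (d := d) ct cv.
have c0 j : 0 < c j by exact: kscale_gt0.
have [B [tB HB]] := kernel_difference sth ca dth th0 th1 c0.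
have [Psi [Phi [tPsi tPhi H]]] := kernel_divergence tB.
have ca' j : csmooth (fun x => a ((c j)^-1 * x + 0)).
  split; first by apply: Smooth_aff; exact: ca.1.
  have [M HM] := ca.2; exists (c j * `|M|) => x Mx; rewrite HM//.
  rewrite addr0 normrM gtr0_norm ?invr_gt0// ltr_pdivlMl//.
  by apply: le_lt_trans Mx; rewrite ler_wpM2l ?ler_norm// ltW.
have dilE (w : Z) j : tnth (dil ct^-1 cv^-1 w) j = (c j)^-1 * tnth w j + 0.
  rewrite tnth_mktuple addr0; congr (_ * _); rewrite /c /kscale.
  by case: (idxP j) => [|i|i]; rewrite !kcaseE// invfM.
exists (fun w => \prod_j a (tnth w j)), Psi, Phi; split => //.
- split.
  + by apply: (@Tens_prod _ _ (fun=> a)).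
  + rewrite (_ : (fun w => _) = fun w : Z => \prod_j (fun j x => a ((c j)^-1 * x + 0)) j (tnth w j)).
      exact: (@Tens_prod _ _ (fun j x => a ((c j)^-1 * x + 0)) ca').
    by apply/funext => w; apply: eq_bigr => j _; rewrite dilE.
  + by move=> w; apply: prodr_ge0.
  + by apply: (ge0_integral_prod (g := fun=> a)) => // j; exact: csmooth_measurable.
- move=> w; rewrite -H -HB; congr (_ - _); rewrite big_split/=; congr (_ * _).
    by rewrite prodfV prod_kscale.
  by apply: eq_bigr => j _; rewrite dilE.
Qed.

End kernel.

(** * Local averages *)

Section jensen.
Variable R : realType.

(** Young's inequality for the product of [a] and [m^(p-1)] with exponents [p] and [p / (p - 1)],
    rearranged; the cases [p = 1] and [m = 0] are separate. *)
Lemma powR_tangent (p a m : R) : 1 <= p -> 0 <= a -> 0 <= m ->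
  m `^ p + p * m `^ (p - 1) * (a - m) <= a `^ p.
Proof.
rewrite le_eqVlt => /predU1P[<-|p1] a0 m0.
  by rewrite subrr powRr0 !powRr1// !mul1r addrCA subrr addr0.
have p0 : 0 < p by exact: lt_trans ltr01 p1.
have [->|mn0] := eqVneq m 0.
  by rewrite !powR0 ?gt_eqF ?subr_gt0// mulr0 mul0r addr0 powR_ge0.
have mp := mulr_powRB1 m0 p0.
have q0 : 0 < p / (p - 1) by rewrite divr_gt0// subr_gt0.
have pq : p^-1 + (p / (p - 1))^-1 = 1.
  by rewrite invf_div; field; rewrite gt_eqF.
have := conjugate_powR a0 (powR_ge0 m (p - 1)) p0 q0 pq.
rewrite -powRrM mulrCA divff ?mulr1; last by rewrite gt_eqF// subr_gt0.
rewrite invf_div -lerBlDr => H.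
have {}H : p * (a * m `^ (p - 1) - m `^ p * ((p - 1) / p)) <= a `^ p.
  by rewrite -ler_pdivlMl// [leRHS]mulrC.
apply: le_trans H; rewrite le_eqVlt; apply/orP; left; apply/eqP.
rewrite -mp; field; exact/lt0r_neq0.
Qed.

Lemma powR_tangent_le (p a m : R) : 1 <= p -> 0 <= a -> 0 <= m ->
  a `^ p <= m `^ p + p * a `^ (p - 1) * (a - m).
Proof.
move=> p1 a0 m0; have := powR_tangent p1 m0 a0.
by rewrite -(opprB a m) mulrN lerBlDr.
Qed.

Lemma powR_root (p x y : R) : 0 < p -> 0 <= x -> x `^ p <= y -> x <= y `^ (p^-1).
Proof.
move=> p0 x0 xy; rewrite -[leLHS](powRr1 x0) -(mulfV (lt0r_neq0 p0)) powRrM.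
apply: ge0_ler_powR => //; rewrite ?nnegrE ?powR_ge0 ?invr_ge0 ?(ltW p0)//.
exact: le_trans (powR_ge0 _ _) xy.
Qed.

Variable n : nat.
Local Notation V := (n.-tuple R).
Local Notation mu := (lebn R n).
Local Notation I u := (Rintegral mu setT u).
Variable B : R.
Hypothesis B0 : 0 < B.
Let vB := (2 * B) ^+ n.
Let vB0 : 0 < vB. Proof. by rewrite exprn_gt0// mulr_gt0. Qed.

Lemma integrable_box : mu.-integrable setT (EFin \o \1_(box B)).
Proof.
apply/integrableP; split.
  by apply/measurable_EFinP; apply: measurable_indic; exact: measurable_box.
under eq_integral => z _ do rewrite gee0_abs ?lee_fin//.
by rewrite integral_indic ?setIT ?lebn_box ?ltry//; exact: measurable_box.
Qed.

Lemma Rintegral_box : I (\1_(box B)) = vB.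
Proof.
by rewrite /Rintegral integral_indic ?setIT ?lebn_box//; exact: measurable_box.
Qed.

Lemma integrable_norm_box p u : 1 <= p -> Lpfin p u ->
  mu.-integrable setT (EFin \o (fun w : V => `|u w| * \1_(box B) w)).
Proof.
move=> p1 [mu_ uoo].
have hu : Lpfin p (fun w : V => `|u w|).
  split; first exact: measurableT_comp.
  by under eq_integral => z _ do rewrite normr_id.
apply: (integrable_mul_box (M := 1) p1 B0 hu).
- by apply: measurable_indic; exact: measurable_box.
- by move=> z; rewrite ger0_norm// indic_le1.
- by move=> z zB; rewrite indicE memNset.
Qed.

Lemma integrable_powR_box p u : Lpfin p u ->
  mu.-integrable setT (EFin \o (fun w : V => `|u w| `^ p * \1_(box B) w)).
Proof.
move=> [mu_ uoo].
have ip : mu.-integrable setT (fun w => (`|u w| `^ p)%:E).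
  apply/integrableP; split; first exact: measurable_powR_norm.
  by under eq_integral => z _ do rewrite gee0_abs ?lee_fin ?powR_ge0//.
apply: (le_integrable measurableT _ _ ip).
  apply/measurable_EFinP; apply: measurable_funM.
    by apply/measurable_EFinP; exact: measurable_powR_norm.
  by apply: measurable_indic; exact: measurable_box.
by move=> w _; rewrite /= lee_fin normrM ler_piMr// ger0_norm// indic_le1.
Qed.

(* From the tangent line of x^p at the mean value. *)
Lemma jensen_box p u : 1 <= p -> Lpfin p u ->
  I (fun w : V => `|u w| * \1_(box B) w) `^ p <=
  vB `^ (p - 1) * I (fun w : V => `|u w| `^ p * \1_(box B) w).
Proof.
move=> p1 hu; have i1 := integrable_norm_box p1 hu; have ip := integrable_powR_box hu.
set N := I (fun w => `|u w| * _); set J := I (fun w => _ `^ p * _).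
have N0 : 0 <= N by apply: Rintegral_ge0 => w _; rewrite mulr_ge0.
pose m := N / vB; have m0 : 0 <= m by rewrite divr_ge0// ltW.
pose a := m `^ p - p * m `^ (p - 1) * m; pose b := p * m `^ (p - 1).
have ia : mu.-integrable setT (EFin \o (fun w : V => a * \1_(box B) w)).
  have := integrableZl measurableT a integrable_box.
  by apply: eq_integrable => // w _; rewrite /= EFinM.
have ib : mu.-integrable setT (EFin \o (fun w : V => b * (`|u w| * \1_(box B) w))).
  have := integrableZl measurableT b i1.
  by apply: eq_integrable => // w _; rewrite /= EFinM.
have iab : mu.-integrable setT
    (EFin \o (fun w : V => a * \1_(box B) w + b * (`|u w| * \1_(box B) w))).
  have := integrableD measurableT ia ib.
  by apply: eq_integrable => // w _; rewrite /= EFinD.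
have H : vB * m `^ p <= J.
  rewrite (_ : vB * m `^ p = I (fun w : V => a * \1_(box B) w + b * (`|u w| * \1_(box B) w))).
    apply: le_Rintegral => // w _; rewrite mulrA -mulrDl; apply: ler_wpM2r => //.
    apply: le_trans (powR_tangent p1 (normr_ge0 (u w)) m0).
    by rewrite /a /b mulrBr -addrA lerD2l addrC.
  rewrite RintegralD// !RintegralZl//; last exact: integrable_box.
  rewrite Rintegral_box -/N /a /b -[N](divfK (lt0r_neq0 vB0)) -/m; ring.
have -> : N `^ p = vB `^ (p - 1) * (vB * m `^ p).
  rewrite mulrA [_ * vB]mulrC mulr_powRB1 ?(ltW vB0)//; last by lra.
  by rewrite -powRM ?(ltW vB0)// /m mulrC divfK// lt0r_neq0.
by rewrite ler_wpM2l// powR_ge0.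
Qed.

End jensen.

Lemma ge0_le_integralT d (T : measurableType d) (R : realType) (m : {measure set T -> \bar R})
    (f g : T -> \bar R) : (forall x, (0 <= f x)%E) -> measurable_fun setT f ->
  measurable_fun setT g -> (forall x, (f x <= g x)%E) ->
  (\int[m]_x f x <= \int[m]_x g x)%E.
Proof. by move=> f0 mf mg fg; exact: ge0_le_integral. Qed.

Section averages.
Variables (R : realType) (d : nat).
Local Notation Z := ((1 + d + d).-tuple R).
Local Notation mu := (lebn R (1 + d + d)).
Local Notation I u := (Rintegral mu setT u).
Variables (B tau nu : R).
Hypotheses (B0 : 0 < B) (tau0 : 0 < tau) (nu0 : 0 < nu).
Let vB := (2 * B) ^+ (1 + d + d).
Let vB0 : 0 < vB. Proof. by rewrite exprn_gt0// mulr_gt0. Qed.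
Local Notation vv := (vol d tau nu).
Let vv0 : 0 < vv. Proof. exact: vol_gt0. Qed.

(** The average is not normalised: the measure of the box appears as [vB] in the estimates. The
    indicator dominates every kernel up to a constant, so one bound serves them all. *)
Definition avg (u : Z -> R) (z : Z) := I (fun w => `|u (act tau nu z w)| * \1_(box B) w).

Lemma avg_ge0 u z : 0 <= avg u z.
Proof. by apply: Rintegral_ge0 => w _; rewrite mulr_ge0. Qed.

Lemma integrable_avg p u z : 1 <= p -> Lpfin p u ->
  mu.-integrable setT (EFin \o (fun w => `|u (act tau nu z w)| * \1_(box B) w)).
Proof. by move=> p1 hu; exact: (integrable_norm_box B0 p1 (Lpfin_act z tau0 nu0 hu)). Qed.

Lemma measurable_avg_integrand (u : Z -> R) (k : R -> R) : measurable_fun setT u ->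
  measurable_fun setT k ->
  measurable_fun setT (fun y : Z * Z => (k (u (act tau nu y.1 y.2)) * \1_(box B) y.2)%:E).
Proof.
move=> mu_ mk; apply/measurable_EFinP; apply: measurable_funM.
  apply: (measurableT_comp mk); apply: (measurableT_comp mu_); exact: measurable_act.
apply: (measurableT_comp _ measurable_snd).
by apply: measurable_indic; exact: measurable_box.
Qed.

Lemma measurable_avg u : measurable_fun setT u -> measurable_fun setT (avg u).
Proof.
move=> mu_; apply: (measurableT_comp (fine_measurable measurableT)).
apply: (@measurable_integral_param _ _ _ _ _ mu
  (fun y : Z * Z => (`|u (act tau nu y.1 y.2)| * \1_(box B) y.2)%:E)).
exact: (measurable_avg_integrand mu_ (@normr_measurable R setT)).
Qed.

Variables (p Y : R) (u : Z -> R).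
Hypotheses (p1 : 1 <= p) (Y0 : 0 <= Y) (hu : Lpfin p u).
Hypothesis uY : (\int[mu]_z ((`|u z|) `^ p)%:E = (Y `^ p)%:E)%E.

(** The endpoint from [L^p] to [L^infinity]: Jensen over the box, then the change of variables in
    [w], with Jacobian [1 / vv]. *)
Lemma avg_le z : avg u z <= vB `^ (1 - p^-1) * vv `^ (- p^-1) * Y.
Proof.
have p0 : 0 < p by exact: lt_le_trans ltr01 p1.
have H := jensen_box B0 p1 (Lpfin_act z tau0 nu0 hu).
have {H} : avg u z `^ p <= vB `^ (p - 1) * (vv^-1 * Y `^ p).
  apply: le_trans H _; rewrite ler_wpM2l ?powR_ge0//.
  have P0 w : (0 <= (`|u w| `^ p)%:E)%E by rewrite lee_fin powR_ge0.
  have E := ge0_integral_act_w z tau0 nu0 (measurable_powR_norm p hu.1) P0.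
  rewrite -lee_fin EFinM -uY -E.
  rewrite fineK; last first.
    exact: integrable_fin_num (integrable_powR_box B (Lpfin_act z tau0 nu0 hu)).
  apply: ge0_le_integralT.
  - by move=> w; rewrite lee_fin mulr_ge0// powR_ge0.
  - apply/measurable_EFinP; apply: measurable_funM.
      apply/measurable_EFinP.
      exact: (measurable_powR_norm p (Lpfin_act z tau0 nu0 hu).1).
    by apply: measurable_indic; exact: measurable_box.
  - exact: (measurable_powR_norm p (Lpfin_act z tau0 nu0 hu).1).
  - by move=> w; rewrite lee_fin ler_piMr ?powR_ge0// indic_le1.
move=> /(powR_root p0 (avg_ge0 u z)) H; apply: le_trans H _.
have V0 := powR_ge0 vB (p - 1); have Yp0 := powR_ge0 Y p.
have v0 : 0 <= vv^-1 by rewrite invr_ge0 ltW.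
rewrite powRM ?mulr_ge0// powRM// -!powRrM mulfV ?lt0r_neq0// powRr1// mulrA.
by rewrite mulrBl mulfV ?lt0r_neq0// mul1r -[vv^-1]powR_inv1 ?(ltW vv0)// -powRrM mulN1r.
Qed.

(** The endpoint from [L^p] to [L^p]: Jensen and Tonelli, since for fixed [w] the map
    [z -> act tau nu z w] preserves the measure. *)
Lemma integral_avg_le : (\int[mu]_z ((avg u z) `^ p)%:E <= (vB `^ p * Y `^ p)%:E)%E.
Proof.
have p0 : 0 < p by exact: lt_le_trans ltr01 p1.
pose F (y : Z * Z) := ((`|u (act tau nu y.1 y.2)| `^ p) * \1_(box B) y.2)%:E.
have mF : measurable_fun setT F.
  apply: (measurable_avg_integrand (k := fun x => `|x| `^ p) hu.1).
  by apply: (measurableT_comp (measurable_powR p)); exact: normr_measurable.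
have F0 y : (0 <= F y)%E by rewrite lee_fin mulr_ge0// powR_ge0.
have V0 := powR_ge0 vB (p - 1).
have mFz : measurable_fun setT (fun z => \int[mu]_w F (z, w))%E.
  exact: (@measurable_integral_param _ _ _ _ _ mu F).
apply: (@le_trans _ _ (\int[mu]_z ((vB `^ (p - 1))%:E * \int[mu]_w F (z, w)))%E).
  apply: ge0_le_integralT.
  - by move=> z; rewrite lee_fin powR_ge0.
  - apply/measurable_EFinP; apply: (measurableT_comp (measurable_powR p)).
    exact: measurable_avg hu.1.
  - exact: measurable_funeM.
  - move=> z; have H := jensen_box B0 p1 (Lpfin_act z tau0 nu0 hu).
    rewrite -lee_fin EFinM in H; apply: (le_trans H); rewrite lee_wpmul2l ?lee_fin//.
    rewrite fineK//.
    exact: integrable_fin_num (integrable_powR_box B (Lpfin_act z tau0 nu0 hu)).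
rewrite ge0_integralZT//; last by move=> z; exact: integral_ge0.
rewrite (fubini_tonelli F mF F0).
have Fw w : (\int[mu]_z F (z, w) = (Y `^ p)%:E * (\1_(box B) w)%:E)%E.
  have P0 z : (0 <= (`|u z| `^ p)%:E)%E by rewrite lee_fin powR_ge0.
  have E := ge0_integral_act_z tau nu w (measurable_powR_norm p hu.1) P0.
  have mz := measurableT_comp (measurable_powR_norm p hu.1) (measurable_act_z tau nu w).
  have i0 : 0 <= \1_(box B) w :> R by [].
  rewrite -uY -E muleC -(ge0_integralZT mu i0 mz); last by move=> z; exact: P0.
  by apply: eq_integral => z _; rewrite /F/= mulrC EFinM.
under eq_integral => w _ do rewrite Fw.
have mI : measurable_fun setT (fun w : Z => (\1_(box B) w)%:E : \bar R).
  by apply/measurable_EFinP; apply: measurable_indic; exact: measurable_box.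
rewrite (ge0_integralZT mu (powR_ge0 Y p) mI); last by move=> w; rewrite lee_fin.
rewrite integral_indic ?setIT ?lebn_box//; last exact: measurable_box.
rewrite -!EFinM lee_fin -/vB -(mulr_powRB1 (ltW vB0) p0) le_eqVlt.
by apply/orP; left; apply/eqP; ring.
Qed.

(** The endpoints are interpolated through [avg^q <= (sup avg)^(q-p) avg^p]. *)
Lemma integral_avg_young q : p < q ->
  (\int[mu]_z ((avg u z) `^ q)%:E <=
   ((vB `^ (1 - p^-1 + q^-1) * vv `^ (- (p^-1 - q^-1)) * Y) `^ q)%:E)%E.
Proof.
move=> pq; have p0 : 0 < p by exact: lt_le_trans ltr01 p1.
have q0 : 0 < q by exact: lt_trans pq.
pose s := vB `^ (1 - p^-1) * vv `^ (- p^-1) * Y.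
have s0 : 0 <= s by rewrite !mulr_ge0// powR_ge0.
apply: (@le_trans _ _ (\int[mu]_z ((s `^ (q - p))%:E * ((avg u z) `^ p)%:E))%E).
  have mavg : measurable_fun setT (avg u) by exact: measurable_avg hu.1.
  apply: ge0_le_integralT.
  - by move=> z; rewrite lee_fin powR_ge0.
  - by apply/measurable_EFinP; apply: (measurableT_comp (measurable_powR q)).
  - apply: measurable_funeM; apply/measurable_EFinP.
    exact: (measurableT_comp (measurable_powR p)).
  - move=> z; rewrite -EFinM lee_fin.
    have -> : avg u z `^ q = avg u z `^ (q - p) * avg u z `^ p.
      by rewrite -powRD ?subrK// gt_eqF.
    apply: ler_wpM2r; first exact: powR_ge0.
    apply: ge0_ler_powR; rewrite ?nnegrE ?avg_ge0 ?subr_ge0 ?(ltW pq)//.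
    exact: avg_le.
rewrite ge0_integralZT//; last 3 first.
- exact: powR_ge0.
- apply/measurable_EFinP; apply: (measurableT_comp (measurable_powR p)).
  exact: measurable_avg hu.1.
- by move=> z; rewrite lee_fin powR_ge0.
apply: (@le_trans _ _ ((s `^ (q - p))%:E * (vB `^ p * Y `^ p)%:E)%E).
  by rewrite lee_wpmul2l ?lee_fin ?powR_ge0// integral_avg_le.
rewrite -EFinM lee_fin /s; move: (vol d tau nu) (ltW vv0) => v v0.
rewrite !powRM ?mulr_ge0 ?powR_ge0// -!powRrM le_eqVlt; apply/orP; left; apply/eqP.
have -> : (1 - p^-1 + q^-1) * q = (1 - p^-1) * (q - p) + p.
  by field; rewrite !lt0r_neq0.
have -> : - (p^-1 - q^-1) * q = - p^-1 * (q - p) by field; rewrite !lt0r_neq0.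
rewrite [in RHS]powRD; last by rewrite (gt_eqF vB0) implybT.
have -> : Y `^ q = Y `^ (q - p) * Y `^ p.
  by rewrite -powRD ?subrK// gt_eqF.
ring.
Qed.

End averages.

(** * Calculus of upper bounds on norms *)

Section Lq_bounds.
Context d (T : measurableType d) (R : realType) (m : {measure set T -> \bar R}).
Variable q : R.
Hypothesis q1 : 1 <= q.
Let q0 : 0 < q. Proof. exact: lt_le_trans ltr01 q1. Qed.
Implicit Types (F G : T -> R) (a b c : R).

(** Comparing q-th powers with a real [c] avoids roots of extended reals; only addition passes
    through the library norm, for Minkowski's inequality. *)
Definition Nle F c := [/\ measurable_fun setT F, 0 <= c &
  (\int[m]_z ((`|F z|) `^ q)%:E <= (c `^ q)%:E)%E].

Lemma NleP F c : measurable_fun setT F -> 0 <= c ->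
  (Nle F c <-> ('N[m]_q%:E[EFin \o F] <= c%:E)%E).
Proof.
move=> mF c0.
have E : ('N[m]_q%:E[EFin \o F] = (\int[m]_z ((`|F z|) `^ q)%:E) `^ q^-1)%E.
  by rewrite unlock /Lnorm.
have I0 : (0 <= \int[m]_z ((`|F z|) `^ q)%:E)%E.
  by apply: integral_ge0 => z _; rewrite lee_fin powR_ge0.
split=> [[_ _ H]|H].
  rewrite E -[c](powRr1 c0) -(mulfV (lt0r_neq0 q0)) powRrM -poweR_EFin.
  apply: gt0_ler_poweR => //; first by rewrite invr_ge0 ltW.
    by rewrite in_itv/= I0 leey.
  by rewrite in_itv/= lee_fin powR_ge0 leey.
have {}E : (\int[m]_z ((`|F z|) `^ q)%:E = 'N[m]_q%:E[EFin \o F] `^ q)%E.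
  by rewrite E -poweRrM mulVf ?poweRe1// lt0r_neq0.
split => //; rewrite E -poweR_EFin; apply: gt0_ler_poweR => //; first exact: ltW.
  by rewrite in_itv/= Lnorm_ge0 leey.
by rewrite in_itv/= lee_fin c0 leey.
Qed.

Lemma Nle_mono F G c : measurable_fun setT F -> (forall z, `|F z| <= `|G z|) ->
  Nle G c -> Nle F c.
Proof.
move=> mF FG [mG c0 H]; split; [exact: mF|exact: c0|]; apply: le_trans H.
apply: ge0_le_integralT.
- by move=> z; rewrite lee_fin powR_ge0.
- apply/measurable_EFinP; apply: (measurableT_comp (measurable_powR q)).
  exact: measurableT_comp.
- apply/measurable_EFinP; apply: (measurableT_comp (measurable_powR q)).
  exact: measurableT_comp.
- by move=> z; rewrite lee_fin ge0_ler_powR ?nnegrE// ltW.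
Qed.

Lemma Nle_weaken F a b : a <= b -> Nle F a -> Nle F b.
Proof.
move=> ab [mF a0 H]; have b0 := le_trans a0 ab; split; [exact: mF|exact: b0|].
by apply: (le_trans H); rewrite lee_fin ge0_ler_powR ?nnegrE// ltW.
Qed.

Lemma Nle_add F G a b : Nle F a -> Nle G b -> Nle (fun z => F z + G z) (a + b).
Proof.
move=> HF HG; have [mF a0 _] := HF; have [mG b0 _] := HG.
have mFG : measurable_fun setT (fun z => F z + G z) by exact: measurable_funD.
apply/NleP => //; first exact: addr_ge0.
apply: (le_trans (minkowski_EFin m mF mG q1)); rewrite EFinD.
by apply: leeD; apply/NleP.
Qed.

Lemma Nle_scale F c a : 0 <= c -> Nle F a -> Nle (fun z => c * F z) (c * a).
Proof.
move=> c0 [mF a0 H]; split; [exact: measurable_funM|exact: mulr_ge0|].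
have mP : measurable_fun setT (fun z => ((`|F z|) `^ q)%:E).
  apply/measurable_EFinP; apply: (measurableT_comp (measurable_powR q)).
  exact: measurableT_comp.
rewrite powRM// EFinM; apply: (@le_trans _ _ ((c `^ q)%:E * \int[m]_z ((`|F z|) `^ q)%:E)%E).
  rewrite -(ge0_integralZT m (powR_ge0 c q) mP); last by move=> z; rewrite lee_fin powR_ge0.
  rewrite le_eqVlt; apply/orP; left; apply/eqP; apply: eq_integral => z _.
  by rewrite normrM powRM// ger0_norm.
by rewrite lee_wpmul2l ?lee_fin ?powR_ge0.
Qed.

Lemma Nle_sum (n : nat) (F : nat -> T -> R) (a : nat -> R) :
  (forall k, (k < n)%N -> Nle (F k) (a k)) ->
  Nle (fun z => \sum_(k < n) F k z) (\sum_(k < n) a k).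
Proof.
elim: n => [|n ih] H.
  rewrite big_ord0 (_ : (fun z => _) = cst 0); last by apply/funext => z; rewrite big_ord0.
  split => //; rewrite (_ : (fun z => _) = cst 0%E) ?integral0 ?lee_fin ?powR_ge0//.
  by apply/funext => z; rewrite normr0 powR0// gt_eqF.
rewrite big_ord_recr/= (_ : (fun z => _) = fun z => \sum_(k < n) F k z + F n z); last first.
  by apply/funext => z; rewrite big_ord_recr.
apply: Nle_add; last exact: H.
by apply: ih => k kn; apply: H; exact: ltnW.
Qed.

End Lq_bounds.

(** * Averages against bounded Lipschitz kernels *)

Section kernel_bounds.
Variables (R : realType) (d : nat).
Local Notation Z := ((1 + d + d).-tuple R).
Local Notation mu := (lebn R (1 + d + d)).
Local Notation I u := (Rintegral mu setT u).
Implicit Types (h k : d.-tuple R).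

(** What the size estimates use of a kernel. An increment in x lives on the box and its translate,
    so it is again controlled by two averages. *)
Definition kbound B M (Psi : Z -> R) := [/\ measurable_fun setT Psi,
  forall w, `|Psi w| <= M * \1_(box B) w &
  forall k e w, 0 <= e -> (forall i, `|tnth k i| <= e) ->
    `|Psi (xshift k w) - Psi w| <= M * e * (\1_(box B) w + \1_(box B) (xshift k w))].

Lemma tens_kbound (Psi : Z -> R) : tens Psi -> exists B M, [/\ 0 < B, 0 < M & kbound B M Psi].
Proof.
move=> tP; have [M [L [M0 L0 HM HL]]] := tens_bounded_lipschitz tP.
have [B B0 HB] := tens_compact_support tP.
have HB' z : ~ box B z -> Psi z = 0.
  by move=> /existsNP[j zj]; apply: HB; exists j; rewrite ltNge; exact/negP.
exists B, (M + L); split => //; first exact: addr_gt0.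
have ML : 0 <= M + L by rewrite addr_ge0// ltW.
split.
- exact: tens_measurable.
- move=> w; have [wB|wB] := pselect (box B w); last first.
    by rewrite HB'// normr0 mulr_ge0.
  by rewrite indicE mem_set// mulr1 (le_trans (HM w))// lerDl ltW.
- move=> k e w e0 ke.
  have [wB|wB] := pselect (box B w \/ box B (xshift k w)); last first.
    rewrite !HB'; first by rewrite subrr normr0 mulr_ge0// ?addr_ge0// mulr_ge0.
    + by move=> ?; apply: wB; left.
    + by move=> ?; apply: wB; right.
  apply: (@le_trans _ _ (L * e)).
    apply: HL => // j; rewrite tnth_mktuple addrAC subrr add0r xpartE.
    by case: (idxP j) => [|i|i]; rewrite kcaseE ?normr0.
  apply: (@le_trans _ _ ((M + L) * e)); first by rewrite ler_wpM2r// lerDr ltW.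
  rewrite ler_peMr ?mulr_ge0//.
  by case: wB => wB; rewrite !indicE (mem_set wB)/= ?lerDl ?lerDr.
Qed.

Lemma kbound_weaken B B' M M' Psi : B <= B' -> M <= M' -> 0 <= M ->
  kbound B M Psi -> kbound B' M' Psi.
Proof.
move=> BB MM M0 [mP H1 H2].
have ii z : \1_(box B) z <= \1_(box B') z :> R.
  rewrite !indicE ler_nat; case: (boolP (z \in box B)) => // /set_mem zB.
  by rewrite mem_set// => j; exact: le_trans (zB j) BB.
split => [//|w|k e w e0 ke].
  by apply: (le_trans (H1 w)); rewrite ler_pM.
apply: (le_trans (H2 k e w e0 ke)); rewrite ler_pM ?mulr_ge0 ?addr_ge0//.
  by rewrite ler_wpM2r.
by rewrite lerD.
Qed.

Lemma tens_kbound_family (J : finType) (Psi : J -> Z -> R) : (forall j, tens (Psi j)) ->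
  exists B M, [/\ 0 < B, 0 < M & forall j, kbound B M (Psi j)].
Proof.
move=> tP; have /choice[BM H] : forall j, exists BM : R * R,
    [/\ 0 < BM.1, 0 < BM.2 & kbound BM.1 BM.2 (Psi j)].
  by move=> j; have [B [M HBM]] := tens_kbound (tP j); exists (B, M).
have S1 j : (BM j).1 <= 1 + \sum_i (BM i).1.
  rewrite (bigD1 j)//= addrCA lerDl addr_ge0// sumr_ge0// => i _.
  by have [/ltW] := H i.
have S2 j : (BM j).2 <= 1 + \sum_i (BM i).2.
  rewrite (bigD1 j)//= addrCA lerDl addr_ge0// sumr_ge0// => i _.
  by have [_ /ltW] := H i.
exists (1 + \sum_i (BM i).1), (1 + \sum_i (BM i).2); split.
- by rewrite ltr_pwDl// sumr_ge0// => i _; have [/ltW] := H i.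
- by rewrite ltr_pwDl// sumr_ge0// => i _; have [_ /ltW] := H i.
- by move=> j; have [_ /ltW M0 HP] := H j; exact: kbound_weaken HP.
Qed.

Lemma xshiftK h k (w : Z) : (forall i, tnth k i = - tnth h i) -> xshift k (xshift h w) = w.
Proof.
move=> kh; apply: eq_from_tnth => j; rewrite !tnth_mktuple -addrA !xpartE.
by case: (idxP j) => [|i|i]; rewrite !kcaseE ?addr0// kh addrN addr0.
Qed.

Lemma Rintegral_xshift h (F : Z -> R) : mu.-integrable setT (EFin \o F) ->
  I (fun w => F (xshift h w)) = I F.
Proof.
move=> iF; rewrite /Rintegral.
rewrite (integral_change (mu := mu) (phi := xshift h) (c := 1) _ iF) ?mul1e//.
by move=> g mg g0; rewrite mul1e; exact: ge0_integral_xshift.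
Qed.

Lemma integrable_xshift h (F : Z -> \bar R) : mu.-integrable setT F ->
  mu.-integrable setT (fun w => F (xshift h w)).
Proof.
apply: (integrable_change (c := 1)) => //; first exact: measurable_xshift.
by move=> g mg g0; rewrite mul1e; exact: ge0_integral_xshift.
Qed.

Lemma ler_eucl h i : `|tnth h i| <= eucl h.
Proof.
rewrite -sqrtr_sqr /eucl ler_wsqrtr// (bigD1 i)//= lerDl sumr_ge0// => j _.
exact: sqr_ge0.
Qed.

Section one_point.
Variables (B M tau nu p : R) (u Psi : Z -> R) (z : Z).
Hypotheses (B0 : 0 < B) (M0 : 0 < M) (tau0 : 0 < tau) (nu0 : 0 < nu) (p1 : 1 <= p).
Hypotheses (hu : Lpfin p u) (kP : kbound B M Psi).
Local Notation A := (act tau nu z).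

Let ia := integrable_avg B0 tau0 nu0 z p1 hu.

Lemma integrable_kbound : mu.-integrable setT (EFin \o (fun w => u (A w) * Psi w)).
Proof.
have [mP HP _] := kP.
have mA : measurable_fun setT (fun w => u (A w)).
  by apply: (measurableT_comp hu.1); exact: measurable_act_w.
have iM := integrableZl measurableT M ia.
apply: (le_integrable measurableT _ _ iM).
  by apply/measurable_EFinP; exact: measurable_funM.
move=> w _; rewrite /= lee_fin !normrM (ger0_norm (ltW M0)) normr_id mulrCA.
by rewrite ler_wpM2l// (le_trans (HP w))// ger0_norm.
Qed.

Lemma Rintegral_kbound : `|I (fun w => u (A w) * Psi w)| <= M * avg B tau nu u z.
Proof.
have [_ HP _] := kP; have ik := integrable_kbound.
apply: (le_trans (le_normr_Rintegral measurableT ik)).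
rewrite /avg -RintegralZl//; apply: le_Rintegral => //.
- by have := integrable_abse ik; apply: eq_integrable.
- have := integrableZl measurableT M ia.
  by apply: eq_integrable => // w _; rewrite /= EFinM.
- by move=> w _; rewrite normrM mulrCA ler_wpM2l.
Qed.

End one_point.

Section two_points.
Variables (B M tau nu p : R) (u Psi : Z -> R) (h : d.-tuple R) (z : Z).
Hypotheses (B0 : 0 < B) (M0 : 0 < M) (tau0 : 0 < tau) (nu0 : 0 < nu) (p1 : 1 <= p).
Hypotheses (hu : Lpfin p u) (kP : kbound B M Psi).
Local Notation A := (act tau nu z).

Let etah : d.-tuple R := [tuple tnth h i / (tau * nu) | i < d].
Let etan : d.-tuple R := [tuple - tnth etah i | i < d].

Let etaK w : xshift etan (xshift etah w) = w :> Z.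
Proof. by apply: xshiftK => i; rewrite tnth_mktuple. Qed.
Let etaK' w : xshift etah (xshift etan w) = w :> Z.
Proof. by apply: xshiftK => i; rewrite [in RHS]tnth_mktuple opprK. Qed.

Lemma Rintegral_shift_kbound :
  `|I (fun w => u (act tau nu (xshift h z) w) * Psi w) - I (fun w => u (A w) * Psi w)| <=
  M * (eucl h / (tau * nu)) * (avg B tau nu u z + avg B tau nu u (xshift h z)).
Proof.
have [mP HP HL] := kP; have ik := integrable_kbound z B0 M0 tau0 nu0 p1 hu kP.
have tn0 : 0 < tau * nu by exact: mulr_gt0.
have e0 : 0 <= eucl h / (tau * nu) by rewrite divr_ge0 ?sqrtr_ge0// ltW.
have shE w : u (act tau nu (xshift h z) w) = u (A (xshift etah w)).
  by rewrite act_xshift xshift_act.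
(* The integrand after translating [w]: the increment now falls on [Psi] alone, at the cost of
   translating the indicator in [G]. *)
pose F w := u (A w) * Psi (xshift etan w).
pose G w := `|u (A w)| * \1_(box B) (xshift etan w).
have iF : mu.-integrable setT (EFin \o F).
  have H := integrable_kbound (xshift h z) B0 M0 tau0 nu0 p1 hu kP.
  have := integrable_xshift etan H.
  by apply: eq_integrable => // w _; rewrite /F/= shE etaK'.
have iG : mu.-integrable setT (EFin \o G).
  have H := integrable_avg B0 tau0 nu0 (xshift h z) p1 hu.
  have := integrable_xshift etan H.
  by apply: eq_integrable => // w _; rewrite /G/= shE etaK'.
have -> : I (fun w => u (act tau nu (xshift h z) w) * Psi w) = I F.
  rewrite -(Rintegral_xshift etah iF); apply: eq_Rintegral => w _.
  by rewrite /F etaK shE.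
have -> : avg B tau nu u (xshift h z) = I G.
  rewrite -(Rintegral_xshift etah iG); apply: eq_Rintegral => w _.
  by rewrite /G etaK shE.
have ia := integrable_avg B0 tau0 nu0 z p1 hu.
rewrite -RintegralB// /avg -RintegralD//.
have iD : mu.-integrable setT (EFin \o (fun w => F w - u (A w) * Psi w)).
  by have := integrableB measurableT iF ik; apply: eq_integrable => // w _; rewrite /= EFinB.
have iS : mu.-integrable setT (EFin \o (fun w => `|u (A w)| * \1_(box B) w + G w)).
  by have := integrableD measurableT ia iG; apply: eq_integrable => // w _; rewrite /= EFinD.
apply: (le_trans (le_normr_Rintegral measurableT iD)).
rewrite -RintegralZl//; apply: le_Rintegral => //.
- by have := integrable_abse iD; apply: eq_integrable.
- have := integrableZl measurableT (M * (eucl h / (tau * nu))) iS.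
  by apply: eq_integrable => // w _; rewrite /= EFinM.
- move=> w _; rewrite /F /G -mulrBr -mulrDr normrM mulrCA ler_wpM2l//.
  apply: HL => // i; rewrite !tnth_mktuple normrN normrM normfV (gtr0_norm tn0).
  by rewrite ler_wpM2r ?invr_ge0 ?(ltW tn0)// ler_eucl.
Qed.

(* min(1, |h| / (tau nu)) : the trivial bound at scales below |h|, the Lipschitz
   bound of the kernel above. *)
Lemma Rintegral_shift_min :
  `|I (fun w => u (act tau nu (xshift h z) w) * Psi w) - I (fun w => u (A w) * Psi w)| <=
  M * Num.min 1 (eucl h / (tau * nu)) * (avg B tau nu u z + avg B tau nu u (xshift h z)).
Proof.
rewrite /Num.min; case: ifPn => _; last exact: Rintegral_shift_kbound.
rewrite mulr1; apply: (le_trans (ler_normB _ _)); rewrite mulrDr addrC lerD//.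
  exact: (Rintegral_kbound z B0 M0 tau0 nu0 p1 hu kP).
exact: (Rintegral_kbound (xshift h z) B0 M0 tau0 nu0 p1 hu kP).
Qed.

End two_points.
End kernel_bounds.

(** * Density of Lipschitz functions *)

Lemma clamp_lipschitz (R : realType) (x y : R) :
  `|Num.max 0 (Num.min 1 x) - Num.max 0 (Num.min 1 y)| <= `|x - y|.
Proof.
have H1 := ler_norm (x - y); have H2 := ler_norm (y - x); rewrite distrC in H2.
move: H1 H2; set D := `|x - y| => H1 H2.
rewrite /Num.max /Num.min ler_norml; do !case: ifPn; rewrite -?leNgt => *; lra.
Qed.

Section lipschitz_density.
Variables (R : realType) (n : nat).
Local Notation V := (n.-tuple R).
Local Notation mu := (lebn R n).
Implicit Types (f g h : V -> R).
Variable B : R.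
Hypothesis B0 : 0 < B.
Local Notation W := (@box R n B).
Local Notation err f g := (\int[mu]_(z in W) (`|f z - g z|%:E))%E.

Let mW : measurable W. Proof. exact: measurable_box. Qed.

Let integrable_cst1 : mu.-integrable W (cst 1%E).
Proof.
apply/integrableP; split => //.
rewrite (_ : (\int[mu]_(x in W) _)%E = ((2 * B) ^+ n)%:E) ?ltry//.
rewrite -(lebn_box _ B0) -[RHS](mul1e) -integral_cst//.
by apply: eq_integral => x _ /=; rewrite normr1.
Qed.

Let merr f g : measurable_fun setT f -> measurable_fun setT g ->
  measurable_fun W (fun z : V => `|f z - g z|%:E).
Proof.
move=> mf mg; apply: measurable_funTS; apply/measurable_EFinP.
by apply: measurableT_comp => //; exact: measurable_funB.
Qed.

Lemma err_triangle f g h : measurable_fun setT f -> measurable_fun setT g ->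
  measurable_fun setT h -> (err f h <= err f g + err g h)%E.
Proof.
move=> mf mg mh; rewrite -ge0_integralD//; try exact: merr.
apply: ge0_le_integral => //; try exact: merr.
  by apply: emeasurable_funD; exact: merr.
move=> z _; rewrite -EFinD lee_fin.
exact: ler_distD.
Qed.

(** Dominated convergence on a box, with the constant 1 as dominating function; it serves both
    countable unions and half-spaces. *)
Lemma err_dominated (F : nat -> V -> R) f (e : R) : (forall k, measurable_fun setT (F k)) ->
  measurable_fun setT f -> (forall k z, `|F k z| <= 1) ->
  (forall z, F k z @[k --> \oo] --> f z) -> 0 < e ->
  exists k, (err f (F k) <= e%:E)%E.
Proof.
move=> mF mf F1 Ff e0.
have [|||||_ H _] := @dominated_convergence _ _ _ mu W mW (fun k => EFin \o F k)
  (EFin \o f) (cst 1%E).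
- by move=> k; apply: measurable_funTS; apply/measurable_EFinP.
- by apply: measurable_funTS; apply/measurable_EFinP.
- apply: aeW => z _; apply: cvg_EFin; first exact: nearW.
  exact: Ff.
- exact: integrable_cst1.
- by apply: aeW => z k _; rewrite /= lee_fin.
move: H => /fine_cvgP[Hfin /cvgrPdist_le/(_ e e0)] H.
near \oo => k; exists k.
have : `|0 - fine (\int[mu]_(x in W) `|(F k x)%:E - (f x)%:E|)%E| <= e.
  by near: k; exact: H.
have kfin : (\int[mu]_(x in W) `|(F k x)%:E - (f x)%:E|)%E \is a fin_num.
  by near: k; exact: Hfin.
rewrite sub0r normrN ger0_norm ?fine_ge0 ?integral_ge0// => He.
rewrite (_ : err f (F k) = \int[mu]_(x in W) `|(F k x)%:E - (f x)%:E|)%E.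
  by rewrite -(fineK kfin) lee_fin.
by apply: eq_integral => z _; rewrite -EFinB distrC.
Unshelve. all: by end_near. Qed.

(** The range [[0, 1]] is kept by complements and products, and lets the errors of two factors
    simply add up. *)
Definition nice (phi : V -> R) := [/\ measurable_fun setT phi, bounded_lipschitz phi &
  forall z, 0 <= phi z <= 1].

(* These sets form a sigma-algebra containing the half-spaces. *)
Definition good (A : set V) := measurable A /\
  forall e, 0 < e -> exists2 phi, nice phi & (err (\1_A : V -> R) phi <= e%:E)%E.

Let mI (A : set V) : measurable A -> measurable_fun setT (\1_A : V -> R).
Proof. exact: measurable_indic. Qed.

Lemma goodC A : good A -> good (~` A).
Proof.
move=> [mA H]; split; first exact: measurableC.
move=> e e0; have [phi [mphi [M [L [M0 L0 HM HL]]] p01] He] := H e e0.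
exists (fun z => 1 - phi z).
  split; first exact: measurable_funB.
    exists (1 + M), L; split => // [|z|r z w r0 zw]; first exact: addr_gt0.
      by rewrite (le_trans (ler_normB _ _))// normr1 lerD2l.
    by rewrite (_ : _ - _ = - (phi z - phi w)) ?normrN ?HL//; ring.
  by move=> z; have /andP[? ?] := p01 z; apply/andP; split; lra.
apply: le_trans He; rewrite le_eqVlt; apply/orP; left; apply/eqP.
apply: eq_integral => z _; rewrite indicC /=.
rewrite indicE distrC; case: (z \in A) => /=; first by rewrite subr0.
by rewrite sub0r normrN -normrN; congr (`|_|%:E); ring.
Qed.

Lemma goodI A A' : good A -> good A' -> good (A `&` A').
Proof.
move=> [mA H] [mA' H']; split; first exact: measurableI.
move=> e e0; have e2 : 0 < e / 2 by rewrite divr_gt0.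
have [phi [mphi bphi p01] He] := H _ e2; have [psi [mpsi bpsi q01] He'] := H' _ e2.
exists (fun z => phi z * psi z).
  split; [exact: measurable_funM|exact: bounded_lipschitzM|move=> z].
  have /andP[p0 p1] := p01 z; have /andP[q0 q1] := q01 z.
  by rewrite mulr_ge0//= -[leRHS](mulr1 1) ler_pM.
apply: (@le_trans _ _ (err (\1_A : V -> R) phi + err (\1_A' : V -> R) psi)%E); last first.
  by rewrite (splitr e) EFinD leeD.
have m1 := merr (mI mA) mphi; have m2 := merr (mI mA') mpsi.
rewrite -ge0_integralD//.
apply: ge0_le_integral => //.
- by apply: merr; [apply: mI; exact: measurableI|exact: measurable_funM].
- exact: emeasurable_funD.
move=> z _; rewrite -EFinD lee_fin indicI /=.
have -> : \1_A z * \1_A' z - phi z * psi z =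
  (\1_A z - phi z) * \1_A' z + phi z * (\1_A' z - psi z) by ring.
rewrite (le_trans (ler_normD _ _))// !normrM lerD//.
  by rewrite ler_piMr// ger0_norm// indic_le1.
by rewrite ler_piMl// ger0_norm; have /andP[] := p01 z.
Qed.

Lemma good0 : good set0.
Proof.
split => // e e0; exists (fun=> 0).
  by split => //; [exists 1, 1; split => // *; rewrite ?normr0 ?subrr ?normr0 ?mul1r|rewrite lexx ler01].
under eq_integral do rewrite indic0 subrr normr0.
by rewrite integral0 lee_fin ltW.
Qed.

Lemma good_bigcup (F : nat -> set V) : (forall k, good (F k)) -> good (\bigcup_k F k).
Proof.
move=> gF; have mU : measurable (\bigcup_k F k) by apply: bigcup_measurable => k _; exact: (gF k).1.
(* Finite unions follow from complements and intersections; dominated convergence then reaches the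
   countable one. *)
pose G k := \big[setU/set0]_(i < k) F i.
have gG k : good (G k).
  elim: k => [|k ih]; first by rewrite /G big_ord0; exact: good0.
  rewrite /G big_ord_recr/= -[_ `|` _]setCK setCU.
  exact: (goodC (goodI (goodC ih) (goodC (gF k)))).
split => // e e0; have e2 : 0 < e / 2 by rewrite divr_gt0.
have [k Hk] : exists k, (err (\1_(\bigcup_k F k) : V -> R) (\1_(G k) : V -> R) <= (e / 2)%:E)%E.
  apply: (err_dominated (F := fun k => \1_(G k) : V -> R)) => //.
  - by move=> k; apply: mI; exact: (gG k).1.
  - by move=> k z; rewrite ger0_norm// indic_le1.
  move=> z; have [[i _ Fi]|zF] := pselect ((\bigcup_k F k) z); last first.
    rewrite (_ : (fun k => _) = cst (\1_(\bigcup_k F k) z)); first exact: cvg_cst.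
    apply/funext => k /=; rewrite !indicE !memNset//.
    by rewrite /G -bigcup_mkord => -[i _ Fi]; apply: zF; exists i.
  apply: cvg_near_cst.
  exists i.+1 => // k /= ik; rewrite !indicE !mem_set//; first by exists i.
  by rewrite /G -bigcup_mkord; exists i.
have [phi nphi He] := (gG k).2 _ e2; exists phi => //.
have mU' := mI mU; have mGk := mI (gG k).1; have [mphi _ _] := nphi.
apply: (le_trans (err_triangle mU' mGk mphi)).
by rewrite (splitr e) EFinD leeD.
Qed.

Lemma good_ray (j : 'I_n) (a : R) : good [set z | a < tnth z j].
Proof.
(* Ramps of slope [k]: zero off the half-space, and equal to 1 at a given point of it as soon as
   [k >= 1 / (z_j - a)]. *)
pose F (k : nat) (z : V) : R := Num.max 0 (Num.min 1 (k%:R * (tnth z j - a))).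
have F01 k z : 0 <= F k z <= 1.
  by rewrite /F le_max lexx/= ge_max ler01/= ge_min lexx.
have mF k : measurable_fun setT (F k).
  apply: measurable_maxr => //; apply: measurable_minr => //.
  by apply: measurable_funM => //; apply: measurable_funB => //; exact: measurable_tnth.
have mA : measurable [set z : V | a < tnth z j].
  rewrite (_ : [set z | _] = (fun z : V => tnth z j) @^-1` `]a, +oo[).
    by rewrite -[X in measurable X]setTI; exact: measurable_tnth.
  by apply/seteqP; split => z /=; rewrite in_itv/= andbT.
split => // e e0.
have [k Hk] : exists k, (err (\1_[set z : V | a < tnth z j] : V -> R) (F k) <= e%:E)%E.
  apply: err_dominated => //.
    by move=> k z; have /andP[? ?] := F01 k z; rewrite ger0_norm.
  move=> z; have [az|za] := ltP a (tnth z j); last first.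
    rewrite (_ : (fun k => _) = cst (\1_[set z : V | a < tnth z j] z)); first exact: cvg_cst.
    apply/funext => k /=; rewrite indicE memNset/=; last by apply/negP; rewrite -leNgt.
    rewrite /F max_l// ge_min; apply/orP; right.
    by rewrite mulr_ge0_le0// subr_le0.
  apply: cvg_near_cst.
  rewrite indicE mem_set//=.
  have := nbhs_infty_ger ((tnth z j - a)^-1 : R); apply: filterS => k hk.
  rewrite /F min_l; first by rewrite max_r// ler01.
  by rewrite -ler_pdivrMr ?subr_gt0// mul1r.
exists (F k) => //; split => //.
exists 1, (k%:R + 1); split => //.
  by move=> z; have /andP[? ?] := F01 k z; rewrite ger0_norm.
move=> r z w r0 zw; apply: (@le_trans _ _ `|k%:R * (tnth z j - a) - k%:R * (tnth w j - a)|).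
  exact: clamp_lipschitz.
rewrite -mulrBr opprB addrA subrK normrM ger0_norm//.
by rewrite ler_pM// ?lerDl// zw.
Qed.

(** The sigma-algebra on tuples is generated by coordinate preimages of Borel sets, and these by
    open rays: minimality is applied twice. *)
Lemma good_measurable A : measurable A -> good A.
Proof.
have sa : sigma_algebra setT good.
  split; [exact: good0| |exact: good_bigcup].
  by move=> A' gA; rewrite setTD; exact: goodC.
suff H : measurable `<=` good by exact: H.
apply: smallest_sub => //.
move=> X; rewrite -bigcup_seq => -[j _ [Y mY <-]].
rewrite setTI.
have saj : sigma_algebra setT [set Y : set R | good ((fun z : V => tnth z j) @^-1` Y)].
  split => /=.
  - by rewrite preimage_set0; exact: good0.
  - by move=> A' gA; rewrite setTD preimage_setC; exact: goodC.
  - by move=> F gF; rewrite preimage_bigcup; exact: good_bigcup.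
suff : [set Y : set R | good ((fun z : V => tnth z j) @^-1` Y)] Y by [].
move: Y mY {X}; change ((R.-ocitv.-measurable).-sigma.-measurable `<=`
  [set Y : set R | good ((fun z : V => tnth z j) @^-1` Y)]).
rewrite RGenOInfty.measurableE; apply: smallest_sub => // Y [a ->] /=.
rewrite (_ : _ @^-1` _ = [set z : V | a < tnth z j]); first exact: good_ray.
by apply/seteqP; split => z /=; rewrite in_itv/= andbT.
Qed.

End lipschitz_density.

Section lipschitz_density_integrable.
Variables (R : realType) (n : nat).
Local Notation V := (n.-tuple R).
Local Notation mu := (lebn R n).
Implicit Types (f g h : V -> R).
Variable B : R.
Hypothesis B0 : 0 < B.
Local Notation W := (@box R n B).
Local Notation err f g := (\int[mu]_(z in W) (`|f z - g z|%:E))%E.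

Definition lip_approx f := measurable_fun setT f /\
  forall e, 0 < e -> exists phi, [/\ measurable_fun setT phi, bounded_lipschitz phi &
    (err f phi <= e%:E)%E].

Let mW : measurable W. Proof. exact: measurable_box. Qed.

Let merr f g : measurable_fun setT f -> measurable_fun setT g ->
  measurable_fun W (fun z : V => `|f z - g z|%:E).
Proof.
move=> mf mg; apply: measurable_funTS; apply/measurable_EFinP.
by apply: measurableT_comp => //; exact: measurable_funB.
Qed.

Lemma bounded_lipschitzD f g : bounded_lipschitz f -> bounded_lipschitz g ->
  bounded_lipschitz (fun z => f z + g z).
Proof.
move=> [M [L [M0 L0 HM HL]]] [M' [L' [M0' L0' HM' HL']]].
exists (M + M'), (L + L'); split; [exact: addr_gt0|exact: addr_gt0| |].
  by move=> z; rewrite (le_trans (ler_normD _ _))// lerD.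
move=> r z w r0 zw; rewrite opprD addrACA mulrDl (le_trans (ler_normD _ _))// lerD//.
  exact: HL.
exact: HL'.
Qed.

Lemma bounded_lipschitz_cst (c : R) : bounded_lipschitz (fun _ : V => c).
Proof.
exists (`|c| + 1), 1; split => //.
  by move=> z; rewrite lerDl.
by move=> r z w r0 _; rewrite subrr normr0 mul1r.
Qed.

Lemma lip_approxD f g : lip_approx f -> lip_approx g -> lip_approx (fun z => f z + g z).
Proof.
move=> [mf Hf] [mg Hg]; split; first exact: measurable_funD.
move=> e e0; have e2 : 0 < e / 2 by rewrite divr_gt0.
have [phi [mphi bphi He]] := Hf _ e2; have [psi [mpsi bpsi He']] := Hg _ e2.
exists (fun z => phi z + psi z); split.
- exact: measurable_funD.
- exact: bounded_lipschitzD.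
apply: (@le_trans _ _ (err f phi + err g psi)%E); last by rewrite (splitr e) EFinD leeD.
have m1 := merr mf mphi; have m2 := merr mg mpsi.
rewrite -ge0_integralD//.
apply: ge0_le_integral => //.
- by apply: merr; exact: measurable_funD.
- exact: emeasurable_funD.
by move=> z _; rewrite -EFinD lee_fin opprD addrACA ler_normD.
Qed.

Lemma lip_approxZ c f : lip_approx f -> lip_approx (fun z => c * f z).
Proof.
move=> [mf Hf]; split; first exact: measurable_funM.
move=> e e0; have c0 : 0 < `|c| + 1 by rewrite ltr_wpDl.
have [phi [mphi bphi He]] := Hf (e / (`|c| + 1)) (divr_gt0 e0 c0).
exists (fun z => c * phi z); split.
- exact: measurable_funM.
- exact: bounded_lipschitzM (bounded_lipschitz_cst c) bphi.
apply: (@le_trans _ _ (`|c|%:E * err f phi)%E).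
  rewrite -ge0_integralZl//; last exact: merr.
  rewrite le_eqVlt; apply/orP; left; apply/eqP.
  by apply: eq_integral => z _; rewrite -mulrBr normrM.
apply: (@le_trans _ _ (`|c|%:E * (e / (`|c| + 1))%:E)%E).
  by rewrite lee_wpmul2l ?lee_fin.
rewrite -EFinM lee_fin mulrCA ler_piMr ?(ltW e0)// ler_pdivrMr// mul1r.
by rewrite lerDl.
Qed.

Lemma lip_approx_indic A : measurable A -> lip_approx (\1_A : V -> R).
Proof.
move=> mA; split; first exact: measurable_indic.
move=> e e0; have [_ /(_ e e0)[phi [mphi bphi _] He]] := good_measurable B0 mA.
by exists phi.
Qed.

Lemma lip_approx_sum (I : Type) (r : seq I) (F : I -> V -> R) :
  (forall i, lip_approx (F i)) -> lip_approx (fun z => \sum_(i <- r) F i z).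
Proof.
move=> HF; elim: r => [|i r ih].
  under eq_fun do rewrite big_nil.
  split => // e e0; exists (fun=> 0); split => //; first exact: bounded_lipschitz_cst.
  under eq_integral do rewrite subrr normr0.
  by rewrite integral0 lee_fin ltW.
under eq_fun do rewrite big_cons.
exact: lip_approxD.
Qed.

Import HBSimple.

Lemma lip_approx_sfun (g : {sfun V >-> R}) : lip_approx (fun z => g z).
Proof.
rewrite (_ : (fun z => g z) = fun z =>
    \sum_(y <- finmap.enum_fset (fset_set (range g))) y * \1_(g @^-1` [set y]) z).
  apply: lip_approx_sum => y; apply: lip_approxZ; apply: lip_approx_indic.
  by rewrite -[X in measurable X]setTI; apply: measurable_funP.
by apply/funext => z; rewrite fimfunE fsbig_finite.
Qed.

(** Simple functions are dense and combine indicators. This density takes the place of continuity of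
    translations when the mollification is shown to converge. *)
Lemma integrable_lip_approx f : measurable_fun setT f ->
  mu.-integrable W (EFin \o f) -> lip_approx f.
Proof.
move=> mf intf; split => // e e0; have e2 : 0 < e / 2 by rewrite divr_gt0.
have [g_ [ig _ H]] := approximation_sfun_integrable mW intf.
have [k Hk] : exists k, (err f (g_ k) <= (e / 2)%:E)%E.
  move: H => /fine_cvgP[Hfin /cvgrPdist_le/(_ _ e2)] H.
  near \oo => k; exists k.
  have He : `|0 - fine (\int[mu]_(z in W) `|(EFin \o f) z - (g_ k z)%:E|)%E| <= e / 2.
    by near: k; exact: H.
  have kfin : (\int[mu]_(z in W) `|(EFin \o f) z - (g_ k z)%:E|)%E \is a fin_num.
    by near: k; exact: Hfin.
  rewrite sub0r normrN ger0_norm ?fine_ge0 ?integral_ge0// in He.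
  rewrite (_ : err f (g_ k) = \int[mu]_(z in W) `|(EFin \o f) z - (g_ k z)%:E|)%E.
    by rewrite -(fineK kfin) lee_fin.
  by apply: eq_integral.
have [mg Hg] := lip_approx_sfun (g_ k).
have [phi [mphi bphi He]] := Hg _ e2; exists phi; split => //.
apply: (le_trans (err_triangle B mf mg mphi)).
by rewrite (splitr e) EFinD leeD.
Unshelve. all: by end_near. Qed.

End lipschitz_density_integrable.

(** * Convergence of the mollification *)

Section approximation.
Variables (R : realType) (d : nat).
Local Notation Z := ((1 + d + d).-tuple R).
Local Notation mu := (lebn R (1 + d + d)).
Local Notation I u := (Rintegral mu setT u).
Implicit Types z w : Z.
Variables (K u : Z -> R).
Hypotheses (tK : tens K) (K0 : forall w, 0 <= K w) (K1 : (\int[mu]_w (K w)%:E = 1)%E).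
Hypothesis hu : Lpfin 2 u.

Let mK : measurable_fun setT K. Proof. exact: tens_measurable. Qed.

Let iK : mu.-integrable setT (EFin \o K).
Proof.
apply/integrableP; split; first exact/measurable_EFinP.
under eq_integral => w _ do rewrite gee0_abs ?lee_fin//.
by rewrite K1 ltry.
Qed.

Lemma integrable_on_box (M : R) : 0 < M -> mu.-integrable (box M) (EFin \o u).
Proof.
move=> M0; have M12 : 1 <= 2 :> R by rewrite ler1n.
have := integrable_norm_box M0 M12 hu => /integrableP[_ H].
apply/integrableP; split; first by apply: measurable_funTS; apply/measurable_EFinP; exact: hu.1.
apply: le_lt_trans H; rewrite le_eqVlt; apply/orP; left; apply/eqP.
rewrite integral_mkcond; apply: eq_integral => z _.
rewrite /= patchE indicE; case: ifPn => _ /=; first by rewrite mulr1 normr_id.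
by rewrite mulr0 normr0.
Qed.

Section one_scale.
Variables (B MK M L tau nu dl e : R) (phi : Z -> R).
Hypotheses (B0 : 0 < B) (MK0 : 0 < MK) (kK : kbound B MK K) (M0 : 0 < M) (L0 : 0 < L).
Hypotheses (tau0 : 0 < tau) (nu0 : 0 < nu) (taud : tau <= dl) (nud : nu <= dl) (dl1 : dl <= 1).
(** Radius of a box containing [act tau nu z w] for [z] in [box M], [w] in [box B] and scales at
    most 1. *)
Let M' := B + (M + B * M).
Hypotheses (mphi : measurable_fun setT phi) (phiL : forall r z w, 0 <= r ->
  (forall j, `|tnth z j - tnth w j| <= r) -> `|phi z - phi w| <= L * r).
Hypothesis He : (\int[mu]_(z in box M') (`|u z - phi z|%:E) <= e%:E)%E.
Let g z := `|u z - phi z| * \1_(box M') z.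
Let c := L * (dl * (B + B * M)).

Let g0 z : 0 <= g z. Proof. by rewrite mulr_ge0. Qed.

Let mg : measurable_fun setT g.
Proof.
apply: measurable_funM; last by apply: measurable_indic; exact: measurable_box.
by apply: measurableT_comp => //; apply: measurable_funB => //; exact: hu.1.
Qed.

Let intg : (\int[mu]_z (g z)%:E <= e%:E)%E.
Proof.
apply: le_trans He; rewrite le_eqVlt; apply/orP; left; apply/eqP.
rewrite [RHS]integral_mkcond; apply: eq_integral => z _.
rewrite patchE /g indicE; case: ifPn => _ /=; first by rewrite mulr1.
by rewrite mulr0.
Qed.

Let act_near z w : box M z -> box B w ->
  forall j, `|tnth (act tau nu z w) j - tnth z j| <= dl * (B + B * M).
Proof.
move=> zM wB j; rewrite tnth_mktuple [X in X - _]addrCA addrAC subrr add0r.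
have dl0 : 0 <= dl by rewrite (le_trans _ taud)// ltW.
rewrite mulrDr (le_trans (ler_normD _ _))// lerD//; rewrite !normrM.
  apply: ler_pM => //.
  rewrite /kscale; case: (idxP j) => [|i|i]; rewrite kcaseE ger0_norm ?mulr_ge0 ?(ltW tau0) ?(ltW nu0)//.
  rewrite -[leRHS]mulr1; apply: ler_pM; rewrite ?(ltW tau0) ?(ltW nu0)//.
  exact: le_trans nud dl1.
rewrite -mulrA; apply: ler_pM; rewrite ?mulr_ge0//; first by rewrite ger0_norm ?(ltW tau0).
apply: ler_pM => //.
rewrite /vpart; case: (idxP j) => [|i|i]; rewrite kcaseE ?normr0 ?(ltW M0)//.
Qed.

Let u_near z w : box M z -> `|u (act tau nu z w) - u z| * K w <=
  g (act tau nu z w) * K w + (c + g z) * K w.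
Proof.
move=> zM; have [wB|wB] := pselect (box B w); last first.
  have [_ /(_ w) + _] := kK; rewrite indicE memNset// mulr0 normr_le0 => /eqP ->.
  by rewrite !mulr0 addr0.
have dl0 : 0 <= dl by rewrite (le_trans _ taud)// ltW.
have N := act_near zM wB.
have zM' : box M' z.
  by move=> j; rewrite (le_trans (zM j))// /M' addrCA lerDl addr_ge0 ?mulr_ge0 ?(ltW B0) ?(ltW M0).
have AM' : box M' (act tau nu z w).
  move=> j; rewrite -[tnth _ j](subrK (tnth z j)) (le_trans (ler_normD _ _))//.
  rewrite /M' [M + _]addrC addrA lerD//.
  rewrite (le_trans (N j))// -[leRHS]mul1r ler_wpM2r//.
  by rewrite addr_ge0 ?mulr_ge0 ?(ltW B0) ?(ltW M0).
rewrite -mulrDl ler_wpM2r// /g !indicE !mem_set//= !mulr1.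
set a := act _ _ _ _.
have H : `|phi a - phi z| <= c.
  by apply: phiL => //; rewrite mulr_ge0// addr_ge0 ?mulr_ge0 ?(ltW B0) ?(ltW M0).
rewrite (_ : u a - u z = (u a - phi a) + ((phi a - phi z) - (u z - phi z))); last by ring.
rewrite (le_trans (ler_normD _ _))// lerD2l (le_trans (ler_normB _ _))// lerD2r.
exact: H.
Qed.

Let mgA : measurable_fun setT (fun y : Z * Z => (g (act tau nu y.1 y.2) * K y.2)%:E).
Proof.
apply/measurable_EFinP; apply: measurable_funM.
  by apply: (measurableT_comp mg); exact: measurable_act.
exact: (measurableT_comp mK measurable_snd).
Qed.

Let diff_le z : box M z ->
  ((`|I (fun w => u (act tau nu z w) * K w) - u z|)%:E <=
   \int[mu]_w (g (act tau nu z w) * K w)%:E + (c + g z)%:E)%E.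
Proof.
move=> zM; have M12 : 1 <= 2 :> R by rewrite ler1n.
have i1 := integrable_kbound z B0 MK0 tau0 nu0 M12 hu kK.
have i2 : mu.-integrable setT (EFin \o (fun w => u z * K w)).
  have := integrableZl measurableT (u z) iK.
  by apply: eq_integrable => // w _; rewrite /= EFinM.
have i3 : mu.-integrable setT (EFin \o (fun w => u (act tau nu z w) * K w - u z * K w)).
  by have := integrableB measurableT i1 i2; apply: eq_integrable => // w _; rewrite /= EFinB.
have -> : I (fun w => u (act tau nu z w) * K w) - u z =
    I (fun w => u (act tau nu z w) * K w - u z * K w).
  rewrite RintegralB//; congr (_ - _).
  by rewrite RintegralZl// /Rintegral K1 mulr1.
apply: (@le_trans _ _ (\int[mu]_w (`|u (act tau nu z w) * K w - u z * K w|)%:E)%E).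
  have i4 := integrable_abse i3.
  rewrite (_ : (\int[mu]_w _)%E = (I (fun w => `|u (act tau nu z w) * K w - u z * K w|))%:E).
    by rewrite lee_fin; exact: le_normr_Rintegral.
  rewrite /Rintegral fineK//; exact: integrable_fin_num i4.
have mA : measurable_fun setT (fun w => (g (act tau nu z w) * K w)%:E).
  exact: (measurableT_comp mgA (measurable_pair1 z)).
have c0 : 0 <= c + g z.
  rewrite addr_ge0// mulr_ge0 ?(ltW L0)// mulr_ge0 ?addr_ge0 ?mulr_ge0 ?(ltW B0) ?(ltW M0)//.
  by rewrite (le_trans _ taud)// ltW.
rewrite -[(c + g z)%:E]mule1 -K1.
rewrite -(ge0_integralZT mu c0); last 2 first.
- exact/measurable_EFinP.
- by move=> w; rewrite lee_fin.
rewrite -ge0_integralD//; last 3 first.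
- by move=> w _; rewrite lee_fin mulr_ge0.
- by move=> w _; rewrite -EFinM lee_fin mulr_ge0.
- by apply: measurable_funeM; exact/measurable_EFinP.
apply: ge0_le_integralT.
- by move=> w; rewrite lee_fin.
- apply/measurable_EFinP; apply: measurableT_comp => //; apply/measurable_EFinP.
  by have /integrableP[] := i3.
- by apply: emeasurable_funD => //; apply: measurable_funeM; exact/measurable_EFinP.
move=> w; rewrite -EFinM -EFinD lee_fin -mulrBl normrM (ger0_norm (K0 w)).
exact: u_near.
Qed.

(** With [a = act tau nu z w], write [u a - u z] as [(u - phi) a + (phi a - phi z) - (u - phi) z].
    The outer terms cost [e] each, the first because [z -> a] preserves the measure; the middle one
    is at most [c] on the box. *)
Lemma integral_convolution_diff :
  (\int[mu]_z (`|I (fun w => u (act tau nu z w) * K w) - u z| * \1_(box M) z)%:E <=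
   (e + (c * (2 * M) ^+ (1 + d + d) + e))%:E)%E.
Proof.
have mU : measurable_fun setT (fun z => I (fun w => u (act tau nu z w) * K w)).
  apply: (measurableT_comp (fine_measurable measurableT)).
  apply: (@measurable_integral_param _ _ _ _ _ mu
    (fun y : Z * Z => (u (act tau nu y.1 y.2) * K y.2)%:E)).
  apply/measurable_EFinP; apply: measurable_funM.
    by apply: (measurableT_comp hu.1); exact: measurable_act.
  exact: (measurableT_comp mK measurable_snd).
have mB : measurable_fun setT (\1_(box M) : Z -> R).
  by apply: measurable_indic; exact: measurable_box.
have c0 : 0 <= c.
  rewrite mulr_ge0 ?(ltW L0)// mulr_ge0 ?addr_ge0 ?mulr_ge0 ?(ltW B0) ?(ltW M0)//.
  by rewrite (le_trans _ taud)// ltW.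
have gK0 y : (0 <= (g (act tau nu y.1 y.2) * K y.2)%:E)%E by rewrite lee_fin mulr_ge0.
have mgz : measurable_fun setT (fun z => \int[mu]_w (g (act tau nu z w) * K w)%:E)%E.
  exact: (@measurable_integral_param _ _ _ _ _ mu _ mgA).
have mcg : measurable_fun setT (fun z => (c * \1_(box M) z)%:E + (g z)%:E : \bar R)%E.
  apply: emeasurable_funD; apply/measurable_EFinP => //.
  exact: measurable_funM.
apply: (@le_trans _ _ (\int[mu]_z (\int[mu]_w (g (act tau nu z w) * K w)%:E +
    ((c * \1_(box M) z)%:E + (g z)%:E)))%E).
  apply: ge0_le_integralT.
  - by move=> z; rewrite lee_fin mulr_ge0.
  - apply/measurable_EFinP; apply: measurable_funM => //.
    by apply: measurableT_comp => //; apply: measurable_funB => //; exact: hu.1.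
  - exact: emeasurable_funD.
  move=> z; have I0 : (0 <= \int[mu]_w (g (act tau nu z w) * K w)%:E)%E.
    by apply: integral_ge0 => w _; exact: (gK0 (z, w)).
  have [zM|zM] := pselect (box M z); last first.
    by rewrite indicE memNset// !mulr0 add0e adde_ge0// lee_fin.
  by rewrite indicE mem_set// !mulr1 -EFinD; exact: diff_le.
rewrite ge0_integralD//; last 2 first.
- by move=> z _; apply: integral_ge0 => w _; exact: (gK0 (z, w)).
- by move=> z _; rewrite -EFinD lee_fin addr_ge0// mulr_ge0.
rewrite EFinD; apply: leeD.
  rewrite (fubini_tonelli _ mgA gK0) /=.
  have gw w : (\int[mu]_z (g (act tau nu z w) * K w)%:E =
      (\int[mu]_z (g z)%:E) * (K w)%:E)%E.
    have P0 z : (0 <= (g z)%:E)%E by rewrite lee_fin.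
    have E := ge0_integral_act_z tau nu w ((measurable_EFinP setT g).2 mg) P0.
    have mz := measurableT_comp ((measurable_EFinP setT g).2 mg) (measurable_act_z tau nu w).
    rewrite -E muleC -(ge0_integralZT mu (K0 w) mz); last by move=> z; exact: P0.
    by apply: eq_integral => z _; rewrite /= mulrC EFinM.
  under eq_integral => w _ do rewrite gw.
  rewrite ge0_integralZl//; last 3 first.
  - exact/measurable_EFinP.
  - by move=> w _; rewrite lee_fin.
  - by apply: integral_ge0 => z _; rewrite lee_fin.
  by rewrite K1 mule1.
rewrite ge0_integralD//; last 4 first.
- by move=> z _; rewrite lee_fin mulr_ge0.
- by apply/measurable_EFinP; exact: measurable_funM.
- by move=> z _; rewrite lee_fin.
- exact/measurable_EFinP.
rewrite EFinD; apply: leeD => //.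
under eq_integral => z _ do rewrite EFinM.
rewrite (ge0_integralZT mu c0); last 2 first.
- exact/measurable_EFinP.
- by move=> z; rewrite lee_fin.
rewrite integral_indic ?setIT ?lebn_box//; exact: measurable_box.
Qed.

End one_scale.

Lemma convolution_cvg (M e : R) : 0 < M -> 0 < e -> exists2 dl, 0 < dl &
  forall tau nu, 0 < tau -> tau <= dl -> 0 < nu -> nu <= dl ->
  (\int[mu]_z (`|I (fun w => u (act tau nu z w) * K w) - u z| * \1_(box M) z)%:E <= e%:E)%E.
Proof.
move=> M0 e0; have [B [MK [B0 MK0 kK]]] := tens_kbound tK.
have M'0 : 0 < B + (M + B * M) by rewrite !addr_gt0// mulr_gt0.
(* Two errors [e / 4] come from the approximation, and [dl] is chosen to leave [e / 2] for the
   Lipschitz term. *)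
have e4 : 0 < e / 4 by rewrite divr_gt0.
have [_ /(_ _ e4)[phi [mphi [M1 [L [_ L0 _ HL]]] He]]] :=
  integrable_lip_approx M'0 hu.1 (integrable_on_box M'0).
pose k := L * (B + B * M) * (2 * M) ^+ (1 + d + d).
have k0 : 0 < k by rewrite !mulr_gt0 ?exprn_gt0 ?addr_gt0 ?mulr_gt0.
exists (Num.min 1 (e / (2 * k))).
  by rewrite lt_min ltr01 divr_gt0// mulr_gt0.
move=> tau nu tau0 taud nu0 nud; set dl := Num.min _ _ in taud nud.
have dl1 : dl <= 1 by rewrite ge_min lexx.
have dlk : dl <= e / (2 * k) by rewrite ge_min lexx orbT.
apply: (le_trans (integral_convolution_diff B0 MK0 kK M0 L0 tau0 nu0 taud nud dl1 mphi HL He)).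
have {}dlk : dl * k <= e / 2.
  have k2 : 0 < 2 * k by exact: mulr_gt0.
  by rewrite ler_pdivlMr// -mulrA [k * 2]mulrC -ler_pdivlMr.
rewrite lee_fin (_ : _ * _ ^+ _ = dl * k); last by rewrite /k; ring.
by move: (dl * k) dlk => x; lra.
Qed.

End approximation.

(** * One step of the multiscale decomposition *)

Section scale_step.
Variables (R : realType) (d : nat).
Local Notation Z := ((1 + d + d).-tuple R).
Local Notation mu := (lebn R (1 + d + d)).
Local Notation I u := (Rintegral mu setT u).
Implicit Types z w : Z.

Lemma ler_vnorm n (F : 'I_d -> n.-tuple R -> R) i y : `|F i y| <= vnorm F y.
Proof.
rewrite -sqrtr_sqr /vnorm ler_wsqrtr// (bigD1 i)//= lerDl sumr_ge0// => j _.
exact: sqr_ge0.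
Qed.

Lemma measurable_vnorm n (F : 'I_d -> n.-tuple R -> R) :
  (forall i, measurable_fun setT (F i)) -> measurable_fun setT (vnorm F).
Proof.
move=> mF; apply: (measurableT_comp (continuous_measurable_fun (@sqrt_continuous R))).
by apply: measurable_sum => i; exact: measurable_funX.
Qed.

Lemma Lpfin_component n p (F : 'I_d -> n.-tuple R -> R) i : 0 <= p ->
  (forall i, measurable_fun setT (F i)) ->
  Lpfin p (vnorm F) -> Lpfin p (F i).
Proof.
move=> p0 mF [_ H]; split; first exact: mF.
apply: le_lt_trans H; apply: ge0_le_integralT.
- by move=> y; rewrite lee_fin powR_ge0.
- exact: measurable_powR_norm.
- by apply: measurable_powR_norm; exact: measurable_vnorm.
- move=> y; rewrite lee_fin ge0_ler_powR ?nnegrE//.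
  by rewrite (le_trans (ler_vnorm F i y))// ler_norm.
Qed.

Lemma avg_mono B tau nu p (u v : Z -> R) z : 0 < B -> 0 < tau -> 0 < nu -> 1 <= p ->
  Lpfin p u -> Lpfin p v -> (forall z, `|u z| <= `|v z|) -> avg B tau nu u z <= avg B tau nu v z.
Proof.
move=> B0 tau0 nu0 p1 hu hv uv; apply: le_Rintegral => //.
- exact: (integrable_avg B0 tau0 nu0 z p1 hu).
- exact: (integrable_avg B0 tau0 nu0 z p1 hv).
- by move=> w _; rewrite ler_wpM2r.
Qed.

Variables (p p' : R) (f : Z -> R) (g S : 'I_d -> Z -> R).
Hypotheses (p1 : 1 <= p) (p1' : 1 <= p').
Hypotheses (hf : Lpfin 2 f) (mg : forall i, measurable_fun setT (g i))
  (mS : forall i, measurable_fun setT (S i)).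
Hypotheses (hg : Lpfin p (vnorm g)) (hS : Lpfin p' (vnorm S)).
Hypotheses (wg : weak_grad_v f g) (ke : kinetic_eq f S).
Variables (ct cv B M : R) (K Psi : Z -> R) (Phi : 'I_d -> Z -> R).
Hypotheses (ct0 : 0 < ct) (cv0 : 0 < cv) (B0 : 0 < B) (M0 : 0 < M).
Hypotheses (tK : tens K) (tK' : tens (fun w => K (dil ct^-1 cv^-1 w)))
  (tPsi : tens Psi) (tPhi : forall i, tens (Phi i)).
Hypothesis KE : forall w, K w - (vol d ct cv)^-1 * K (dil ct^-1 cv^-1 w) =
  Ykin Psi w + \sum_(i < d) partial (vidx i) (Phi i) w.
Hypotheses (kPsi : forall i, kbound B M (partial (vidx i) Psi))
  (kPhi : forall i, kbound B M (Phi i)).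

Let p0 : 0 <= p. Proof. exact: le_trans ler01 p1. Qed.
Let p0' : 0 <= p'. Proof. exact: le_trans ler01 p1'. Qed.
Let hgi i : Lpfin p (g i). Proof. exact: Lpfin_component. Qed.
Let hSi i : Lpfin p' (S i). Proof. exact: Lpfin_component. Qed.
Let M12 : 1 <= 2 :> R. Proof. by rewrite ler1n. Qed.

Definition mollify tau nu z := I (fun w => f (act tau nu z w) * K w).

Lemma dilK w : dil ct^-1 cv^-1 (dil ct cv w) = w.
Proof.
apply: eq_from_tnth => j; rewrite !tnth_mktuple mulrA /kscale.
case: (idxP j) => [|i|i]; rewrite !kcaseE -?invfM mulVf ?mul1r ?mulf_neq0 ?lt0r_neq0//.
Qed.

(** By [act_dil] and the Jacobian of [dil], the coarser mollification integrates [f] at the finer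
    scale against the dilated kernel; [KE] then lets the equation in. *)
Lemma mollify_diff tau nu z : 0 < tau -> 0 < nu ->
  mollify tau nu z - mollify (ct * tau) (cv * nu) z =
  tau / nu * \sum_(j < d) I (fun w => S j (act tau nu z w) * partial (vidx j) Psi w)
  - nu * \sum_(i < d) I (fun w => g i (act tau nu z w) * Phi i w).
Proof.
move=> tau0 nu0.
rewrite -(kernel_act p1 p1' hf hgi hSi wg ke z tau0 nu0 tPsi tPhi).
pose G w := f (act tau nu z w) * K (dil ct^-1 cv^-1 w).
have iG : mu.-integrable setT (EFin \o G) by exact: integrable_act_tens hf tK'.
have iK : mu.-integrable setT (EFin \o (fun w => f (act tau nu z w) * K w)).
  exact: integrable_act_tens hf tK.
have vE : mollify (ct * tau) (cv * nu) z = I (fun w => (vol d ct cv)^-1 * G w).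
  rewrite RintegralZl//.
  transitivity (I (fun w => G (dil ct cv w))).
    by apply: eq_Rintegral => w _; rewrite /G dilK act_dil.
  rewrite /Rintegral (integral_change (mu := mu) (phi := dil ct cv) (c := (vol d ct cv)^-1) _ iG).
    rewrite fineM//; exact: integrable_fin_num.
  by move=> h mh h0; rewrite ge0_integral_dil.
have iG' : mu.-integrable setT (EFin \o (fun w => (vol d ct cv)^-1 * G w)).
  have := integrableZl measurableT (vol d ct cv)^-1 iG.
  by apply: eq_integrable => // w _; rewrite /= EFinM.
rewrite vE /mollify -RintegralB//; apply: eq_Rintegral => w _.
by rewrite -KE /G mulrBr; congr (_ - _); rewrite mulrCA.
Qed.

Variable h : d.-tuple R.
Local Notation A2 u tau nu z := (avg B tau nu u z + avg B tau nu u (xshift h z)).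

Let sum_diff_le (c e : R) (F : 'I_d -> R) : (forall i, `|F i| <= e) ->
  0 <= c -> `|c * \sum_(i < d) F i| <= c * (d%:R * e).
Proof.
move=> Fe c0; rewrite normrM (ger0_norm c0) ler_wpM2l//.
rewrite (le_trans (ler_norm_sum _ _ _))// (le_trans (ler_sum _ (fun i _ => Fe i)))//.
by rewrite sumr_const card_ord mulr_natl.
Qed.

Definition mollify_shift tau nu z := mollify tau nu (xshift h z) - mollify tau nu z.

Lemma mollify_shift_step tau nu z : 0 < tau -> 0 < nu ->
  `|mollify_shift tau nu z - mollify_shift (ct * tau) (cv * nu) z| <=
  tau / nu * (d%:R * (M * Num.min 1 (eucl h / (tau * nu)) * A2 (vnorm S) tau nu z)) +
  nu * (d%:R * (M * Num.min 1 (eucl h / (tau * nu)) * A2 (vnorm g) tau nu z)).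
Proof.
move=> tau0 nu0; set m := Num.min _ _.
have m0 : 0 <= m.
  by rewrite le_min ler01 divr_ge0 ?sqrtr_ge0// mulr_ge0 ?(ltW tau0) ?(ltW nu0).
have vn n (F : 'I_d -> n.-tuple R -> R) y i : `|F i y| <= `|vnorm F y|.
  by rewrite (le_trans (ler_vnorm F i y))// ler_norm.
rewrite (_ : _ - _ = (mollify tau nu (xshift h z) - mollify (ct * tau) (cv * nu) (xshift h z)) -
   (mollify tau nu z - mollify (ct * tau) (cv * nu) z)); last first.
  by rewrite /mollify_shift; ring.
rewrite !mollify_diff//.
set a1 := \sum_(j < d) _; set b1 := \sum_(j < d) _; set a2 := \sum_(j < d) _.
set b2 := \sum_(j < d) _.
rewrite (_ : _ - _ = tau / nu * (a1 - a2) - nu * (b1 - b2)); last by ring.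
rewrite (le_trans (ler_normB _ _))// /a1 /a2 /b1 /b2 -!sumrB lerD//.
  apply: sum_diff_le => [i|]; last by rewrite divr_ge0 ?(ltW tau0) ?(ltW nu0).
  apply: (le_trans (Rintegral_shift_min h z B0 M0 tau0 nu0 p1' (hSi i) (kPsi i))).
  rewrite ler_wpM2l//; first by rewrite mulr_ge0 ?(ltW M0).
  by rewrite lerD//; apply: (avg_mono _ B0 tau0 nu0 p1' (hSi i) hS) => y; exact: vn.
apply: sum_diff_le => [i|]; last exact: ltW.
apply: (le_trans (Rintegral_shift_min h z B0 M0 tau0 nu0 p1 (hgi i) (kPhi i))).
rewrite ler_wpM2l//; first by rewrite mulr_ge0 ?(ltW M0).
by rewrite lerD//; apply: (avg_mono _ B0 tau0 nu0 p1 (hgi i) hg) => y; exact: vn.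
Qed.

Variables (q X Y : R).
Hypotheses (q1 : 1 <= q) (pq : p < q) (pq' : p' < q) (X0 : 0 <= X) (Y0 : 0 <= Y).
Hypothesis gX : (\int[mu]_z ((`|vnorm g z|) `^ p)%:E = (X `^ p)%:E)%E.
Hypothesis SY : (\int[mu]_z ((`|vnorm S z|) `^ p')%:E = (Y `^ p')%:E)%E.

Lemma Nle_xshift (F : Z -> R) c : Nle mu q F c -> Nle mu q (fun z => F (xshift h z)) c.
Proof.
move=> [mF c0 H]; split; [|exact: c0|].
  by apply: (measurableT_comp mF); exact: measurable_xshift.
have mP := measurable_powR_norm q mF.
rewrite (ge0_integral_xshift h mP)// => z; by rewrite lee_fin powR_ge0.
Qed.

Lemma Nle_avg p2 (u : Z -> R) c tau nu : 0 < tau -> 0 < nu -> 1 <= p2 -> p2 < q -> 0 <= c ->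
  Lpfin p2 u -> (\int[mu]_z ((`|u z|) `^ p2)%:E = (c `^ p2)%:E)%E ->
  Nle mu q (fun z => A2 u tau nu z)
   (2 * (((2 * B) ^+ (1 + d + d)) `^ (1 - p2^-1 + q^-1) * vol d tau nu `^ (- (p2^-1 - q^-1)) * c)).
Proof.
move=> tau0 nu0 p21 p2q c0 hu uc.
have N : Nle mu q (avg B tau nu u)
    (((2 * B) ^+ (1 + d + d)) `^ (1 - p2^-1 + q^-1) * vol d tau nu `^ (- (p2^-1 - q^-1)) * c).
  split.
  - exact: measurable_avg hu.1.
  - by rewrite !mulr_ge0// powR_ge0.
  - under eq_integral => z _ do rewrite ger0_norm ?avg_ge0//.
    exact: (integral_avg_young B0 tau0 nu0 p21 c0 hu uc p2q).
rewrite mulr_natl mulr2n; apply: (Nle_add q1 N); exact: Nle_xshift.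
Qed.

Lemma measurable_mollify_shift tau nu : measurable_fun setT (mollify_shift tau nu).
Proof.
have mU : measurable_fun setT (mollify tau nu).
  apply: (measurableT_comp (fine_measurable measurableT)).
  apply: (@measurable_integral_param _ _ _ _ _ mu
    (fun y : Z * Z => (f (act tau nu y.1 y.2) * K y.2)%:E)).
  apply/measurable_EFinP; apply: measurable_funM.
    by apply: (measurableT_comp hf.1); exact: measurable_act.
  exact: (measurableT_comp (tens_measurable tK) measurable_snd).
by apply: measurable_funB => //; apply: (measurableT_comp mU); exact: measurable_xshift.
Qed.

(** The 2 counts the averages at [z] and at its translate, [d] the components; adding the two box
    powers gives one constant for both terms. *)
Definition step_cst := 2 * (d%:R * M) * (((2 * B) ^+ (1 + d + d)) `^ (1 - p'^-1 + q^-1)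
  + ((2 * B) ^+ (1 + d + d)) `^ (1 - p^-1 + q^-1)).

Lemma Nle_step tau nu : 0 < tau -> 0 < nu ->
  Nle mu q (fun z => mollify_shift tau nu z - mollify_shift (ct * tau) (cv * nu) z)
   (step_cst * Num.min 1 (eucl h / (tau * nu)) *
    (tau / nu * vol d tau nu `^ (- (p'^-1 - q^-1)) * Y + nu * vol d tau nu `^ (- (p^-1 - q^-1)) * X)).
Proof.
move=> tau0 nu0; set m := Num.min _ _.
have m0 : 0 <= m.
  by rewrite le_min ler01 divr_ge0 ?sqrtr_ge0// mulr_ge0 ?(ltW tau0) ?(ltW nu0).
have tn0 : 0 <= tau / nu by rewrite divr_ge0 ?(ltW tau0) ?(ltW nu0).
have dMm0 : 0 <= d%:R * (M * m) by rewrite !mulr_ge0// ltW.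
have N1 := Nle_scale (m := mu) (mulr_ge0 tn0 dMm0) (Nle_avg tau0 nu0 p1' pq' Y0 hS SY).
have N2 := Nle_scale (m := mu) (mulr_ge0 (ltW nu0) dMm0) (Nle_avg tau0 nu0 p1 pq X0 hg gX).
have N := Nle_add q1 N1 N2.
apply: Nle_weaken (Nle_mono q1 _ _ N) => //.
- rewrite /step_cst; set b1 := _ `^ (1 - p'^-1 + _); set b2 := _ `^ (1 - p^-1 + _).
  move: (powR_ge0 ((2 * B) ^+ (1 + d + d)) (1 - p'^-1 + q^-1)).
  move: (powR_ge0 ((2 * B) ^+ (1 + d + d)) (1 - p^-1 + q^-1)).
  rewrite -/b1 -/b2 => b20 b10.
  have v10 := powR_ge0 (vol d tau nu) (- (p'^-1 - q^-1)).
  have v20 := powR_ge0 (vol d tau nu) (- (p^-1 - q^-1)).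
  set v1 := _ `^ (- (p'^-1 - _)) in v10 *; set v2 := _ `^ (- (p^-1 - _)) in v20 *.
  have E1 : 0 <= 2 * (d%:R * M) * b2 * m * (tau / nu * v1 * Y).
    by rewrite !mulr_ge0 ?invr_ge0 ?(ltW tau0) ?(ltW nu0) ?(ltW M0).
  have E2 : 0 <= 2 * (d%:R * M) * b1 * m * (nu * v2 * X).
    by rewrite !mulr_ge0 ?invr_ge0 ?(ltW tau0) ?(ltW nu0) ?(ltW M0).
  rewrite -subr_ge0; apply: le_trans (addr_ge0 E1 E2) _.
  rewrite le_eqVlt; apply/orP; left; apply/eqP; ring.
- by apply: measurable_funB; exact: measurable_mollify_shift.
- move=> z; rewrite [leRHS]ger0_norm; last first.
    apply: addr_ge0; apply: mulr_ge0; rewrite ?addr_ge0 ?avg_ge0//.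
      exact: mulr_ge0.
    by apply: mulr_ge0 => //; exact: ltW.
  apply: (le_trans (mollify_shift_step z tau0 nu0)); rewrite -/m.
  rewrite le_eqVlt; apply/orP; left; apply/eqP; ring.
Qed.

End scale_step.

(** * Passage to the limit at both ends of the scales *)

Section passage_to_limit.
Variables (R : realType) (d : nat).
Local Notation Z := ((1 + d + d).-tuple R).
Local Notation mu := (lebn R (1 + d + d)).
Local Notation I u := (Rintegral mu setT u).
Implicit Types z w : Z.

Lemma Lpfin_norm p (u : Z -> R) : 0 < p -> Lpfin p u ->
  exists2 Y, 0 <= Y & (\int[mu]_z ((`|u z|) `^ p)%:E = (Y `^ p)%:E)%E.
Proof.
move=> p0 [_ H]; set J := (\int[mu]_z _)%E in H *.
have J0 : (0 <= J)%E by apply: integral_ge0 => z _; rewrite lee_fin powR_ge0.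
exists (fine J `^ p^-1); first exact: powR_ge0.
rewrite -powRrM mulVf ?lt0r_neq0// powRr1 ?fine_ge0// fineK//.
by rewrite ge0_fin_numE.
Qed.

Lemma Lpfin_Delta h (f : Z -> R) : Lpfin 2 f -> Lpfin 2 (Delta_x h f).
Proof.
move=> hf; have M12 : 1 <= 2 :> R by rewrite ler1n.
have [Y Y0 fY] := Lpfin_norm (ltr0Sn R 1) hf.
have N : Nle mu 2 f Y by split; [exact: hf.1|exact: Y0|rewrite fY].
have N' : Nle mu 2 (fun z => - f z) Y.
  apply: (Nle_mono M12 _ _ N); first by apply: measurable_funN; exact: hf.1.
  by move=> z; rewrite normrN.
have [mD _ H] := Nle_add M12 (Nle_xshift h N) N'.
by split; [exact: mD|apply: le_lt_trans H _; rewrite ltry].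
Qed.

Lemma integral_exhaustion (F : Z -> \bar R) (A : nat -> set Z) c :
  (forall n, measurable (A n)) -> nondecreasing_seq A -> (forall z, exists n, A n z) ->
  measurable_fun setT F -> (forall z, 0 <= F z)%E ->
  (forall n, \int[mu]_(z in A n) F z <= c)%E -> (\int[mu]_z F z <= c)%E.
Proof.
move=> mA ndA AT mF F0 H.
have E : \bigcup_n A n = setT.
  by apply/seteqP; split => // z _; have [n An] := AT z; exists n.
have := ge0_nondecreasing_set_cvg_integral (mu := mu) (f := F) ndA mA
  (fun i => measurable_funTS mF) (fun _ z _ => F0 z).
rewrite E => C; rewrite -(cvg_lim _ C)//; apply: lime_le; first by apply/cvg_ex; eexists; exact: C.
exact: nearW.
Qed.

Variables (f K : Z -> R) (h : d.-tuple R).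
Hypotheses (tK : tens K) (K0 : forall w, 0 <= K w) (K1 : (\int[mu]_w (K w)%:E = 1)%E).
Hypothesis hf : Lpfin 2 f.
Let M12 : 1 <= 2 :> R. Proof. by rewrite ler1n. Qed.

(** The bound [avg_le] with exponent 2: square integrability of [f] makes coarse scales decay
    uniformly in [z]. *)
Lemma mollify_tail : exists2 c, 0 < c & forall tau nu z, 0 < tau -> 0 < nu ->
  `|mollify_shift f K h tau nu z| <= c * vol d tau nu `^ (- 2^-1).
Proof.
have [B [M [B0 M0 kK]]] := tens_kbound tK.
have [Y Y0 fY] := Lpfin_norm (ltr0Sn R 1) hf.
(* The [+ 1] keeps the constant positive when [Y = 0]. *)
exists (2 * M * (((2 * B) ^+ (1 + d + d)) `^ (1 - 2^-1) * Y + 1)).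
  by rewrite !mulr_gt0// ltr_wpDl// mulr_ge0// powR_ge0.
move=> tau nu z tau0 nu0; set v := vol _ _ _ `^ _.
have v0 : 0 <= v by exact: powR_ge0.
have H y : `|mollify f K tau nu y| <= M * (((2 * B) ^+ (1 + d + d)) `^ (1 - 2^-1) * Y + 1) * v.
  apply: (le_trans (Rintegral_kbound y B0 M0 tau0 nu0 M12 hf kK)).
  rewrite -mulrA ler_wpM2l ?(ltW M0)//.
  apply: (le_trans (avg_le B0 tau0 nu0 M12 Y0 hf fY y)).
  by rewrite -/v mulrAC ler_wpM2r// lerDl.
rewrite (le_trans (ler_normB _ _))// (le_trans (lerD (H _) (H _)))//.
by rewrite -mulr2n -[leLHS]mulr_natl !mulrA.
Qed.

Lemma mollify_shiftE tau nu z : 0 < tau -> 0 < nu ->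
  mollify_shift f K h tau nu z = I (fun w => Delta_x h f (act tau nu z w) * K w).
Proof.
move=> tau0 nu0; have [B [M [B0 M0 kK]]] := tens_kbound tK.
rewrite /mollify_shift /mollify -RintegralB//.
- by apply: eq_Rintegral => w _; rewrite act_xshift -mulrBl.
- exact: (integrable_kbound _ B0 M0 tau0 nu0 M12 hf kK).
- exact: (integrable_kbound _ B0 M0 tau0 nu0 M12 hf kK).
Qed.

Variables (ct cv q b : R).
Hypotheses (ct1 : 1 < ct) (cv1 : 1 < cv) (q1 : 1 <= q).
Hypothesis Hb : forall dl, 0 < dl -> exists tau nu, [/\ 0 < tau <= dl, 0 < nu <= dl &
  forall n, Nle mu q (fun z => mollify_shift f K h tau nu z -
    mollify_shift f K h (ct ^+ n * tau) (cv ^+ n * nu) z) b].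

Let ct0 : 0 < ct. Proof. exact: lt_trans ltr01 ct1. Qed.
Let cv0 : 0 < cv. Proof. exact: lt_trans ltr01 cv1. Qed.
Let q0 : 0 < q. Proof. exact: lt_le_trans ltr01 q1. Qed.
(** The decay factor of the tail over one scale step. *)
Let x := vol d ct cv `^ (- 2^-1).

Let x_lt1 : `|x| < 1.
Proof.
rewrite /x ger0_norm ?powR_ge0//.
have v1 : 1 < vol d ct cv.
  apply: (lt_le_trans ct1); rewrite /vol -mulrA ler_peMr ?(ltW ct0)//.
  by rewrite mulr_ege1// exprn_ege1// ?mulr_ege1// ltW.
rewrite powRN invf_lt1 ?powR_gt0 ?(lt_trans ltr01 v1)//.
by rewrite -[ltLHS](congr1 (@^~ 2^-1) (powR1 R)) gt0_ltr_powR ?nnegrE ?(ltW (lt_trans ltr01 v1)).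
Qed.

Let volX n tau nu : 0 < tau -> 0 < nu ->
  vol d (ct ^+ n * tau) (cv ^+ n * nu) `^ (- 2^-1) = x ^+ n * vol d tau nu `^ (- 2^-1).
Proof.
move=> tau0 nu0; have -> : vol d (ct ^+ n * tau) (cv ^+ n * nu) = vol d ct cv ^+ n * vol d tau nu.
  rewrite /vol !exprMn -!exprM [(n * d)%N]mulnC !exprM; ring.
rewrite powRM ?exprn_ge0 ?ltW ?vol_gt0//; congr (_ * _).
rewrite -[RHS]powR_mulrn ?powR_ge0// /x -powRrM [_ * n%:R]mulrC powRrM powR_mulrn//.
by rewrite ltW ?vol_gt0.
Qed.

Let tail_small tau nu e : 0 < tau -> 0 < nu -> 0 < e -> exists n, forall z,
  `|mollify_shift f K h (ct ^+ n * tau) (cv ^+ n * nu) z| <= e.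
Proof.
move=> tau0 nu0 e0; have [c c0 Hc] := mollify_tail.
have v0 : 0 < vol d tau nu `^ (- 2^-1) by rewrite powR_gt0 ?vol_gt0.
have cv0' : 0 < c * vol d tau nu `^ (- 2^-1) by exact: mulr_gt0.
have /cvgrPdist_le/(_ _ (divr_gt0 e0 cv0'))[n _ /(_ n (leqnn n))] := cvg_expr x_lt1.
rewrite sub0r normrN => Hn; exists n => z.
apply: (le_trans (Hc _ _ z _ _)); rewrite ?mulr_gt0 ?exprn_gt0//.
rewrite volX// mulrCA -ler_pdivlMr//; exact: le_trans (ler_norm _) Hn.
Qed.

Variable b' : R.
Hypothesis bb' : b < b'.
Local Notation u := (Delta_x h f).

Let hu : Lpfin 2 u. Proof. exact: Lpfin_Delta. Qed.

Let A (n : nat) : set Z := box n.+1%:R `&` [set z | `|u z| <= n.+1%:R].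

Let mA n : measurable (A n).
Proof.
apply: measurableI; first exact: measurable_box.
rewrite -[X in measurable X]setTI.
have mf : measurable_fun setT (fun z => `|u z|) by apply: measurableT_comp => //; exact: hu.1.
have := mf measurableT [set` `]-oo, (n.+1%:R : R)]] (measurable_itv `]-oo, (n.+1%:R : R)]).
rewrite !setTI; congr measurable; apply/seteqP; split => z /=; by rewrite in_itv.
Qed.

(* On A n, |u|^q <= |W|^q + q |u|^(q-1) (|u| - |W|) with |u| bounded, so the L^1_loc
   convergence of W to u suffices to pass to the limit. *)
Let local_bound n : (\int[mu]_(z in A n) ((`|u z|) `^ q)%:E <= (b' `^ q)%:E)%E.
Proof.
pose M : R := n.+1%:R; have M0 : 0 < M by rewrite ltr0n.
apply/lee_addgt0Pr => e e0.
have k0 : 0 < q * M `^ (q - 1) by rewrite mulr_gt0// powR_gt0.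
have [dl dl0 Hdl] := convolution_cvg tK K0 K1 hu M0 (divr_gt0 e0 k0).
have [tau [nu [/andP[tau0 taud] /andP[nu0 nud] HN]]] := Hb dl0.
have := Hdl _ _ tau0 taud nu0 nud => {}Hdl.
pose W z := mollify_shift f K h tau nu z.
have mW : measurable_fun setT W by exact: measurable_mollify_shift.
pose D : R := (2 * M) ^+ (1 + d + d); have D0 : 0 < D by rewrite exprn_gt0// mulr_gt0.
have r0 : 0 < D `^ q^-1 by rewrite powR_gt0.
(* On the box, of measure [D], a function bounded by [(b' - b) / D^(1/q)] has norm at most [b' - b]:
   the slack is spent on the coarse tail. *)
have [N tailN] := tail_small tau0 nu0 (divr_gt0 (eqbRL (subr_gt0 _ _) bb') r0).
set eps := (b' - b) / _ in tailN.
have eps0 : 0 < eps by rewrite divr_gt0// subr_gt0.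
have mB : measurable_fun setT (\1_(box M) : Z -> R).
  by apply: measurable_indic; exact: measurable_box.
have NB : Nle mu q (fun z => eps * \1_(box M) z) (eps * D `^ q^-1).
  apply: (Nle_scale (ltW eps0)); split; [exact: mB|exact: powR_ge0|].
  rewrite -powRrM mulVf ?lt0r_neq0// powRr1 ?(ltW D0)//.
  have -> : (D%:E = \int[mu]_z (\1_(box M) z)%:E)%E.
    by rewrite integral_indic ?setIT ?lebn_box//; exact: measurable_box.
  rewrite le_eqVlt; apply/orP; left; apply/eqP; apply: eq_integral => z _.
  rewrite indicE; case: (z \in box M); first by rewrite normr1 powR1.
  by rewrite normr0 powR0// lt0r_neq0.
have NW : Nle mu q (fun z => W z * \1_(box M) z) b'.
  have N1 : Nle mu q (fun z => `|W z - mollify_shift f K h (ct ^+ N * tau) (cv ^+ N * nu) z|) b.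
    apply: (Nle_mono q1 _ _ (HN N)); last by move=> z; rewrite normr_id.
    apply: measurableT_comp => //; apply: measurable_funB => //.
    exact: measurable_mollify_shift.
  have := Nle_add q1 N1 NB; rewrite /eps divfK ?lt0r_neq0// subrKC.
  apply: Nle_mono => //; first exact: measurable_funM.
  move=> z; rewrite [leRHS]ger0_norm; last first.
    by rewrite addr_ge0// mulr_ge0// divr_ge0 ?(ltW r0)// subr_ge0 ltW.
  rewrite indicE; case: (z \in box M); last by rewrite !mulr0 addr0 normr0.
  rewrite !mulr1 -[W z in leLHS](subrK (mollify_shift f K h (ct ^+ N * tau) (cv ^+ N * nu) z)).
  by rewrite (le_trans (ler_normD _ _))// lerD2l tailN.
have [_ _ HW] := NW.
have b'0 : 0 <= b'.
  by have [_ b0 _] := HN 0; exact: le_trans b0 (ltW bb').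
have mP : measurable_fun setT (fun z => (`|W z * \1_(box M) z| `^ q)%:E).
  by apply: measurable_powR_norm; exact: measurable_funM.
have mQ : measurable_fun setT (fun z => (`|W z - u z| * \1_(box M) z)%:E).
  apply/measurable_EFinP; apply: measurable_funM => //.
  by apply: measurableT_comp => //; apply: measurable_funB => //; exact: hu.1.
have {}Hdl : (\int[mu]_z (`|W z - u z| * \1_(box M) z)%:E <= (e / (q * M `^ (q - 1)))%:E)%E.
  apply: le_trans Hdl; rewrite le_eqVlt; apply/orP; left; apply/eqP.
  by apply: eq_integral => z _; rewrite /W mollify_shiftE.
apply: (@le_trans _ _ (\int[mu]_z ((`|W z * \1_(box M) z| `^ q)%:E +
   (q * M `^ (q - 1))%:E * (`|W z - u z| * \1_(box M) z)%:E))%E).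
  rewrite integral_mkcond; apply: ge0_le_integralT.
  - by move=> z; rewrite patchE; case: ifPn => // _; rewrite lee_fin powR_ge0.
  - apply/(measurable_restrictT _ (mA n)); apply: measurable_funTS.
    by apply: measurable_powR_norm; exact: hu.1.
  - by apply: emeasurable_funD => //; exact: measurable_funeM.
  move=> z; rewrite patchE; case: ifPn => [/set_mem[zB zu]|_]; last first.
    by rewrite -EFinM -EFinD lee_fin addr_ge0 ?powR_ge0// mulr_ge0 ?(ltW k0)// mulr_ge0.
  rewrite -EFinM -EFinD lee_fin !indicE mem_set// !mulr1.
  apply: (le_trans (powR_tangent_le q1 (normr_ge0 (u z)) (normr_ge0 (W z)))).
  rewrite lerD2l; apply: (@le_trans _ _ (q * `|u z| `^ (q - 1) * `|W z - u z|)).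
    rewrite ler_wpM2l//; first by rewrite mulr_ge0 ?powR_ge0 ?(ltW q0).
    by rewrite [leRHS]distrC; exact: lerB_dist.
  rewrite ler_wpM2r// ler_wpM2l ?(ltW q0)// ge0_ler_powR ?nnegrE ?subr_ge0//.
rewrite ge0_integralD//; last 2 first.
- by move=> z _; rewrite -EFinM lee_fin mulr_ge0 ?(ltW k0)// mulr_ge0.
- exact: measurable_funeM.
apply: leeD => //; rewrite (ge0_integralZT mu (ltW k0) mQ); last first.
  by move=> z; rewrite lee_fin mulr_ge0.
apply: (@le_trans _ _ ((q * M `^ (q - 1))%:E * (e / (q * M `^ (q - 1)))%:E)%E).
  by rewrite lee_wpmul2l ?lee_fin ?(ltW k0).
by rewrite -EFinM lee_fin mulrC divfK// lt0r_neq0.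
Qed.

(** [local_bound] is uniform in [n], and the sets [A n] increase to the whole space. *)
Lemma Delta_le : (\int[mu]_z ((`|u z|) `^ q)%:E <= (b' `^ q)%:E)%E.
Proof.
apply: (integral_exhaustion (A := A)).
- exact: mA.
- move=> m n mn; apply/subsetPset => z [zB zu].
  have mnR : m.+1%:R <= n.+1%:R :> R by rewrite ler_nat.
  by split => [j|]; [exact: le_trans (zB j) mnR|exact: le_trans zu mnR].
- move=> z; pose c := `|u z| + \sum_j `|tnth z j|.
  have c0 : 0 <= c by rewrite addr_ge0// sumr_ge0.
  exists (Num.truncn c); have H : c <= (Num.truncn c).+1%:R.
    by rewrite ltW// truncnS_gt.
  split => [j|]; apply: le_trans H; last by rewrite lerDl sumr_ge0.
  by rewrite /c (bigD1 j)//= addrCA lerDl; apply: addr_ge0 => //; apply: sumr_ge0.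
- exact: (measurable_powR_norm q hu.1).
- by move=> z; rewrite lee_fin powR_ge0.
- exact: local_bound.
Qed.

End passage_to_limit.

(** * Summation over dyadic scales *)

Section two_sided_geometric.
Variable R : realType.

(** [J] will index the scale [|h|]. The bound is uniform in [J] and [n], as required when the finest
    scale tends to zero and the coarsest to infinity. *)
Lemma two_sided_geometric (x y : R) (J : nat) (t : nat -> R) : 1 < x -> 0 <= y < 1 ->
  (forall k, t k <= x ^+ k / x ^+ J) -> (forall m, t (J + m)%N <= y ^+ m) ->
  forall n, \sum_(k < n) t k <= (x - 1)^-1 + (1 - y)^-1.
Proof.
move=> x1 /andP[y0 y1] tx ty n.
have x0 : 0 < x by exact: lt_trans ltr01 x1.
have x10 : 0 < x - 1 by rewrite subr_gt0.
have y10 : 0 < 1 - y by rewrite subr_gt0.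
have low m : \sum_(k < m) t k <= x ^+ m / x ^+ J / (x - 1).
  elim: m => [|m ih]; first by rewrite big_ord0 !mulr_ge0 ?invr_ge0 ?exprn_ge0 ?(ltW x0) ?(ltW x10).
  rewrite big_ord_recr/= (le_trans (lerD ih (tx m)))// le_eqVlt; apply/orP; left; apply/eqP.
  by rewrite exprS; field; rewrite !lt0r_neq0 ?exprn_gt0.
have high m : \sum_(k < (J + m)%N) t k <= (x - 1)^-1 + (1 - y ^+ m) / (1 - y).
  elim: m => [|m ih].
    rewrite addn0 expr0 subrr mul0r addr0 (le_trans (low J))// divff ?mul1r//.
    by rewrite lt0r_neq0// exprn_gt0.
  rewrite addnS big_ord_recr/= (le_trans (lerD ih (ty m)))// le_eqVlt.
  by apply/orP; left; apply/eqP; rewrite exprS; field; rewrite !lt0r_neq0.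
have [nJ|Jn] := leqP n J.
  apply: (le_trans (low n)); rewrite -[leLHS]addr0 lerD ?invr_ge0 ?(ltW y10)//.
  rewrite ler_piMl ?invr_ge0 ?(ltW x10)// ler_pdivrMr ?exprn_gt0// mul1r.
  by rewrite ler_weXn2l// ltW.
rewrite -(subnKC (ltnW Jn)) (le_trans (high _))// lerD2l ler_piMl ?invr_ge0 ?(ltW y10)//.
by rewrite gerBl exprn_ge0.
Qed.

End two_sided_geometric.

Section scales.
Variables (R : realType) (d : nat) (p p' q th s : R).
Local Notation Z := ((1 + d + d).-tuple R).
Local Notation mu := (lebn R (1 + d + d)).
(** The exponent of [r] in [vol] when [tau = r^(1 - th)] and [nu = r^th], namely
    [(1 - th) (1 + d) + 2 d th]. *)
Let kap : R := 1 + d%:R - th + th * d%:R.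
Hypotheses (th01 : 0 < th < 1) (s01 : 0 < s < 1).
Hypotheses (p1 : 1 <= p) (p1' : 1 <= p') (pq : p < q) (pq' : p' < q).
Hypothesis sE : th - (p^-1 - q^-1) * kap = s.
Hypothesis sE' : 1 - 2 * th - (p'^-1 - q^-1) * kap = s.
(** [A1] and [- A2] are the exponents of [e^l] in the contributions of [grad_v f] and of [S_0]: [nu]
    gives 1, [tau / nu] gives -2, and the volume gives [d - 1] inside its power. *)
Let A1 : R := 1 - (d%:R - 1) * (p^-1 - q^-1).
Let A2 : R := 2 + (d%:R - 1) * (p'^-1 - q^-1).

(* The scale r = e^a has tau nu = r; the exponent th makes the transport term and the
   diffusion term of a step both grow like r^s, and l is left free for interpolation. *)
Let tau (l a : R) := expR ((1 - th) * a - l).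
Let nu (l a : R) := expR (l + th * a).

Let tau_nu l a : tau l a * nu l a = expR a.
Proof. by rewrite -expRD; congr expR; ring. Qed.

Let volE l a : vol d (tau l a) (nu l a) = expR ((d%:R - 1) * l + kap * a).
Proof.
rewrite /vol tau_nu -!expRM_natl -!expRD; congr expR; rewrite /kap; ring.
Qed.

Let nu_vol l a : nu l a * vol d (tau l a) (nu l a) `^ (- (p^-1 - q^-1)) =
  expR (A1 * l) * expR (s * a).
Proof. by rewrite volE -expRM -!expRD; congr expR; rewrite -sE /A1; ring. Qed.

Let tau_vol l a : tau l a / nu l a * vol d (tau l a) (nu l a) `^ (- (p'^-1 - q^-1)) =
  expR (- A2 * l) * expR (s * a).
Proof.
rewrite volE -expRM -[(nu l a)^-1]expRN -!expRD; congr expR; rewrite -sE' /A2; ring.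
Qed.

Let ln2 : 0 < ln (2 : R). Proof. by rewrite ln_gt0// ltr1n. Qed.

Let scale_step n l a : (expR ((1 - th) * ln 2)) ^+ n * tau l a = tau l (a + n%:R * ln 2) /\
  (expR (th * ln 2)) ^+ n * nu l a = nu l (a + n%:R * ln 2).
Proof. by split; rewrite -expRM_natl -expRD; congr expR; ring. Qed.

(** [C] is fixed before [l], so that [l] can later be adapted to the two norms; the strict
    inequality below [b] is the slack required by [Delta_le]. *)
Lemma Delta_scale_bound : exists2 C : R, 0 < C &
  forall (f : Z -> R) (g S : 'I_d -> Z -> R) (X Y : R) (h : d.-tuple R) (l b : R),
  Lpfin 2 f -> (forall i, measurable_fun setT (g i)) ->
  (forall i, measurable_fun setT (S i)) ->
  Lpfin p (vnorm g) -> Lpfin p' (vnorm S) -> weak_grad_v f g -> kinetic_eq f S ->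
  0 <= X -> 0 <= Y -> (\int[mu]_z ((`|vnorm g z|) `^ p)%:E = (X `^ p)%:E)%E ->
  (\int[mu]_z ((`|vnorm S z|) `^ p')%:E = (Y `^ p')%:E)%E ->
  0 < eucl h ->
  C * eucl h `^ s * (expR (A1 * l) * X + expR (- A2 * l) * Y) < b ->
  (\int[mu]_z ((`|Delta_x h f z|) `^ q)%:E <= (b `^ q)%:E)%E.
Proof.
have /andP[th0 th1] := th01; have /andP[s0 s1] := s01.
have q1 : 1 <= q by rewrite ltW// (le_lt_trans p1).
(* The ratios [2^(1 - th)] and [2^th] multiply to 2: each step doubles [tau nu]. *)
have ct1 : 1 < expR ((1 - th) * ln 2) by rewrite expR_gt1 mulr_gt0// subr_gt0.
have cv1 : 1 < expR (th * ln 2) by rewrite expR_gt1 mulr_gt0.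
have ct0 := lt_trans ltr01 ct1; have cv0 := lt_trans ltr01 cv1.
have [K [Psi [Phi [[tK tK' K0 K1] tPsi tPhi KE]]]] := kernel_exists d ct0 cv0.
have [B1 [N1 [B10 N10 kP]]] := tens_kbound_family (fun j => (tens_partial tPsi).1 (vidx j)).
have [B2 [N2 [B20 N20 kQ]]] := tens_kbound_family tPhi.
pose B := B1 + B2; pose M := N1 + N2.
have B0 : 0 < B by exact: addr_gt0.
have M0 : 0 < M by exact: addr_gt0.
have kPsi i : kbound B M (partial (vidx i) Psi).
  by apply: kbound_weaken (kP i); rewrite ?lerDl ltW.
have kPhi i : kbound B M (Phi i).
  by apply: kbound_weaken (kQ i); rewrite ?lerDr ltW.
(* [2^s] and [2^(s - 1)]: the growth per step below and above [|h|]. The first exceeds 1 since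
   [s > 0], the second is below 1 since [s < 1]. *)
pose x := expR (s * ln 2); pose y := expR (- (1 - s) * ln 2).
have x1 : 1 < x by rewrite expR_gt1 mulr_gt0.
have y01 : 0 <= y < 1.
  by rewrite expR_ge0 expR_lt1 mulNr oppr_lt0 mulr_gt0// subr_gt0.
pose G := (x - 1)^-1 + (1 - y)^-1.
have G0 : 0 < G by rewrite addr_gt0// invr_gt0 subr_gt0//; case/andP: y01.
pose c := step_cst d p p' B M q.
have c0 : 0 <= c.
  rewrite /c /step_cst; apply: mulr_ge0; last by apply: addr_ge0; exact: powR_ge0.
  by apply: mulr_ge0 => //; apply: mulr_ge0 => //; exact: ltW.
have cG0 : 0 <= c * G by rewrite mulr_ge0 ?(ltW G0).
(* The [+ 1] is there because [c] is only known to be nonnegative. *)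
exists (c * G + 1); first by rewrite ltr_wpDl.
move=> f g S X Y h l b hf mg mS hg hS wg ke X0 Y0 gX SY h0 Hb.
set E := expR _ * X + _ in Hb.
have E0 : 0 <= E by rewrite addr_ge0// mulr_ge0// expR_ge0.
have es0 := powR_ge0 (eucl h) s.
apply: (@Delta_le _ _ f K h tK K0 K1 hf _ _ q (c * G * eucl h `^ s * E) ct1 cv1 q1); last first.
  apply: le_lt_trans Hb; rewrite ler_wpM2r// ler_wpM2r//.
  by rewrite lerDl.
move=> dl dl0.
have [J [Jt Jn]] : exists J : nat, tau l (ln (eucl h) - J%:R * ln 2) <= dl /\
    nu l (ln (eucl h) - J%:R * ln 2) <= dl.
  (* [r1] and [r2] are the real values of [J] at which [tau] and [nu] equal [dl]. *)
  pose r1 := ((1 - th) * ln (eucl h) - l - ln dl) / ((1 - th) * ln 2).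
  pose r2 := (l + th * ln (eucl h) - ln dl) / (th * ln 2).
  exists (Num.truncn (`|r1| + `|r2|)).+1; set J := _.+1.
  have HJ : `|r1| + `|r2| <= J%:R by rewrite ltW// truncnS_gt.
  have J1 : r1 <= J%:R.
    by rewrite (le_trans _ HJ)// (le_trans (ler_norm _))// lerDl.
  have J2 : r2 <= J%:R.
    by rewrite (le_trans _ HJ)// (le_trans (ler_norm _))// lerDr.
  rewrite ler_pdivrMr in J1; last by rewrite mulr_gt0// subr_gt0.
  rewrite ler_pdivrMr in J2; last by rewrite mulr_gt0.
  rewrite -(lnK (x := dl)) ?posrE// !ler_expR; split; lra.
(* Starting [J] halvings below [|h|] puts step [J] exactly at [tau nu = |h|], where the two regimes
   of the minimum meet. *)
pose a := ln (eucl h) - J%:R * ln 2.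
exists (tau l a), (nu l a); split; rewrite ?expR_gt0//.
move=> n; have [-> ->] := scale_step n l a.
pose a_ (k : nat) := a + k%:R * ln 2.
pose W k z := mollify_shift f K h (tau l (a_ k)) (nu l (a_ k)) z.
have stepN k : Nle mu q (fun z => W k z - W k.+1 z)
    (c * E * (Num.min 1 (eucl h / expR (a_ k)) * expR (s * a_ k))).
  have t0 : 0 < tau l (a_ k) by exact: expR_gt0.
  have n0 : 0 < nu l (a_ k) by exact: expR_gt0.
  have := Nle_step p1 p1' hf mg mS hg hS wg ke ct0 cv0 B0 M0 tK tK' tPsi tPhi KE kPsi kPhi
    h q1 pq pq' X0 Y0 gX SY t0 n0.
  have [E1 E2] := scale_step 1 l (a_ k); rewrite !expr1 in E1 E2.
  rewrite E1 E2 tau_nu tau_vol nu_vol /W.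
  have -> : a_ k.+1 = a_ k + 1%:R * ln 2 by rewrite /a_ -natr1; ring.
  apply: Nle_weaken => //; rewrite /E le_eqVlt; apply/orP; left; apply/eqP.
  by rewrite /c; ring.
have tele z m : W 0 z - W m z = \sum_(k < m) (W k z - W k.+1 z).
  elim: m => [|m ih]; first by rewrite big_ord0 subrr.
  by rewrite big_ord_recr/= -ih addrA subrK.
have -> : (fun z => mollify_shift f K h (tau l a) (nu l a) z -
    mollify_shift f K h (tau l (a + n%:R * ln 2)) (nu l (a + n%:R * ln 2)) z) =
    (fun z => \sum_(k < n) (W k z - W k.+1 z)).
  by apply/funext => z; rewrite -tele /W /a_ mul0r addr0.
apply: Nle_weaken (Nle_sum q1 (F := fun k z => W k z - W k.+1 z) (fun k _ => stepN k)) => //.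
rewrite -mulr_sumr [leRHS](_ : _ = c * E * (eucl h `^ s * G)); last by ring.
apply: ler_wpM2l; first exact: mulr_ge0 c0 E0.
rewrite -ler_pdivrMl ?powR_gt0// mulr_sumr.
have esE : eucl h `^ s = expR (s * ln (eucl h)) by rewrite -{1}(lnK (x := eucl h)) ?posrE// -expRM mulrC.
apply: (two_sided_geometric (J := J) x1 y01
  (t := fun k => (eucl h `^ s)^-1 * (Num.min 1 (eucl h / expR (a_ k)) * expR (s * a_ k)))).
- move=> k; apply: (@le_trans _ _ ((eucl h `^ s)^-1 * (1 * expR (s * a_ k)))).
    by rewrite ler_wpM2l ?invr_ge0// ler_wpM2r ?expR_ge0// ge_min lexx.
  rewrite mul1r esE -!expRM_natl -!expRN -!expRD ler_expR /a_ /a.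
  rewrite le_eqVlt; apply/orP; left; apply/eqP; ring.
- move=> m; apply: (@le_trans _ _ ((eucl h `^ s)^-1 *
      (eucl h / expR (a_ (J + m)%N) * expR (s * a_ (J + m)%N)))).
    by rewrite ler_wpM2l ?invr_ge0// ler_wpM2r ?expR_ge0// ge_min lexx orbT.
  rewrite esE -{2}(lnK (x := eucl h)) ?posrE// -!expRM_natl -!expRN -!expRD ler_expR /a_ /a.
  rewrite natrD le_eqVlt; apply/orP; left; apply/eqP; ring.
Qed.

End scales.

(** * Exponents and interpolation *)

Section exponents.
Variables (R : realType) (x p q : R).
Hypotheses (x1 : 1 <= x) (p_lb : 2 - 2 / (3 * x + 2) < p) (p_ub : p < 2 + 2 / x).
Let p' := p / (p - 1).
Hypotheses (pq : p < q) (pq' : p' < q) (qbar : q < p * (4 * x + 2) / (x * (p + 2))).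
Let D := x * (p - 2) + 2 * p + 2.
(** Eliminating [s] from the two exponent identities gives [3 th - 1 = (2 / p - 1) (1 + x + (x - 1)
    th)], since [1 / p' = 1 - 1 / p]; this is the solution, and [q] has dropped out. *)
Let th := (2 * (x + 1) - x * p) / D.
Let s := (p * (4 * x + 2) - q * x * (p + 2)) / (q * D).
Let A1 : R := 1 - (x - 1) * (p^-1 - q^-1).
Let A2 : R := 2 + (x - 1) * (p'^-1 - q^-1).

Let x0 : 0 < x. Proof. exact: lt_le_trans ltr01 x1. Qed.

Let x32 : 0 < 3 * x + 2. Proof. have := x0; lra. Qed.

(** For [p > 1] this is equivalent to [p' < qbar], where [qbar = p (4 x + 2) / (x (p + 2))]. *)
Let H1 : 6 * x + 2 < p * (3 * x + 2).
Proof.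
rewrite -ltr_pdivrMr//; apply: le_lt_trans p_lb; rewrite le_eqVlt; apply/orP; left; apply/eqP.
by field; rewrite lt0r_neq0.
Qed.

(** This says [p < qbar], and equally that the numerator of [th] is positive. *)
Let H2 : x * p < 2 * x + 2.
Proof.
rewrite -ltr_pdivlMl//; apply: lt_le_trans p_ub _; rewrite le_eqVlt; apply/orP; left; apply/eqP.
by field; rewrite lt0r_neq0.
Qed.

Lemma exponent_p_gt1 : 1 < p.
Proof. by rewrite -(ltr_pM2r x32); apply: le_lt_trans H1; rewrite mul1r; have := x0; lra. Qed.

Let p0 : 0 < p. Proof. exact: lt_trans ltr01 exponent_p_gt1. Qed.
Let pm1 : 0 < p - 1. Proof. by rewrite subr_gt0 exponent_p_gt1. Qed.
Let q0 : 0 < q. Proof. exact: lt_trans pq. Qed.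

Lemma exponent_p'_ge1 : 1 <= p'.
Proof. by rewrite /p' ler_pdivlMr// mul1r gerBl. Qed.

Let D0 : 0 < D.
Proof.
rewrite -(pmulr_lgt0 _ x32).
(* The positive excess of [H1] is factored out so that the remainder is visibly positive; [H3] uses
   the same device. *)
have -> : D * (3 * x + 2) = (p * (3 * x + 2) - (6 * x + 2)) * (x + 2) + (16 * x + 8).
  by rewrite /D; ring.
apply: addr_gt0; last by have := x0; lra.
by apply: mulr_gt0; [rewrite subr_gt0|have := x0; lra].
Qed.

Let H3 : 4 * x < (2 * x + 2) * p.
Proof.
rewrite -subr_gt0 -(pmulr_lgt0 _ x32).
have -> : ((2 * x + 2) * p - 4 * x) * (3 * x + 2) =
  (p * (3 * x + 2) - (6 * x + 2)) * (2 * x + 2) + (8 * x + 4) by ring.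
apply: addr_gt0; last by have := x0; lra.
by apply: mulr_gt0; [rewrite subr_gt0|have := x0; lra].
Qed.

Lemma exponent_theta : 0 < th < 1.
Proof.
apply/andP; split; first by rewrite divr_gt0// subr_gt0; have := H2; lra.
rewrite ltr_pdivrMr// mul1r /D -subr_gt0.
have -> : x * (p - 2) + 2 * p + 2 - (2 * (x + 1) - x * p) = (2 * x + 2) * p - 4 * x by ring.
by rewrite subr_gt0.
Qed.

Let xp2 : 0 < x * (p + 2). Proof. by rewrite mulr_gt0// addr_gt0. Qed.

Let Hq : q * (x * (p + 2)) < p * (4 * x + 2).
Proof. by rewrite -ltr_pdivlMr. Qed.

(** Positivity is [q < qbar]; the upper bound combines [p < q] with [H3], the inequality behind
    [th < 1]. *)
Lemma exponent_s : 0 < s < 1.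
Proof.
apply/andP; split.
  by rewrite divr_gt0 ?mulr_gt0// subr_gt0 -mulrA.
rewrite ltr_pdivrMr ?mulr_gt0// mul1r ltrBlDr.
have -> : q * D + q * x * (p + 2) = q * ((2 * x + 2) * p + 2) by rewrite /D; ring.
have H : 4 * x + 2 < (2 * x + 2) * p + 2 by rewrite ltrD2r.
by apply: ltr_pM => //; [exact: ltW|rewrite addr_ge0// mulr_ge0// ltW].
Qed.

Lemma exponent_identity : th - (p^-1 - q^-1) * (1 + x - th + th * x) = s.
Proof. by rewrite /th /s /D; field; rewrite !lt0r_neq0. Qed.

Lemma exponent_identity' : 1 - 2 * th - (p'^-1 - q^-1) * (1 + x - th + th * x) = s.
Proof. by rewrite /th /s /p' /D; field; rewrite !lt0r_neq0. Qed.

(** The numerator is affine in [q]. For [x - 1 <= p] its sign is plain; otherwise it decreases in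
    [q], and at the excluded endpoint [qbar] it is a positive multiple of [D]. *)
Lemma exponent_A1 : 0 < A1.
Proof.
have -> : A1 = ((x - 1) * p - q * (x - 1 - p)) / (p * q).
  by rewrite /A1; field; rewrite !lt0r_neq0.
rewrite divr_gt0 ?mulr_gt0// subr_gt0.
have xm1 : 0 <= x - 1 by rewrite subr_ge0.
have [e0|e0] := ltP 0 (x - 1 - p); last first.
  have [->|xn1] := eqVneq x 1.
    by rewrite subrr mul0r sub0r mulrN oppr_lt0 mulr_gt0.
  apply: (@le_lt_trans _ _ 0); first by rewrite mulr_ge0_le0// ltW.
  by rewrite mulr_gt0// lt0r xm1 andbT subr_eq0.
rewrite -(ltr_pM2r xp2).
apply: (@lt_le_trans _ _ (p * (4 * x + 2) * (x - 1 - p))).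
  by rewrite mulrAC ltr_pM2r.
rewrite -subr_ge0.
have -> : (x - 1) * p * (x * (p + 2)) - p * (4 * x + 2) * (x - 1 - p) =
  p * ((x + 1) * D) by rewrite /D; ring.
by apply: mulr_ge0; rewrite ?(ltW p0)// mulr_ge0 ?(ltW D0)// addr_ge0// ltW.
Qed.

Lemma exponent_A2 : 0 < A2.
Proof.
have p'0 : 0 < p' by exact: lt_le_trans ltr01 exponent_p'_ge1.
apply: (@lt_le_trans _ _ 2) => //; rewrite /A2 lerDl.
by apply: mulr_ge0; rewrite subr_ge0// lef_pV2 ?posrE// ltW.
Qed.

(** Balancing [e^(A1 l) X] against [e^(-A2 l) Y] gives [X] the exponent [A2 / (A1 + A2)]; in the sum
    [A1 + A2] the [q] terms cancel. *)
Lemma exponent_alpha :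
  (3 * x + 1) / (4 * x + 2) - (x - 1) / (4 * x + 2) * s = A2 / (A1 + A2).
Proof.
have -> : A1 + A2 = D / p by rewrite /A1 /A2 /p' /D; field; rewrite !lt0r_neq0.
have x42 : 0 < 4 * x + 2 by have := x0; lra.
by rewrite /A2 /s /p' /D; field; rewrite !lt0r_neq0.
Qed.

End exponents.

(** * Norms, optimisation in [l] and conclusion *)

Section norms.
Variables (R : realType) (n : nat).
Local Notation Z := (n.-tuple R).
Local Notation mu := (lebn R n).

Lemma Ipow_Lpfin p (u : Z -> R) : measurable_fun setT u -> (Ipow p u < +oo)%E -> Lpfin p u.
Proof. by move=> mu_; rewrite Ipow_int. Qed.

Lemma Lp_normE p (u : Z -> R) X : measurable_fun setT u -> 0 < p -> 0 <= X ->
  (\int[mu]_z ((`|u z|) `^ p)%:E = (X `^ p)%:E)%E -> Lp_norm p u = X%:E.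
Proof.
move=> mu_ p0 X0 H; rewrite /Lp_norm Ipow_int// H poweR_EFin -powRrM mulfV ?powRr1//.
by rewrite lt0r_neq0.
Qed.

Lemma Lp_norm_le p (u : Z -> R) b : measurable_fun setT u -> 0 < p -> 0 <= b ->
  (\int[mu]_z ((`|u z|) `^ p)%:E <= (b `^ p)%:E)%E -> (Lp_norm p u <= b%:E)%E.
Proof.
move=> mu_ p0 b0 H; rewrite /Lp_norm Ipow_int//.
have -> : b%:E = (((b `^ p)%:E : \bar R) `^ p^-1)%E.
  by rewrite poweR_EFin -powRrM mulfV ?powRr1// lt0r_neq0.
have I0 : (0 <= \int[mu]_z ((`|u z|) `^ p)%:E)%E.
  by apply: integral_ge0 => z _; rewrite lee_fin powR_ge0.
apply: gt0_ler_poweR => //; first by rewrite invr_ge0 ltW.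
  by rewrite in_itv/= I0 leey.
by rewrite in_itv/= lee_fin powR_ge0 leey.
Qed.

Lemma eucl_gt0 (d : nat) (h : d.-tuple R) : h != [tuple 0 | _ < d] -> 0 < eucl h.
Proof.
move=> h0; rewrite lt0r sqrtr_ge0 andbT; apply: contra h0 => /eqP e0.
apply/eqP/eq_from_tnth => i; rewrite tnth_mktuple; apply/eqP.
by rewrite -normr_le0 -e0; exact: ler_eucl.
Qed.

End norms.

(* Balancing the two terms: l = ln (Y / X) / (A1 + A2) if X, Y > 0; otherwise one
   term vanishes and the other tends to 0. *)
Lemma interpolation_optimum (R : realType) (c A1 A2 X Y b : R) :
  0 < c -> 0 < A1 -> 0 < A2 -> 0 <= X -> 0 <= Y -> 0 < b ->
  3 * c * (X `^ (A2 / (A1 + A2)) * Y `^ (1 - A2 / (A1 + A2))) <= b ->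
  exists l, c * (expR (A1 * l) * X + expR (- A2 * l) * Y) < b.
Proof.
move=> c0 A10 A20; have A0 : 0 < A1 + A2 by exact: addr_gt0.
have vanish A Q : 0 < A -> 0 <= Q -> 0 < b -> exists l, c * (expR (- A * l) * Q) < b.
  move=> A_gt0 Q0 b0; have k0 : 0 < c * Q + 1 by rewrite ltr_wpDl// mulr_ge0// ltW.
  (* Makes the exponential equal to [b / (c Q + 1)], which suffices because [c Q < c Q + 1]. *)
  exists (- ln (b / (c * Q + 1)) / A).
  rewrite (_ : - A * _ = ln (b / (c * Q + 1))); last by field; rewrite lt0r_neq0.
  rewrite lnK ?posrE ?divr_gt0//.
  rewrite (_ : c * _ = b * (c * Q) / (c * Q + 1)); last by field; exact: lt0r_neq0.
  by rewrite ltr_pdivrMr// ltr_pM2l// ltrDl.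
rewrite le_eqVlt => /predU1P[<- Y0 b0 _|X0].
  have [l Hl] := vanish A2 Y A20 Y0 b0.
  by exists l; rewrite mulr0 add0r.
rewrite le_eqVlt => /predU1P[<- b0 _|Y0].
  have [l Hl] := vanish A1 X A10 (ltW X0) b0.
  by exists (- l); rewrite mulr0 addr0 mulrN -mulNr.
move=> b0 Hb; exists ((ln Y - ln X) / (A1 + A2)); set l := _ / _.
set T := _ * _ `^ _ in Hb.
have T0 : 0 < T by rewrite mulr_gt0// powR_gt0.
have TE : T = expR (A2 / (A1 + A2) * ln X + (1 - A2 / (A1 + A2)) * ln Y).
  by rewrite expRD [_ * ln X]mulrC [_ * ln Y]mulrC !expRM !lnK ?posrE.
have E1 : expR (A1 * l) * X = T.
  rewrite -{1}[X]lnK ?posrE// -expRD TE; congr expR; rewrite /l; field; exact: lt0r_neq0.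
have E2 : expR (- A2 * l) * Y = T.
  rewrite -{1}[Y]lnK ?posrE// -expRD TE; congr expR; rewrite /l; field; exact: lt0r_neq0.
(* Both terms equal [T] at this [l]; the constant 3 in place of 2 makes the inequality strict. *)
rewrite E1 E2; apply: lt_le_trans Hb; rewrite -mulrA [ltRHS]mulrCA ltr_pM2l//; lra.
Qed.

Unset Implicit Arguments.

Theorem theorem1p8 (R : realType) (d : nat) (p q : R) :
  (0 < d)%N ->
  2 - 2 / (3 * d + 2)%:R < p < 2 + 2 / d%:R ->
  let p' := p / (p - 1) in
  let qbar := p * (4 * d + 2)%:R / (d%:R * (p + 2)) in
  Num.max p p' < q < qbar ->
  let s := (p * (4 * d + 2)%:R - q * d%:R * (p + 2))
           / (q * (d%:R * (p - 2) + 2 * p + 2)) in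
  let alpha := (3 * d + 1)%:R / (4 * d + 2)%:R
               - (d%:R - 1) / (4 * d + 2)%:R * s in
  exists2 C : R, 0 < C &
    forall (f : (1 + d + d).-tuple R -> R)
           (gradvf S0 : 'I_d -> (1 + d + d).-tuple R -> R),
      measurable_fun setT f -> (Ipow 2 f < +oo)%E ->
      (forall i, measurable_fun setT (gradvf i)) ->
      weak_grad_v f gradvf -> (Ipow p (vnorm gradvf) < +oo)%E ->
      (forall i, measurable_fun setT (S0 i)) ->
      (Ipow p' (vnorm S0) < +oo)%E ->
      kinetic_eq f S0 ->
      forall h : d.-tuple R, h != [tuple 0 | _ < d] ->
        (Lp_norm q (Delta_x h f)
         <= (C * eucl h `^ s)%:E
            * (Lp_norm p (vnorm gradvf) `^ alpha)
            * (Lp_norm p' (vnorm S0) `^ (1 - alpha)))%E.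
Proof.
move=> d0; have x1 : 1 <= d%:R :> R by rewrite ler1n.
have E32 : (3 * d + 2)%:R = 3 * d%:R + 2 :> R by rewrite natrD natrM.
have E42 : (4 * d + 2)%:R = 4 * d%:R + 2 :> R by rewrite natrD natrM.
have E31 : (3 * d + 1)%:R = 3 * d%:R + 1 :> R by rewrite natrD natrM.
rewrite E32 E42 E31 => /andP[p_lb p_ub] p' qbar /andP[]; rewrite gt_max => /andP[pq pq'] qq s alpha.
have p1 : 1 < p := exponent_p_gt1 x1 p_lb.
have p1' : 1 <= p' := exponent_p'_ge1 x1 p_lb.
have s01 : 0 < s < 1 := exponent_s x1 p_lb pq qq.
have A10 := exponent_A1 x1 p_lb pq qq.
have A20 := exponent_A2 x1 p_lb pq pq'.
have aE : alpha = _ := exponent_alpha x1 p_lb pq.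
have p0 : 0 < p by exact: lt_trans ltr01 p1.
have p0' : 0 < p' by exact: lt_le_trans ltr01 p1'.
have q0 : 0 < q by exact: lt_trans pq.
have [C C0 HC] := Delta_scale_bound (exponent_theta x1 p_lb p_ub) s01 (ltW p1) p1' pq pq'
  (exponent_identity x1 p_lb pq) (exponent_identity' x1 p_lb pq).
exists (3 * C); first exact: mulr_gt0.
move=> f g S mf /(Ipow_Lpfin mf) hf mg wg /(Ipow_Lpfin (measurable_vnorm mg)) hg mS
  /(Ipow_Lpfin (measurable_vnorm mS)) hS ke h /eucl_gt0 h0.
have [X X0 gX] := Lpfin_norm p0 hg; have [Y Y0 SY] := Lpfin_norm p0' hS.
rewrite (Lp_normE (measurable_vnorm mg) p0 X0 gX) (Lp_normE (measurable_vnorm mS) p0' Y0 SY).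
(* A strict and positive bound is required below, and when exactly one of [X], [Y] vanishes the
   infimum over [l] is not attained; hence the estimate by [T + e] for every [e > 0]. *)
rewrite !poweR_EFin -!EFinM; apply/lee_addgt0Pr => e e0; rewrite -EFinD.
set T := _ * Y `^ _.
have T0 : 0 <= T by rewrite !mulr_ge0 ?powR_ge0// ltW.
have b0 : 0 < T + e by rewrite ltr_wpDl.
have c0 : 0 < C * eucl h `^ s by rewrite mulr_gt0// powR_gt0.
have [|l Hl] := interpolation_optimum c0 A10 A20 X0 Y0 b0.
  by rewrite -aE /T !mulrA lerDl ltW.
apply: (Lp_norm_le (Lpfin_Delta h hf).1 q0 (ltW b0)).
exact: (HC f g S X Y h l _ hf mg mS hg hS wg ke X0 Y0 gX SY h0 Hl).
Qed.
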